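(* Let $\mathcal{G}$ be an \'etale groupoid with the Fourier coefficients approximation property, let $\Gamma$ be a countable infinite nonabelian group with identity $e$, let $c:\mathcal{G}\to\Gamma$ be a continuous $1$-cocycle, and put $\mathcal{G}_t=c^{-1}(t)$ for $t\in\Gamma$. Assume that the unit space $\mathcal{G}^{(0)}$ is totally disconnected, that $\Gamma$ has a subsemigroup $\mathcal{P}$ containing $e$ and satisfying $\Gamma=\mathcal{P}\mathcal{P}^{-1}=\mathcal{P}^{-1}\mathcal{P}$, and that the kernel $\mathcal{G}_e$ of $c$ is amenable and principal. Suppose that for each $p\in\mathcal{P}$ there exists a cover $\{U_{p,i}\mid i\in\Lambda_p\}$ of $\mathcal{G}_p$ by compact open bisections of $\mathcal{G}$ (with $U_{p,i}\subseteq\mathcal{G}_p$), such that the collection $$\{U_{p,i}U_{q,j}^{-1}\mid p,q\in\mathcal{P},\ i\in\Lambda_p,\ j\in\Lambda_q,\ s(U_{p,i})=s(U_{q,j})\}$$ forms an open cover of $\mathcal{G}$. Then a diagonal bimodule $M$ of $C_r^*(\mathcal{G})$ is spectral if and only if $M$ is $\delta_c$-invariant.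
   Context: An \'etale groupoid means a second countable, locally compact, Hausdorff topological groupoid $\mathcal{G}$ whose range and source maps $r,s:\mathcal{G}\to\mathcal{G}^{(0)}$ are local homeomorphisms; $\mathcal{G}^{(0)}$ is the unit space. A bisection is a subset of $\mathcal{G}$ on which both $r$ and $s$ are injective. $\mathcal{G}$ is principal if every $\gamma$ with $r(\gamma)=s(\gamma)$ is a unit; amenability is (topological) amenability. For $A,B\subseteq\mathcal{G}$, $AB=\{\alpha\beta:\alpha\in A,\beta\in B,s(\alpha)=r(\beta)\}$ and $A^{-1}=\{\alpha^{-1}:\alpha\in A\}$. $C_c(\mathcal{G})$ is a $*$-algebra with $f^*(\gamma)=\overline{f(\gamma^{-1})}$ and $(fg)(\gamma)=\sum_{\gamma'\in s^{-1}(s(\gamma))}f(\gamma\gamma'^{-1})g(\gamma')$; $C_r^*(\mathcal{G})$ is its completion in the norm $\|f\|_{\mathrm{red}}=\sup_{u\in\mathcal{G}^{(0)}}\|\mathrm{Ind}_u(f)\|$, where $\mathrm{Ind}_u(f)\xi(\gamma)=\sum_{\gamma'\in s^{-1}(u)}f(\gamma\gamma'^{-1})\xi(\gamma')$ on $\ell^2(s^{-1}(u))$. The inclusion $C_c(\mathcal{G})\subseteq C_0(\mathcal{G})$ extends to a norm-decreasing injective linear map $j:C_r^*(\mathcal{G})\to C_0(\mathcal{G})$, and each $a\in C_r^*(\mathcal{G})$ is identified with the function $j(a)$; write $a(\gamma)=j(a)(\gamma)$ and $\mathrm{supp}'(a)=\{\gamma\in\mathcal{G}:a(\gamma)\neq0\}$.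 $C_0(\mathcal{G}^{(0)})$ is regarded as a $C^*$-subalgebra of $C_r^*(\mathcal{G})$. For open $P\subseteq\mathcal{G}$, $C_c(P)\subseteq C_c(\mathcal{G})$ via extension by zero. A diagonal bimodule of $C_r^*(\mathcal{G})$ is a norm closed subspace $M$ such that $ab,ba\in M$ for all $a\in M$, $b\in C_0(\mathcal{G}^{(0)})$. Its spectrum is $\sigma(M)=\{\gamma\in\mathcal{G}:a(\gamma)\ne0\text{ for some }a\in M\}$. For open $P\subseteq\mathcal{G}$, $A(P)=\{a\in C_r^*(\mathcal{G}):a(\gamma)=0\text{ for all }\gamma\notin P\}$ (so $A(\emptyset)=\{0\}$). $M$ is spectral if $M=A(\sigma(M))$. $\mathcal{G}$ has the Fourier coefficients approximation property if $a\in\overline{C_c(\mathrm{supp}'(a))}$ (closure in the reduced norm) for all $a\in C_r^*(\mathcal{G})$. A continuous $1$-cocycle is a continuous groupoid homomorphism $c:\mathcal{G}\to\Gamma$ ($\Gamma$ discrete). Let $\lambda$ be the left regular representation of $\Gamma$ on $\ell^2(\Gamma)$. The cocycle induces a coaction $\delta_c:C_r^*(\mathcal{G})\to C_r^*(\mathcal{G})\otimes_{\min}C_r^*(\Gamma)$, the nondegenerate $*$-homomorphism determined by $\delta_c(f)=f\otimes\lambda_t$ for $f\in C_c(\mathcal{G})$ with $\mathrm{supp}(f)\subseteq c^{-1}(t)$, $t\in\Gamma$. A closed subspace $M$ is $\delta_c$-invariant if $\delta_c(M)\subseteq M\otimes_{\min}C_r^*(\Gamma)$, where $M\otimes_{\min}C_r^*(\Gamma)=\overline{\mathrm{span}}\{a\otimes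 b: a\in M,b\in C_r^*(\Gamma)\}$. *)

(* Defs.v *)
From HB Require Import structures.
From mathcomp Require Import all_boot all_order all_algebra.
From mathcomp Require Import finmap.
From mathcomp Require Import all_classical all_reals all_analysis.
From mathcomp Require Import complex ring lra.

Set Implicit Arguments.
Unset Strict Implicit.
Unset Printing Implicit Defensive.

Import Order.TTheory GRing.Theory Num.Theory.
Import ComplexField.Normc.
Import numFieldNormedType.Exports.

Local Open Scope classical_set_scope.
Local Open Scope ring_scope.
Local Open Scope complex_scope.

Section l2_space.
Context (R : realType) (X : choiceType).
Implicit Types (f g : X -> R[i]).

Definition sqsum f : \bar R := (\esum_(x in [set: X]) (normc (f x) ^+ 2)%:E)%E.

Definition sqsummable : {pred X -> R[i]} := fun f => (sqsum f < +oo)%E.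

Lemma sqsum_ge0 f : (0 <= sqsum f)%E.
Proof. by apply: esum_ge0 => x _; rewrite lee_fin sqr_ge0. Qed.

Let normc_ge0 (z : R[i]) : 0 <= normc z.
Proof. by case: z => a b; rewrite /= sqrtr_ge0. Qed.

Lemma sqsummable_submod_closed : submod_closed sqsummable.
Proof.
split=> [|k f g].
  rewrite /in_mem/= /sqsummable /sqsum esum1 ?ltry// => x _.
  by rewrite normc0 expr0n.
rewrite /in_mem/= /sqsummable => ff gg.
set K := (normc k ^+ 2 *+ 2); set L : R := 2.
have K0 : 0 <= K by rewrite mulrn_wge0// sqr_ge0.
apply: (@le_lt_trans _ _ (K%:E * sqsum f + L%:E * sqsum g)%E); last first.
  by rewrite lte_add_pinfty// lte_mul_pinfty ?lee_fin ?sqsum_ge0.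
have mulE (c : R) (h : X -> R[i]) : 0 <= c ->
    (\esum_(x in [set: X]) (c * normc (h x) ^+ 2)%:E <= c%:E * sqsum h)%E.
  move=> c0; apply: ge_ereal_sup => _ [A [finA AX] <-].
  under eq_fsbigr do rewrite EFinM.
  rewrite -ge0_mule_fsumr; last by move=> x; rewrite lee_fin sqr_ge0.
  by rewrite lee_wpmul2l ?lee_fin// /sqsum; apply: ereal_sup_ubound; exists A.
apply: (le_trans _ (leeD (mulE K f K0) (mulE L g _))); last by [].
rewrite -esumD; [|by move=> x _; rewrite lee_fin mulr_ge0// ?sqr_ge0..].
apply: le_esum => x _ /=; rewrite -EFinD lee_fin.
rewrite (_ : (k *: f + g) x = k * f x + g x)//.
apply: (@le_trans _ _ ((normc k * normc (f x) + normc (g x)) ^+ 2)).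
  rewrite ler_sqr ?nnegrE ?addr_ge0 ?mulr_ge0 ?normc_ge0//.
  by rewrite -normcM; exact: (@le_normcD R).
rewrite /K /L mulr2n; set a := normc k; set b := normc _; set c := normc _.
have := sqr_ge0 (a * b - c).
rewrite -subr_ge0; set u := (X in 0 <= X -> _) => u0.
by rewrite (_ : _ - _ = u)// /u; ring.
Qed.

HB.instance Definition _ :=
  GRing.isSubmodClosed.Build _ _ sqsummable sqsummable_submod_closed.

Record l2 := L2 { l2val :> X -> R[i]; _ : l2val \in sqsummable }.

HB.instance Definition _ := [isSub of l2 for l2val].
HB.instance Definition _ := [Choice of l2 by <:].
HB.instance Definition _ := [SubChoice_isSubLmodule of l2 by <:].

End l2_space.

Section l2_operators.
Context (R : realType).
Implicit Types (X Y : choiceType).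

Definition l2norm X (xi : l2 R X) : R := Num.sqrt (fine (sqsum xi)).

(* Only meaningful for absolutely summable families. *)
Definition rsum X (F : X -> R) : R :=
  fine (\esum_(x in [set: X]) (Num.max (F x) 0)%:E)
  - fine (\esum_(x in [set: X]) (Num.max (- F x) 0)%:E).

Definition csum X (F : X -> R[i]) : R[i] :=
  rsum (fun x => complex.Re (F x)) +i* rsum (fun x => complex.Im (F x)).

Definition inner X (xi eta : l2 R X) : R[i] :=
  csum (fun x => xi x * (eta x)^*).

(* [f] viewed in l^2(X), with default value 0 when [f] is not square summable.
   The default is never taken in the uses below, see [tensor_vecE], [left_regE]
   and [IndE]. *)
Definition mkl2 X (f : X -> R[i]) : l2 R X := insubd (0 : l2 R X) f.

Definition basis_vec X (x : X) : l2 R X :=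
  mkl2 (fun y => if y == x then 1 else 0).

Definition bounded_op X (a : l2 R X -> l2 R X) : Prop :=
  linear a /\ exists k : R, forall xi, l2norm (a xi) <= k * l2norm xi.

Definition opnorm X (a : l2 R X -> l2 R X) : \bar R :=
  ereal_sup [set (l2norm (a xi))%:E | xi in [set xi | l2norm xi <= 1]].

Definition adjoint X (a b : l2 R X -> l2 R X) : Prop :=
  forall xi eta, inner (a xi) eta = inner xi (b eta).

(* Closure in the operator norm, taken in B(l^2(X)). *)
Definition op_closure X (S : set (l2 R X -> l2 R X)) : set (l2 R X -> l2 R X) :=
  [set a : l2 R X -> l2 R X | bounded_op a /\
     forall eps : R, 0 < eps -> exists2 b, S b & (opnorm (a - b)%R < eps%:E)%E].

Definition op_subspace X (S : set (l2 R X -> l2 R X)) : Prop :=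
  S 0 /\ forall (k : R[i]) a b, S a -> S b -> S (k *: a + b).

Definition op_span X (S : set (l2 R X -> l2 R X)) : set (l2 R X -> l2 R X) :=
  smallest (@op_subspace X) S.

(* The identification of l^2(X) (x) l^2(Y) with l^2(X * Y). *)
Definition tensor_vec X Y (xi : l2 R X) (eta : l2 R Y) : l2 R (X * Y)%type :=
  mkl2 (fun p => xi p.1 * eta p.2).

Definition is_tensor X Y (a : l2 R X -> l2 R X) (b : l2 R Y -> l2 R Y)
    (T : l2 R (X * Y)%type -> l2 R (X * Y)%type) : Prop :=
  bounded_op T /\
  forall xi eta, T (tensor_vec xi eta) = tensor_vec (a xi) (b eta).

(* The minimal C*-tensor norm of concrete operator algebras is the spatial one,
   that is, the operator norm on l^2(X * Y). *)
Definition min_tensor X Y (M : set (l2 R X -> l2 R X))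
    (N : set (l2 R Y -> l2 R Y)) : set (l2 R (X * Y)%type -> l2 R (X * Y)%type) :=
  op_closure (op_span
    [set T | exists a b, [/\ M a, N b & is_tensor a b T]]).

End l2_operators.

Section group_algebra.
Context (R : realType) (Gamma : groupType).

Definition left_reg (t : Gamma) (xi : l2 R Gamma) : l2 R Gamma :=
  mkl2 (fun g => xi (t^-1 * g)%g).

Definition group_Cstar_red : set (l2 R Gamma -> l2 R Gamma) :=
  op_closure (op_span (range left_reg)).

End group_algebra.

(* A groupoid is given by its arrows, units being identified with identity
   arrows. [gmul x y] is total, but only meaningful when [src x = rng y]. *)
HB.mixin Record isGroupoid (T : Type) := {
  src : T -> T;
  rng : T -> T;
  ginv : T -> T;
  gmul : T -> T -> T;
  src_src : forall x, src (src x) = src x;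
  rng_src : forall x, rng (src x) = src x;
  src_rng : forall x, src (rng x) = rng x;
  rng_rng : forall x, rng (rng x) = rng x;
  src_mul : forall x y, src x = rng y -> src (gmul x y) = src y;
  rng_mul : forall x y, src x = rng y -> rng (gmul x y) = rng x;
  gmulA : forall x y z, src x = rng y -> src y = rng z ->
    gmul x (gmul y z) = gmul (gmul x y) z;
  gmul_src : forall x, gmul x (src x) = x;
  gmul_rng : forall x, gmul (rng x) x = x;
  src_inv : forall x, src (ginv x) = rng x;
  rng_inv : forall x, rng (ginv x) = src x;
  gmulVx : forall x, gmul (ginv x) x = src x;
  gmulxV : forall x, gmul x (ginv x) = rng x
}.

#[short(type="groupoidType")]
HB.structure Definition Groupoid := { T of isGroupoid T }.

Definition units (G : groupoidType) : set G := [set x | src x = x].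

Definition composable (G : groupoidType) : set (G * G) :=
  [set p | src p.1 = rng p.2].

(* [f] is a local homeomorphism of [T] onto open pieces of the subspace [Y]. *)
Definition local_homeo_into (T : topologicalType) (Y : set T) (f : T -> T) :=
  forall x, exists U : set T, [/\ open U, U x, {within U, continuous f},
    set_inj U f &
    forall V, open V -> V `<=` U ->
      exists W, open W /\ f @` V = W `&` Y].

HB.mixin Record isEtale T of Topological T & isGroupoid T := {
  ginv_continuous : continuous (ginv : T -> T);
  gmul_continuous :
    {within @composable T, continuous (fun p : T * T => gmul p.1 p.2)};
  etale_second_countable : @second_countable T;
  etale_locally_compact : locally_compact [set: T];
  etale_hausdorff : hausdorff_space T;
  rng_local_homeo : local_homeo_into (@units T) (rng : T -> T);
  src_local_homeo : local_homeo_into (@units T) (src : T -> T)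
}.

#[short(type="etaleGroupoidType")]
HB.structure Definition EtaleGroupoid :=
  { T of Topological T & isGroupoid T & isEtale T }.

Section groupoid_sets.
Context (G : groupoidType).
Implicit Types (A B : set G).

Definition set_gmul A B : set G :=
  [set z | exists x y, [/\ A x, B y, src x = rng y & z = gmul x y]].

Definition set_ginv A : set G := [set ginv x | x in A].

Definition bisection A : Prop := set_inj A (@rng G) /\ set_inj A (@src G).

Definition principal_on A : Prop :=
  forall x, A x -> rng x = src x -> units x.

End groupoid_sets.

(* For a clopen subgroupoid [H] of [G] (such as [H = setT], or the kernel of a
   continuous cocycle), extension by zero identifies C_c(H) with the functions
   of C_c(G) whose support is contained in [H]. The sums run over H_(r(x)), and
   they are finite since the fibres of [src] are discrete. *)
Definition amenable_on (R : realType) (G : etaleGroupoidType) (H : set G) :=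
  forall (K : set G) (eps : R), compact K -> K `<=` H -> 0 < eps ->
  exists mu : G -> R,
    [/\ continuous mu, compact (closure [set y | mu y != 0]),
        closure [set y | mu y != 0] `<=` H, forall y, 0 <= mu y &
        forall x, K x ->
          `| \sum_(y \in H `&` [set y | src y = rng x]) mu y - 1 | < eps /\
          \sum_(y \in H `&` [set y | src y = rng x])
            `| mu y - mu (gmul y x) | < eps].

Section reduced_algebra.
Context (R : realType) (G : etaleGroupoidType).
Implicit Types (P : set G) (f : G -> R[i]) (M : set (l2 R G -> l2 R G)).

Definition supp f : set G := closure [set x | f x != 0].

(* C_c(P), extended by zero to [G]. *)
Definition Cc P : set (G -> R[i]) :=
  [set f | [/\ continuous (f : G -> R[i]^o), compact (supp f) & supp f `<=` P]].

(* The direct sum over all units [u] of the representations Ind_u, acting on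
   l^2(G) = (+)_u l^2(src^-1(u)); its operator norm is sup_u ||Ind_u f||. *)
Definition Ind f (xi : l2 R G) : l2 R G :=
  mkl2 (fun x => \sum_(y \in [set y | src y = src x])
                   f (gmul x (ginv y)) * xi y).

(* The completion of C_c(G) in the reduced norm, realized as the norm closure
   of its image under [Ind]. *)
Definition Cstar_red : set (l2 R G -> l2 R G) := op_closure [set Ind f | f in Cc setT].

(* The unique continuous extension of C_c(G) -> C_0(G): by [jmap_Ind] and
   [jmap_le] below, it extends the inclusion and is norm-decreasing. *)
Definition jmap (a : l2 R G -> l2 R G) (x : G) : R[i] :=
  a (basis_vec R (src x)) x.

Definition supp' (a : l2 R G -> l2 R G) : set G := [set x | jmap a x != 0].

(* C_0 of the unit space, extended by zero to [G]. *)
Definition C0_units : set (G -> R[i]) :=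
  [set b | [/\ {within @units G, continuous (b : G -> R[i]^o)},
     forall x, ~ units x -> b x = 0 &
     forall eps : R, 0 < eps -> compact [set x | units x /\ eps <= normc (b x)]]].

Definition diagonal_bimodule M : Prop :=
  [/\ M `<=` Cstar_red, op_subspace M, op_closure M `<=` M &
      forall a b, M a -> C0_units b -> M (a \o Ind b) /\ M (Ind b \o a)].

Definition spectrum M : set G := [set x | exists2 a, M a & jmap a x != 0].

Definition spectral_subspace P : set (l2 R G -> l2 R G) :=
  [set a : l2 R G -> l2 R G | Cstar_red a /\ forall x, ~ P x -> jmap a x = 0].

Definition spectral M : Prop := M = spectral_subspace (spectrum M).

Definition Fourier_approximation : Prop :=
  forall a, Cstar_red a -> op_closure [set Ind f | f in Cc (supp' a)] a.

End reduced_algebra.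

Section l2_theory.
Context (R : realType).
Implicit Types (X Y : choiceType).

Lemma mkl2E X (f : X -> R[i]) : (sqsum f < +oo)%E -> mkl2 f = f :> (X -> R[i]).
Proof. move=> fX; exact: (@insubdK _ (@sqsummable R X) (l2 R X) 0 f fX). Qed.

Lemma sqsum_l2 X (xi : l2 R X) : (sqsum xi < +oo)%E.
Proof. exact: valP xi. Qed.

Lemma sqsum_le_inj X Y (D : set X) (e : X -> Y) (f : Y -> R[i]) :
  set_inj D e ->
  (\esum_(x in D) (normc (f (e x)) ^+ 2)%:E <= sqsum f)%E.
Proof.
move=> eD; rewrite -(esum_image D e (fun y => (normc (f y) ^+ 2)%:E) eD).
rewrite /sqsum esum_mkcond; apply: le_esum => y _.
by case: ifP => _; rewrite lee_fin ?sqr_ge0.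
Qed.

Lemma left_regE (Gamma : groupType) (t : Gamma) (xi : l2 R Gamma) g :
  left_reg t xi g = xi (t^-1 * g)%g.
Proof.
rewrite /left_reg mkl2E//; apply: le_lt_trans (sqsum_l2 xi).
apply: (@sqsum_le_inj _ _ setT (fun g => (t^-1 * g)%g)).
by move=> x y _ _ /=; exact: mulgI.
Qed.

Lemma basis_vecE X (x y : X) :
  basis_vec R x y = if y == x then 1 else 0.
Proof.
rewrite /basis_vec mkl2E// /sqsum.
rewrite [X in (X < _)%E](_ : _ = \esum_(y in [set x]) 1%:E)%E.
  by rewrite esum_set1 ?lee_fin// ltry.
rewrite [RHS]esum_mkcond; apply: eq_esum => z _; rewrite in_set1.
by case: eqP => _; rewrite ?normc1 ?normc0 ?expr1n ?expr0n.
Qed.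

Lemma ge0_esumZl X (c : R) (h : X -> R) : 0 <= c -> (forall x, 0 <= h x) ->
  (\esum_(x in [set: X]) (c * h x)%:E <= c%:E * \esum_(x in [set: X]) (h x)%:E)%E.
Proof.
move=> c0 h0; apply: ge_ereal_sup => _ [A [finA AX] <-].
under eq_fsbigr do rewrite EFinM.
rewrite -ge0_mule_fsumr; last by move=> x; rewrite lee_fin.
by rewrite lee_wpmul2l ?lee_fin//; apply: ereal_sup_ubound; exists A.
Qed.

Lemma tensor_vecE X Y (xi : l2 R X) (eta : l2 R Y) p :
  tensor_vec xi eta p = xi p.1 * eta p.2.
Proof.
rewrite /tensor_vec mkl2E// /sqsum.
have -> : [set: X * Y] = [set: X] `*`` (fun=> [set: Y]).
  by apply/seteqP; split=> // -[].
under eq_esum do rewrite normcM exprMn.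
rewrite -(@esum_esum _ _ _ _ _ (fun x y =>
  (normc (xi x) ^+ 2 * normc (eta y) ^+ 2)%:E)); last first.
  by move=> i j _ _; rewrite lee_fin mulr_ge0 ?sqr_ge0.
set b := fine (sqsum eta).
have b0 : 0 <= b by rewrite fine_ge0// sqsum_ge0.
have bE : sqsum eta = b%:E.
  by rewrite fineK// ge0_fin_numE ?sqsum_ge0// sqsum_l2.
apply: (@le_lt_trans _ _ (b%:E * sqsum xi)%E); last first.
  by rewrite lte_mul_pinfty ?lee_fin ?sqsum_l2.
apply: le_trans (ge0_esumZl b0 (fun x => sqr_ge0 (normc (xi x)))).
apply: le_esum => x _; rewrite mulrC EFinM -bE.
by apply: ge0_esumZl => [|y]; rewrite sqr_ge0.
Qed.

Lemma normc_le_l2norm X (xi : l2 R X) x : normc (xi x) <= l2norm xi.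
Proof.
have n0 : 0 <= normc (xi x) by case: (xi x) => a b; rewrite sqrtr_ge0.
rewrite /l2norm -[leLHS](ger0_norm n0) -sqrtr_sqr; apply: ler_wsqrtr.
rewrite -lee_fin fineK; last by rewrite ge0_fin_numE ?sqsum_ge0 ?sqsum_l2.
apply: le_trans (@sqsum_le_inj _ _ [set x] id xi _) => //.
by rewrite esum_set1 ?lee_fin ?sqr_ge0.
Qed.

Lemma l2norm_basis_vec X (x : X) : l2norm (basis_vec R x) = 1.
Proof.
rewrite /l2norm /sqsum.
rewrite [X in fine X](_ : _ = \esum_(y in [set x]) 1%:E)%E.
  by rewrite esum_set1 ?lee_fin//= sqrtr1.
rewrite [RHS]esum_mkcond; apply: eq_esum => z _; rewrite basis_vecE in_set1.
by case: eqP => _; rewrite ?normc1 ?normc0 ?expr1n ?expr0n.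
Qed.

End l2_theory.

Section groupoid_theory.
Context (G : groupoidType).
Implicit Types x y z : G.

Lemma ginv_unit x : ginv (src x) = src x.
Proof.
by have := gmul_src (ginv (src x)); rewrite src_inv rng_src gmulVx src_src.
Qed.

Lemma ginvK x : ginv (ginv x) = x.
Proof.
rewrite -[LHS]gmul_src src_inv rng_inv -(gmulVx x).
rewrite gmulA ?src_inv ?rng_inv// gmulVx src_inv.
by rewrite gmul_rng.
Qed.

Lemma gmulK x y : src x = src y -> gmul (gmul x (ginv y)) y = x.
Proof.
by move=> xy; rewrite -gmulA ?rng_inv ?src_inv// gmulVx -xy gmul_src.
Qed.

Lemma gmulVK x y : src x = src y -> gmul (ginv (gmul x (ginv y))) x = y.
Proof.
move=> xy; set z := gmul x (ginv y).
have sz : src z = rng y by rewrite /z src_mul ?rng_inv// src_inv.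
have rz : rng z = rng x by rewrite /z rng_mul ?rng_inv.
rewrite -{1}(gmulK xy) -/z gmulA ?src_inv//.
by rewrite gmulVx sz gmul_rng.
Qed.

End groupoid_theory.

Section Ind_theory.
Context (R : realType) (G : etaleGroupoidType).
Implicit Types (f : G -> R[i]).

Lemma compact_coverT (T : topologicalType) (K : set T) :
  compact K -> cover_compact K.
Proof.
have [->|/set0P[x _]] := eqVneq K set0.
  by move=> _ I D F _ _; exists fset0%fset.
pose pT : ptopologicalType := HB.pack (T : Type) T (isPointed.Build T x).
move=> cK; have E := congr1 (fun P : set T -> Prop => P K) (@compact_cover pT).
exact: (eq_ind _ id cK _ E).
Qed.

Lemma Cc_cover f : Cc setT f -> exists (D : {fset G}) (U : G -> set G)
    (b : G -> R), [/\ forall p, 0 <= b p,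
    forall p, p \in D -> bisection (U p) /\ forall z, U p z -> normc (f z) <= b p &
    forall z, f z != 0 -> exists2 p, p \in D & U p z].
Proof.
move=> [cf /compact_coverT cK _].
have key (p : G) : exists U : set G, [/\ open U, U p, bisection U &
    forall z, U z -> normc (f z) <= normc (f p) + 1].
  have [U [oU Up _ Ui _]] := rng_local_homeo p.
  have [V [oV Vp _ Vi _]] := src_local_homeo p.
  have /cvgrPdist_lt/(_ 1 ltr01) := cf p.
  rewrite /= nbhsE => -[W [oW Wp] Wf].
  exists (U `&` V `&` W); split.
  - by apply: openI => //; exact: openI.
  - by [].
  - by split=> x y; rewrite !inE => -[[? ?] _] [[? ?] _];
      [apply: Ui|apply: Vi]; rewrite ?inE.
  - move=> z [_ /Wf /=] fz.
    have fzE : f z = f p - (f p - f z) by rewrite opprB addrC subrK.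
    rewrite [in X in X <= _]fzE.
    apply: (le_trans (le_normcD (f p : Rcomplex R) (- (f p - f z)))).
    rewrite (_ : normc (- _) = normc (f p - f z)); last first.
      by case: (f p - f z) => u v /=; rewrite !sqrrN.
    rewrite lerD2l; move: fz; rewrite normc_def ltcE /= => /andP[_ /ltW].
    by case: (f p - f z).
have {}key := choice key; case: key => U HU.
have [D _ HD] : finite_subset_cover setT U (supp f).
  apply: cK => [p _|z fz]; first by have [] := HU p.
  by exists z => //; have [] := HU z.
exists D, U, (fun p => normc (f p) + 1); split=> [p|p _|z fz].
- by rewrite addr_ge0//; case: (f p) => u v /=; rewrite sqrtr_ge0.
- by have [] := HU p.
- by have [|p pD Uz] := HD z; [exact: subset_closure|exists p].
Qed.

Definition fib f (x : G) : set G :=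
  [set y | src y = src x /\ f (gmul x (ginv y)) != 0].

Lemma fib_finite f x : Cc setT f -> finite_set (fib f x).
Proof.
move=> /Cc_cover[D [U [b [b0 Ub Uf]]]].
pose g p := xget x [set y | src y = src x /\ U p (gmul x (ginv y))].
apply: (@sub_finite_set _ _ (g @` [set` D])); last first.
  exact/finite_image/finite_fset.
move=> y [yx /Uf[p pD Upy]]; exists p => //.
rewrite /g; case: xgetP => [z _ [zx Uz]|/(_ y)]; last by case.
have [[ri _] _] := Ub p pD.
have E : gmul x (ginv z) = gmul x (ginv y).
  apply: ri; [by rewrite inE|by rewrite inE|].
  by rewrite !rng_mul ?rng_inv.
by rewrite -(gmulVK (esym zx)) E gmulVK.
Qed.

Lemma Ind_sumE f (xi : G -> R[i]) x : Cc setT f ->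
  \sum_(y \in [set y | src y = src x]) f (gmul x (ginv y)) * xi y =
  \sum_(y <- fset_set (fib f x)) f (gmul x (ginv y)) * xi y.
Proof.
move=> fC; rewrite -fsbig_finite; last exact: fib_finite.
apply/esym/fsbig_widen => [y []//|y [/= yx] nfib].
have [->|f0] := eqVneq (f (gmul x (ginv y))) 0; first by rewrite mul0r.
by case: nfib.
Qed.

Lemma sqr_sum_le (I : Type) (s : seq I) (F : I -> R) :
  (\sum_(i <- s) F i) ^+ 2 <= 2 ^+ (size s) * \sum_(i <- s) F i ^+ 2.
Proof.
elim: s => [|i s ih]; first by rewrite !big_nil expr0n mulr0.
move: ih; rewrite !big_cons /= [2 ^+ _.+1]exprS.
move: (F i) (\sum_(j <- s) F j) (\sum_(j <- s) F j ^+ 2) => a S Q ih.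
have t1 : 1 <= 2 ^+ size s :> R by rewrite exprn_ege1// ler1n.
move: (2 ^+ size s) ih t1 => t ih t1.
have : 0 <= (t - 1) * a ^+ 2 by rewrite mulr_ge0 ?sqr_ge0// subr_ge0.
have := sqr_ge0 (a - S); rewrite -subr_ge0 in ih => h1 h2.
rewrite -subr_ge0 (_ : _ - _ = (a - S) ^+ 2 + 2 * ((t - 1) * a ^+ 2) +
  2 * (t * Q - S ^+ 2)); last by ring.
by rewrite !addr_ge0// mulr_ge0.
Qed.

Lemma Ind_bound f : Cc setT f -> exists2 C : R, 0 <= C &
  forall xi : l2 R G, (sqsum (fun x => \sum_(y \in [set y | src y = src x])
    f (gmul x (ginv y)) * xi y)%R <= C%:E * sqsum xi)%E.
Proof.
move=> fC; have [D [U [b [b0 Ub Uf]]]] := Cc_cover fC.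
pose B p := [set y : G * G | src y.2 = src y.1 /\ U p (gmul y.1 (ginv y.2))].
pose g p x := xget x [set y | B p (x, y)].
pose E p := [set x | exists y, B p (x, y)].
pose h p (xi : l2 R G) x : R := if x \in E p then normc (xi (g p x)) else 0.
have normc_ge0 (z : R[i]) : 0 <= normc z by case: z => ? ?; rewrite sqrtr_ge0.
have gE p x y : p \in D -> B p (x, y) -> g p x = y.
  move=> pD [/= yx Uy]; rewrite /g; case: xgetP => [z _ [/= zx Uz]|/(_ y)].
    have [[ri _] _] := Ub p pD.
    have E' : gmul x (ginv z) = gmul x (ginv y).
      apply: ri; [by rewrite inE|by rewrite inE|].
      by rewrite !rng_mul ?rng_inv.
    by rewrite -(gmulVK (esym zx)) E' gmulVK.
  by case.
exists (2 ^+ size D * \sum_(p <- D) b p ^+ 2).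
  by rewrite mulr_ge0 ?exprn_ge0// sumr_ge0// => p _; rewrite sqr_ge0.
move=> xi.
have ptw x : normc (\sum_(y \in [set y | src y = src x])
    f (gmul x (ginv y)) * xi y) <= \sum_(p <- D) b p * h p xi x.
  rewrite Ind_sumE//.
  apply: (@le_trans _ _ (\sum_(y <- fset_set (fib f x))
      normc (f (gmul x (ginv y)) * xi y))).
    elim/big_ind2: _ => [|u v w z uv wz|//]; first by rewrite normc0.
    by apply: le_trans (lerD uv wz); exact: (@le_normcD R).
  apply: (@le_trans _ _ (\sum_(y <- fset_set (fib f x)) \sum_(p <- D)
      if `[< B p (x, y) >] then b p * h p xi x else 0)).
    rewrite big_seq [leRHS]big_seq; apply: ler_sum => y.
    rewrite in_fset_set; last exact: fib_finite.
    rewrite inE => -[yx fy0]; have [p pD Up] := Uf _ fy0.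
    rewrite (big_rem p)//= asboolT//.
    rewrite normcM -[leLHS]addr0; apply: lerD.
      rewrite /h mem_set; last by exists y.
      rewrite (gE p x y)// ler_wpM2r//.
      by have [_] := Ub p pD; apply.
    apply: sumr_ge0 => q _; case: ifP => // _; rewrite mulr_ge0//.
    by rewrite /h; case: ifP.
  rewrite exchange_big/= big_seq [leRHS]big_seq; apply: ler_sum => p pD.
  have h0 : 0 <= b p * h p xi x by rewrite mulr_ge0// /h; case: ifP.
  rewrite -big_mkcond/=.
  case: (pselect (exists2 y, y \in fset_set (fib f x) & B p (x, y))) => [[y yf By]|nB].
    rewrite (big_rem y)//= asboolT// big_seq_cond big1 ?addr0//.
    move=> z /andP[zf /asboolP Bz]; exfalso; move: zf.
    have <- : y = z by rewrite -(gE p x y)// (gE p x z).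
    by rewrite mem_rem_uniqF// fset_uniq.
  rewrite big_seq_cond big1// => z /andP[zf /asboolP Bz].
  by exfalso; apply: nB; exists z.
have q0 p : 0 <= b p ^+ 2 by rewrite sqr_ge0.
apply: (@le_trans _ _ (\esum_(x in [set: G]) \sum_(p <- D)
   (2 ^+ size D * b p ^+ 2 * h p xi x ^+ 2)%:E)%E).
  apply: le_esum => x _; rewrite sumEFin lee_fin.
  apply: (@le_trans _ _ ((\sum_(p <- D) b p * h p xi x) ^+ 2)).
    rewrite ler_sqr ?nnegrE// sumr_ge0// => p _.
    by rewrite mulr_ge0// /h; case: ifP.
  apply: (le_trans (sqr_sum_le _ _)); rewrite mulr_sumr.
  by apply: ler_sum => p _; rewrite exprMn mulrA.
have c0 p : 0 <= 2 ^+ size D * b p ^+ 2 by rewrite mulr_ge0// exprn_ge0.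
rewrite esum_sum; last first.
  by move=> x p _ _; rewrite lee_fin mulr_ge0// sqr_ge0.
rewrite mulr_sumr -sumEFin ge0_sume_distrl; last by move=> p _; rewrite lee_fin.
rewrite big_seq [leRHS]big_seq; apply: lee_sum => p pD.
apply: (le_trans (ge0_esumZl _ _)) => //.
  by move=> x; rewrite sqr_ge0.
rewrite lee_wpmul2l ?lee_fin//.
rewrite (_ : (\esum_(x in _) _ =
  \esum_(x in E p) (normc (xi (g p x)) ^+ 2)%:E)%E).
  apply: sqsum_le_inj => x x' /[!inE] -[y Bxy] -[y' Bxy'].
  rewrite (gE p x y)// (gE p x' y')// => yy'; subst y'.
  have [[_ si] _] := Ub p pD.
  have E' : gmul x (ginv y) = gmul x' (ginv y).
    apply: si; rewrite ?inE; [by case: Bxy|by case: Bxy'|].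
    by rewrite !src_mul ?rng_inv; [|case: Bxy'|case: Bxy].
  case: Bxy => /= yx _; case: Bxy' => /= yx' _.
  by rewrite -(gmulK (esym yx)) E' gmulK.
rewrite [RHS]esum_mkcond; apply: eq_esum => x _; rewrite /h.
by case: ifP; rewrite ?expr0n.
Qed.

Lemma IndE f (xi : l2 R G) x : Cc setT f ->
  Ind f xi x = \sum_(y \in [set y | src y = src x]) f (gmul x (ginv y)) * xi y.
Proof.
move=> fC; rewrite /Ind mkl2E//; have [C C0 +] := Ind_bound fC.
move=> /(_ xi)/le_lt_trans; apply.
by rewrite lte_mul_pinfty ?lee_fin ?sqsum_l2.
Qed.

Lemma Ind_bounded f : Cc setT f -> bounded_op (@Ind R G f).
Proof.
move=> fC; split.
  move=> k xi eta; apply/val_inj/funext => x.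
  rewrite [LHS]IndE// [RHS](_ : _ = k * Ind f xi x + Ind f eta x)//.
  rewrite !IndE// !Ind_sumE// mulr_sumr -big_split; apply: eq_bigr => y _ /=.
  by rewrite [X in _ * X = _](_ : _ = k * xi y + eta y)//; ring.
have [C C0 +] := Ind_bound fC => HC; exists (Num.sqrt C) => xi.
rewrite /l2norm -sqrtrM//; apply: ler_wsqrtr.
have -> : C * fine (sqsum xi) = fine (C%:E * sqsum xi)%E.
  by rewrite fineM// ge0_fin_numE ?sqsum_ge0 ?sqsum_l2.
have Cfin : (C%:E * sqsum xi)%E \is a fin_num.
  by rewrite fin_numM// ge0_fin_numE ?sqsum_ge0 ?sqsum_l2.
apply: fine_le => //; first by rewrite ge0_fin_numE ?sqsum_ge0 ?sqsum_l2.
apply: le_trans (HC xi); rewrite le_eqVlt; apply/orP; left; apply/eqP.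
by congr sqsum; apply/funext => x; rewrite IndE.
Qed.

Lemma Ind_Cstar_red f : Cc setT f -> Cstar_red (@Ind R G f).
Proof.
move=> fC; split=> [|eps e0]; first exact: Ind_bounded.
exists (@Ind R G f); first by exists f.
rewrite subrr; apply: (@le_lt_trans _ _ 0%E); last by rewrite lte_fin.
apply: ge_ereal_sup => _ [xi _ <-]; rewrite lee_fin /l2norm /sqsum esum1 ?sqrtr0//.
by move=> x _; rewrite (_ : (0 : l2 R G -> l2 R G) xi x = 0)// normc0 expr0n.
Qed.

Lemma jmap_Ind f : Cc setT f -> jmap (@Ind R G f) = f.
Proof.
move=> fC; apply/funext => x; rewrite /jmap IndE//.
rewrite -(fsbig_widen [set src x]) => [|_ -> /=|y [/= _ /eqP yx]].
- by rewrite fsbig_set1 basis_vecE eqxx mulr1 ginv_unit gmul_src.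
- exact: src_src.
- by rewrite basis_vecE (negPf yx) mulr0.
Qed.

Lemma jmap_le (a : l2 R G -> l2 R G) x : ((normc (jmap a x))%:E <= opnorm a)%E.
Proof.
apply: (@le_trans _ _ (l2norm (a (basis_vec R (src x))))%:E).
  by rewrite lee_fin; exact: normc_le_l2norm.
apply: ereal_sup_ubound; exists (basis_vec R (src x)) => //=.
by rewrite l2norm_basis_vec.
Qed.

End Ind_theory.

Definition continuous_cocycle (G : etaleGroupoidType) (Gamma : groupType)
    (c : G -> Gamma) : Prop :=
  continuous (c : G -> discrete_topology Gamma) /\
  forall x y, src x = rng y -> c (gmul x y) = (c x * c y)%g.

Section coaction.
Context (R : realType) (G : etaleGroupoidType) (Gamma : groupType).
Implicit Types (c : G -> Gamma)
  (delta : (l2 R G -> l2 R G) ->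
           (l2 R (G * Gamma)%type -> l2 R (G * Gamma)%type)).

Let A := @Cstar_red R G.
Let AxC := min_tensor A (@group_Cstar_red R Gamma).

(* [delta] is the coaction induced by [c]; only its values on the reduced
   C*-algebra of [G] are meaningful. *)
Record is_coaction c delta : Prop := IsCoaction {
  coaction_in : forall a, A a -> AxC (delta a);
  coaction_linear : forall (k : R[i]) a b, A a -> A b ->
    delta (k *: a + b) = k *: delta a + delta b;
  coaction_mul : forall a b, A a -> A b ->
    delta (a \o b) = delta a \o delta b;
  coaction_star : forall a b, A a -> A b ->
    adjoint a b -> adjoint (delta a) (delta b);
  coaction_nondegenerate :
    op_closure (op_span
      [set T | exists a S, [/\ A a, AxC S & T = delta a \o S]]) = AxC;
  coaction_Cc : forall t f, Cc (c @^-1` [set t]) f ->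
    is_tensor (Ind f) (left_reg t) (delta (Ind f))
}.

Definition coaction_invariant delta (M : set (l2 R G -> l2 R G)) : Prop :=
  forall a, M a -> min_tensor M (@group_Cstar_red R Gamma) (delta a).

End coaction.

(* Main.v *)
Require Import Defs.
From HB Require Import structures.
From mathcomp Require Import all_boot all_order all_algebra.
From mathcomp Require Import finmap.
From mathcomp Require Import all_classical all_reals all_analysis.
From mathcomp Require Import complex ring lra.

(** Operators on [l^2(G)] coming from functions on the groupoid are manipulated
    through compact open bisections: as the unit space is totally disconnected,
    these form a basis of the topology, and a function with compact support is a
    finite sum of functions supported in disjoint small ones ([Cc_ind]).

    Write [G_t] for the set of arrows of degree [t]. Reading off the coefficient
    at [t] in the second leg of the coaction gives a contractive slice map. It
    sends [delta (Ind f)] to [Ind] of the restriction of [f] to [G_t]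
    ([slice_coaction_Ind]) and it sends [min_tensor M (group_Cstar_red R Gamma)]
    into [M] ([slice_min_tensor]). To know the slices of [delta a] for a general
    [a], one needs [delta] to be bounded. This is the automatic continuity of
    *-homomorphisms ([star_hom_bounded]): if [a] is small, then [1 - a^* a] is
    the square of a self-adjoint [1 - b] with [b] in the algebra, and applying
    the homomorphism gives [||pi a eta|| <= ||eta||]. The proof uses that the
    reduced algebra is norm closed, closed under products ([Cstar_comp], through
    the convolution of compactly supported functions) and under adjoints
    ([Cstar_star]).

    If [M] is spectral and [a] is in [M], then [a] is a limit of [Ind f] with [f]
    supported in the open support of [a]. The homogeneous pieces of [f] stay in
    [M], and [delta (Ind f)] is the finite sum of their tensors with the
    translations; boundedness of [delta] concludes ([spectral_invariant]).

    Conversely let [M] be invariant, and let [a] vanish off its spectrum. By the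
    approximation property it is enough to find [Ind f] in [M] for [f] supported
    in the spectrum, hence for [f] supported near a given point [z] of it. Some
    [b] in [M] does not vanish at [z], and the slice [y] of [delta b] at the
    degree of [z] is in [M], does not vanish at [z], and is a limit of functions
    on a single [G_t]. There principality of the kernel says that an arrow is
    determined by its range and source ([graded_fibre_inj]). So if a compact open
    bisection [K] is partitioned into small enough pieces [K_i], the sum over [i]
    of the compressions of [y] to [r(K_i)] and [s(K_i)] is an element of [M] close
    to the restriction of [y] to [K] ([block_approximation]); the sum is
    block diagonal, so errors do not add up. In the limit [M] contains the
    restriction of [y] to [K]. Where [y] does not vanish, any function on [K] is
    this restriction multiplied by a function on the unit space, and so belongs
    to [M] ([local_synthesis]). *)

Set Implicit Arguments.
Unset Strict Implicit.
Unset Printing Implicit Defensive.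

Import Order.TTheory GRing.Theory Num.Theory.
Import ComplexField.Normc.
Import numFieldNormedType.Exports.

Section spectral_synthesis.
Local Open Scope classical_set_scope.
Local Open Scope ring_scope.
Local Open Scope complex_scope.

(** * The Hilbert space of square summable families *)

Section modulus.
Context (R : realType).
Implicit Types z w : R[i].

Lemma normc_ge0 z : 0 <= normc z.
Proof. by case: z => a b; rewrite sqrtr_ge0. Qed.

Lemma normcN z : normc (- z) = normc z.
Proof. by case: z => a b /=; rewrite !sqrrN. Qed.

Lemma normc_conj z : normc z^* = normc z.
Proof. by case: z => a b /=; rewrite sqrrN. Qed.

Lemma normc_add z w : normc (z + w) <= normc z + normc w.
Proof. exact: (@le_normcD R). Qed.

Lemma normc_real (a : R) : normc a%:C = `|a|.
Proof. by rewrite /= expr0n addr0 sqrtr_sqr. Qed.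

Lemma mul_conjE z : z * z^* = (normc z ^+ 2)%:C.
Proof.
case: z => a b /=; rewrite sqr_sqrtr ?addr_ge0 ?sqr_ge0//.
apply/eqP; rewrite eq_complex/=; apply/andP; split; apply/eqP; ring.
Qed.

Lemma normc_Re z : `|complex.Re z| <= normc z.
Proof.
case: z => a b /=; rewrite -sqrtr_sqr ler_wsqrtr// lerDl sqr_ge0//.
Qed.

Lemma normc_Im z : `|complex.Im z| <= normc z.
Proof.
case: z => a b /=; rewrite -sqrtr_sqr ler_wsqrtr// lerDr sqr_ge0//.
Qed.

Lemma normc_ReIm z : normc z <= `|complex.Re z| + `|complex.Im z|.
Proof.
case: z => a b; have := normc_ge0 (a +i* b); set u := normc _ => u0 /=.
rewrite -ler_sqr ?nnegrE ?addr_ge0// /u /= sqr_sqrtr ?addr_ge0 ?sqr_ge0//.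
rewrite -(real_normK (num_real a)) -(real_normK (num_real b)).
have := mulr_ge0 (normr_ge0 a) (normr_ge0 b).
by move: (Num.norm a) (Num.norm b) => v w; nra.
Qed.

End modulus.

Section summation.
Context (R : realType) (X : choiceType).
Implicit Types (F G : X -> R[i]) (f g h : X -> R).

Definition nsummable h := (\esum_(x in [set: X]) (h x)%:E < +oo)%E.
Definition nsum h : R := fine (\esum_(x in [set: X]) (h x)%:E)%E.

Lemma nsumE h : (forall x, 0 <= h x) -> nsummable h ->
  (\esum_(x in [set: X]) (h x)%:E)%E = (nsum h)%:E.
Proof.
move=> h0 hs; rewrite /nsum fineK// ge0_fin_numE// esum_ge0// => x _.
by rewrite lee_fin.
Qed.

Lemma le_nsummable h f : (forall x, h x <= f x) ->
  nsummable f -> nsummable h.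
Proof.
by move=> hf; apply: le_lt_trans; apply: le_esum => x _; rewrite lee_fin.
Qed.

Lemma nsummableD h f : (forall x, 0 <= h x) -> (forall x, 0 <= f x) ->
  nsummable h -> nsummable f -> nsummable (fun x => h x + f x).
Proof.
move=> h0 f0 hs fs; rewrite /nsummable.
under eq_esum do rewrite EFinD.
by rewrite esumD ?lte_add_pinfty// => x _; rewrite lee_fin.
Qed.

Lemma nsumD h f : (forall x, 0 <= h x) -> (forall x, 0 <= f x) ->
  nsummable h -> nsummable f -> nsum (fun x => h x + f x) = nsum h + nsum f.
Proof.
move=> h0 f0 hs fs; rewrite [LHS]/nsum.
under eq_esum do rewrite EFinD.
by rewrite esumD ?nsumE// => x _; rewrite lee_fin.
Qed.

Lemma nsummableZ k h : 0 <= k -> (forall x, 0 <= h x) -> nsummable h ->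
  nsummable (fun x => k * h x).
Proof.
move=> k0 h0 hs; apply: (le_lt_trans (ge0_esumZl k0 h0)).
by rewrite lte_mul_pinfty.
Qed.

Lemma nsumZ k h : 0 <= k -> (forall x, 0 <= h x) -> nsummable h ->
  nsum (fun x => k * h x) = k * nsum h.
Proof.
move=> k0 h0 hs; apply/eqP; rewrite eq_le; apply/andP; split.
  rewrite -lee_fin -nsumE; [|by move=> x; rewrite mulr_ge0|exact: nsummableZ].
  by rewrite EFinM -nsumE//; exact: ge0_esumZl.
have [->|kn0] := eqVneq k 0.
  rewrite mul0r /nsum fine_ge0// esum_ge0// => x _; rewrite mul0r//.
have k1 : 0 < k by rewrite lt_neqAle eq_sym kn0.
rewrite mulrC -ler_pdivlMr// mulrC.
have kh0 x : 0 <= k * h x by rewrite mulr_ge0.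
rewrite -lee_fin EFinM -!nsumE//; last exact: nsummableZ.
apply: le_trans (ge0_esumZl _ kh0); last by rewrite invr_ge0.
by apply: le_esum => x _; rewrite mulrA mulVf// mul1r.
Qed.

Definition rsummable f := nsummable (fun x => `|f x|).

(** Two decompositions of a real family as a difference of nonnegative ones
    have the same difference of sums; this reduces the algebra of [rsum] to
    that of sums of nonnegative terms. *)
Lemma rsum_sub f g : (forall x, 0 <= f x) -> (forall x, 0 <= g x) ->
  nsummable f -> nsummable g -> rsum (fun x => f x - g x) = nsum f - nsum g.
Proof.
move=> f0 g0 fs gs; rewrite /rsum.
set p := fun x => Num.max (f x - g x) 0; set n := fun x => Num.max (- (f x - g x)) 0.
have p0 x : 0 <= p x by rewrite /p le_max lexx orbT.
have n0 x : 0 <= n x by rewrite /n le_max lexx orbT.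
have ps : nsummable p.
  by apply: (le_nsummable _ fs) => x; rewrite /p ge_max f0 andbT gerBl.
have ns : nsummable n.
  by apply: (le_nsummable _ gs) => x; rewrite /n ge_max g0 andbT opprB gerBl.
rewrite -[X in X - _]/(nsum p) -[X in _ - X]/(nsum n).
suff : nsum p + nsum g = nsum n + nsum f by move=> ?; lra.
rewrite -!nsumD//; congr nsum; apply/funext => x; rewrite /p /n.
by case: (leP (f x - g x) 0) => ?; case: (leP (- (f x - g x)) 0) => ?; lra.
Qed.

Lemma rsummable_split f : rsummable f -> exists p n, [/\ forall x, 0 <= p x,
  forall x, 0 <= n x, nsummable p, nsummable n & f = fun x => p x - n x].
Proof.
move=> fs; exists (fun x => Num.max (f x) 0), (fun x => Num.max (- f x) 0).
split=> [x|x|||].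
- by rewrite le_max lexx orbT.
- by rewrite le_max lexx orbT.
- by apply: (le_nsummable _ fs) => x; rewrite ge_max normr_ge0 ler_norm.
- by apply: (le_nsummable _ fs) => x; rewrite ge_max normr_ge0 -normrN ler_norm.
apply/funext => x.
by case: (leP (f x) 0) => ?; case: (leP (- f x) 0) => ?; lra.
Qed.

Lemma rsumD f g : rsummable f -> rsummable g ->
  rsum (fun x => f x + g x) = rsum f + rsum g.
Proof.
move=> /rsummable_split[p [n [p0 n0 ps ns ->]]].
move=> /rsummable_split[q [m [q0 m0 qs ms ->]]].
rewrite !rsum_sub//.
rewrite (_ : (fun x => _) = (fun x => (p x + q x) - (n x + m x))); last first.
  by apply/funext => x; ring.
rewrite rsum_sub ?nsumD//; [by ring|..].
- by move=> x; rewrite addr_ge0.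
- by move=> x; rewrite addr_ge0.
- exact: nsummableD.
- exact: nsummableD.
Qed.

Lemma rsumN f : rsummable f -> rsum (fun x => - f x) = - rsum f.
Proof.
move=> /rsummable_split[p [n [p0 n0 ps ns ->]]].
rewrite (_ : (fun x => _) = (fun x => n x - p x)).
  by rewrite !rsum_sub// opprB.
by apply/funext => x; rewrite opprB.
Qed.

Lemma rsumZ k f : rsummable f -> rsum (fun x => k * f x) = k * rsum f.
Proof.
have pos l g : 0 <= l -> rsummable g -> rsum (fun x => l * g x) = l * rsum g.
  move=> l0 /rsummable_split[p [n [p0 n0 ps ns ->]]].
  rewrite (_ : (fun x => _) = (fun x => l * p x - l * n x)); last first.
    by apply/funext => x; rewrite mulrBr.
  rewrite !rsum_sub// ?nsumZ ?mulrBr// => [x|x||].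
  - by rewrite mulr_ge0.
  - by rewrite mulr_ge0.
  - exact: nsummableZ.
  - exact: nsummableZ.
move=> fs; have [k0|k0] := leP 0 k; first exact: pos.
rewrite -[RHS]mulrNN -rsumN// -pos ?oppr_ge0 ?ltW//.
  by congr rsum; apply/funext => x; rewrite mulrNN.
by rewrite /rsummable; under [X in nsummable X]eq_fun do rewrite normrN.
Qed.

Lemma rsum_ge0E f : (forall x, 0 <= f x) -> nsummable f -> rsum f = nsum f.
Proof.
move=> f0 fs; rewrite -[RHS]subr0.
have z0 : nsum (fun=> 0 : R) = 0 by rewrite /nsum esum1.
rewrite -[X in _ - X]z0 -rsum_sub//.
  by congr rsum; apply/funext => x; rewrite subr0.
by rewrite /nsummable esum1.
Qed.

Definition csummable F := nsummable (fun x => normc (F x)).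

Lemma csummable_Re F : csummable F -> rsummable (fun x => complex.Re (F x)).
Proof. by apply: le_nsummable => x; exact: normc_Re. Qed.

Lemma csummable_Im F : csummable F -> rsummable (fun x => complex.Im (F x)).
Proof. by apply: le_nsummable => x; exact: normc_Im. Qed.

Lemma csumD F G : csummable F -> csummable G ->
  csum (fun x => F x + G x) = csum F + csum G.
Proof.
move=> Fs Gs; rewrite /csum.
have := csummable_Re Fs; have := csummable_Re Gs.
have := csummable_Im Fs; have := csummable_Im Gs.
move=> *; rewrite -[RHS]/(_ +i* _) -!rsumD//.
by congr (_ +i* _); congr rsum; apply/funext => x; case: (F x); case: (G x).
Qed.

Lemma rsummableZ k f : rsummable f -> rsummable (fun x => k * f x).
Proof.
move=> fs; rewrite /rsummable; under [X in nsummable X]eq_fun do rewrite normrM.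
by apply: nsummableZ.
Qed.

Lemma csumZ k F : csummable F -> csum (fun x => k * F x) = k * csum F.
Proof.
move=> Fs; have Rs := csummable_Re Fs; have Is := csummable_Im Fs.
case: k => a b; rewrite /csum -[RHS]/((_ - _) +i* (_ + _)) -!rsumZ// -rsumN; last first.
  exact: rsummableZ.
rewrite -!rsumD; [|exact: rsummableZ|exact: rsummableZ|exact: rsummableZ|]; last first.
  under eq_fun do rewrite -mulNr.
  exact: rsummableZ.
by congr (_ +i* _); congr rsum; apply/funext => x; case: (F x).
Qed.

Lemma csum_conj F : csummable F -> csum (fun x => (F x)^*) = (csum F)^*.
Proof.
move=> Fs; rewrite /csum /= -rsumN; last exact: csummable_Im.
by congr (_ +i* _); congr rsum; apply/funext => x; case: (F x).
Qed.

End summation.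

Section hilbert.
Context (R : realType) (X : choiceType).
Implicit Types (xi eta zeta : l2 R X) (k : R[i]).

Lemma l2DE xi eta x : (xi + eta) x = xi x + eta x. Proof. by []. Qed.
Lemma l2ZE k xi x : (k *: xi) x = k * xi x. Proof. by []. Qed.
Lemma l2NE xi x : (- xi) x = - xi x. Proof. by []. Qed.
Lemma l2BE xi eta x : (xi - eta) x = xi x - eta x. Proof. by []. Qed.
Lemma l2P xi eta : (forall x, xi x = eta x) -> xi = eta.
Proof. by move=> e; apply/val_inj/funext. Qed.

Lemma l2norm_ge0 xi : 0 <= l2norm xi.
Proof. by rewrite sqrtr_ge0. Qed.

Lemma sqr_l2norm xi : (l2norm xi ^+ 2)%:E = sqsum xi.
Proof.
rewrite /l2norm sqr_sqrtr ?fine_ge0 ?sqsum_ge0// fineK//.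
by rewrite ge0_fin_numE ?sqsum_ge0 ?sqsum_l2.
Qed.

Lemma l2_nsummable xi : nsummable (fun x => normc (xi x) ^+ 2).
Proof. exact: sqsum_l2. Qed.

Lemma l2norm_nsum xi : l2norm xi ^+ 2 = nsum (fun x => normc (xi x) ^+ 2).
Proof. by rewrite /nsum -/(sqsum xi) -sqr_l2norm. Qed.

Lemma inner_summable xi eta : csummable (fun x => xi x * (eta x)^*).
Proof.
have s2 x : 0 <= normc (xi x) ^+ 2 by rewrite sqr_ge0.
have t2 x : 0 <= normc (eta x) ^+ 2 by rewrite sqr_ge0.
apply: le_nsummable (nsummableD s2 t2 (l2_nsummable xi) (l2_nsummable eta)) => x.
rewrite normcM normc_conj; have := normc_ge0 (xi x); have := normc_ge0 (eta x).
by move: (normc _) (normc _) => b a b0 a0; have := sqr_ge0 (a - b); nra.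
Qed.

Lemma innerDl xi eta zeta : inner (xi + eta) zeta = inner xi zeta + inner eta zeta.
Proof.
rewrite /inner -csumD; try exact: inner_summable.
by congr csum; apply/funext => x; rewrite l2DE mulrDl.
Qed.

Lemma innerZl k xi zeta : inner (k *: xi) zeta = k * inner xi zeta.
Proof.
rewrite /inner -csumZ; try exact: inner_summable.
by congr csum; apply/funext => x; rewrite l2ZE mulrA.
Qed.

Lemma innerC xi eta : inner eta xi = (inner xi eta)^*.
Proof.
rewrite /inner -csum_conj; try exact: inner_summable.
by congr csum; apply/funext => x; rewrite rmorphM/= conjcK mulrC.
Qed.

Lemma innerDr xi eta zeta : inner zeta (xi + eta) = inner zeta xi + inner zeta eta.
Proof. by rewrite innerC innerDl rmorphD [inner zeta xi]innerC [inner zeta eta]innerC. Qed.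

Lemma innerZr k xi zeta : inner zeta (k *: xi) = conjc k * inner zeta xi.
Proof. by rewrite innerC innerZl rmorphM [inner zeta xi]innerC. Qed.

Lemma innerNl xi eta : inner (- xi) eta = - inner xi eta.
Proof. by rewrite -scaleN1r innerZl mulN1r. Qed.

Lemma innerNr xi eta : inner xi (- eta) = - inner xi eta.
Proof. by rewrite innerC innerNl rmorphN [inner xi eta]innerC. Qed.

Lemma inner_norm xi : inner xi xi = (l2norm xi ^+ 2)%:C.
Proof.
rewrite /inner; under [X in csum X]eq_fun do rewrite mul_conjE.
rewrite /csum/= l2norm_nsum rsum_ge0E; last exact: l2_nsummable.
  rewrite [rsum (fun=> 0)]rsum_ge0E//; last by rewrite /nsummable esum1.
  by rewrite [nsum (fun=> 0)]/nsum esum1.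
by move=> x; rewrite sqr_ge0.
Qed.

Lemma l2norm0 : l2norm (0 : l2 R X) = 0.
Proof.
by apply/eqP; rewrite -sqrf_eq0 l2norm_nsum /nsum esum1// => x _; rewrite normc0 expr0n.
Qed.

Lemma l2norm_eq0 xi : l2norm xi = 0 -> xi = 0.
Proof.
move=> xi0; apply: l2P => x; apply: eq0_normc; apply/eqP.
by rewrite eq_le normc_ge0 -xi0 normc_le_l2norm.
Qed.

Lemma l2normZ k xi : l2norm (k *: xi) = normc k * l2norm xi.
Proof.
apply/eqP; rewrite -(eqrXn2 (ltn0Sn 1)) ?mulr_ge0 ?l2norm_ge0 ?normc_ge0//.
rewrite exprMn !l2norm_nsum -nsumZ ?sqr_ge0//; last exact: l2_nsummable.
  by apply/eqP; congr nsum; apply/funext => x; rewrite l2ZE normcM exprMn.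
by move=> x; rewrite sqr_ge0.
Qed.

Lemma l2normN xi : l2norm (- xi) = l2norm xi.
Proof. by rewrite -scaleN1r l2normZ normcN normc1 mul1r. Qed.

Lemma cauchy_schwarz xi eta : normc (inner xi eta) <= l2norm xi * l2norm eta.
Proof.
have [e0|e0] := eqVneq (l2norm eta) 0.
  by rewrite (l2norm_eq0 e0) -(scale0r 0) innerZr rmorph0 mul0r normc0 scale0r l2norm0 mulr0.
set n := l2norm eta; set m := l2norm xi; set c := inner xi eta.
have n0 : 0 < n by rewrite lt_neqAle eq_sym e0 l2norm_ge0.
rewrite -ler_sqr ?nnegrE ?mulr_ge0 ?l2norm_ge0 ?normc_ge0//.
(* The norm of n^2 xi - <xi, eta> eta, orthogonal to eta, is nonnegative. *)
have := inner_norm ((n ^+ 2)%:C *: xi - c *: eta).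
rewrite innerDl innerNl !innerDr !innerNr !innerZl !innerZr !inner_norm.
rewrite (innerC xi eta) -/n -/m -/c.
rewrite conjc_real.
have -> (N M : R) : N%:C * (N%:C * M%:C) - N%:C * (conjc c * c) -
    (c * (N%:C * conjc c) - c * (conjc c * N%:C)) =
    (N * (N * M - normc c ^+ 2))%:C.
  have -> : normc c ^+ 2 = complex.Re c ^+ 2 + complex.Im c ^+ 2.
    by case: (c) => u v; rewrite /= sqr_sqrtr ?addr_ge0 ?sqr_ge0.
  case: (c) => u v; apply/eqP; rewrite eq_complex/=.
  by apply/andP; split; apply/eqP; ring.
move=> /(congr1 (@complex.Re R)) /= E.
have : 0 <= n ^+ 2 * (n ^+ 2 * m ^+ 2 - normc c ^+ 2) by rewrite E sqr_ge0.
by rewrite pmulr_rge0 ?exprn_gt0// subr_ge0 exprMn mulrC [m ^+ 2 * _]mulrC.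
Qed.

Lemma sqr_l2normD xi eta : l2norm (xi + eta) ^+ 2 =
  l2norm xi ^+ 2 + 2 * complex.Re (inner xi eta) + l2norm eta ^+ 2.
Proof.
have := inner_norm (xi + eta); rewrite innerDl !innerDr !inner_norm (innerC xi eta).
by case: (inner xi eta) => u v /(congr1 (@complex.Re R)) /= <-; ring.
Qed.

Lemma ler_l2normD xi eta : l2norm (xi + eta) <= l2norm xi + l2norm eta.
Proof.
rewrite -ler_sqr ?nnegrE ?addr_ge0 ?l2norm_ge0// sqr_l2normD.
have := cauchy_schwarz xi eta; have := normc_Re (inner xi eta).
by have := ler_norm (complex.Re (inner xi eta)); nra.
Qed.

Lemma ler_l2normB xi eta : l2norm (xi - eta) <= l2norm xi + l2norm eta.
Proof. by rewrite -[X in _ <= _ + X]l2normN ler_l2normD. Qed.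

Lemma l2norm_le xi (r : R) : 0 <= r ->
  (sqsum xi <= (r ^+ 2)%:E)%E -> l2norm xi <= r.
Proof.
by move=> r0; rewrite -sqr_l2norm lee_fin ler_sqr ?nnegrE ?l2norm_ge0.
Qed.

Lemma inner_basis xi x : inner xi (basis_vec R x) = xi x.
Proof.
have -> : inner xi (basis_vec R x) = csum (fun y => if y == x then xi x else 0).
  congr csum; apply/funext => y; rewrite basis_vecE.
  by case: eqP => [->|_]; rewrite ?rmorph1 ?mulr1// rmorph0 mulr0.
have ns (a : R) : 0 <= a -> nsummable (fun y => if y == x then a else 0) /\
    nsum (fun y => if y == x then a else 0) = a.
  move=> a0; rewrite /nsummable /nsum.
  have -> : (\esum_(y in [set: X]) (if y == x then a else 0)%:E =
      \esum_(y in [set x]) a%:E)%E.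
    rewrite [RHS]esum_mkcond; apply: eq_esum => y _; rewrite in_set1.
    by case: eqP.
  by rewrite esum_set1 ?lee_fin// ltry.
have rs (a : R) : rsum (fun y => if y == x then a else 0) = a.
  have nn (b : R) : 0 <= b -> forall y, 0 <= (if y == x then b else 0).
    by move=> b0 y; case: ifP.
  have [a0|/ltW a0] := leP 0 a; first
    by rewrite rsum_ge0E//; [case: (ns _ a0)|exact: nn|case: (ns _ a0)].
  rewrite -oppr_ge0 in a0; have [h1 h2] := ns _ a0.
  rewrite -[RHS]opprK -[in RHS]h2 -rsum_ge0E//; last exact: nn.
  rewrite -rsumN; last first.
    rewrite /rsummable (_ : (fun _ => _) = (fun y => if y == x then - a else 0))//.
    by apply/funext => y; rewrite ger0_norm ?nn.
  by congr rsum; apply/funext => y; case: ifP => _; rewrite ?opprK ?oppr0.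
rewrite /csum; case: (xi x) => a b; congr (_ +i* _).
  by rewrite -[RHS]rs; congr rsum; apply/funext => y; case: eqP.
by rewrite -[RHS]rs; congr rsum; apply/funext => y; case: eqP.
Qed.

End hilbert.

(** * Bounded operators, their limits and their adjoints *)

Section sequences_l2.
Context (R : realType) (X : choiceType).
Implicit Types (f : X -> R[i]) (xi eta : l2 R X).

Lemma sqsum_le f (c : R) :
  (forall s : seq X, uniq s -> \sum_(x <- s) normc (f x) ^+ 2 <= c) ->
  (sqsum f <= c%:E)%E.
Proof.
move=> fc; apply: ge_ereal_sup => _ [A [finA _] <-].
by rewrite fsbig_finite//= sumEFin lee_fin fc// fset_uniq.
Qed.

Lemma sum_le_l2norm xi (s : seq X) : uniq s ->
  \sum_(x <- s) normc (xi x) ^+ 2 <= l2norm xi ^+ 2.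
Proof.
move=> us; rewrite -lee_fin sqr_l2norm; apply: ereal_sup_ubound.
exists [set` s] => //.
by rewrite -fsbig_seq// sumEFin.
Qed.

Lemma l2norm_mkl2 f (r : R) : 0 <= r -> (sqsum f <= (r ^+ 2)%:E)%E ->
  mkl2 f = f :> (X -> R[i]) /\ l2norm (mkl2 f) <= r.
Proof.
move=> r0 fr; have fE : mkl2 f = f :> (X -> R[i]).
  by apply: mkl2E; apply: le_lt_trans fr _; rewrite ltry.
by split=> //; apply: l2norm_le => //; rewrite fE.
Qed.

(** The intervals of centre [a n] and radius [e n] meet pairwise, so the
    supremum of their lower ends lies in all of them. *)
Lemma real_interval_limit (a e : nat -> R) : (forall n, 0 <= e n) ->
  (forall n m, (n <= m)%N -> `|a m - a n| <= e n) ->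
  exists l, forall n, `|l - a n| <= e n.
Proof.
move=> e0 ae; pose S := [set a n - e n | n in [set: nat]].
have ub n m : a n - e n <= a m + e m.
  have := e0 n; have := e0 m; have [nm|/ltnW mn] := leqP n m.
    by have := ae _ _ nm; rewrite ler_norml => /andP[]; lra.
  by have := ae _ _ mn; rewrite ler_norml => /andP[]; lra.
have hS : has_sup S.
  by split; [exists (a 0%N - e 0%N); exists 0%N|exists (a 0%N + e 0%N) => _ [n _ <-]].
exists (sup S) => n; rewrite ler_norml; apply/andP; split.
  suff : a n - e n <= sup S by lra.
  by apply: sup_upper_bound => //; exists n.
suff : sup S <= a n + e n by lra.
by apply: ge_sup => [|_ [m _ <-]//]; case: hS.
Qed.

Lemma complex_disc_limit (a : nat -> R[i]) (e : nat -> R) :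
  (forall n, 0 <= e n) ->
  (forall n m, (n <= m)%N -> normc (a m - a n) <= e n) ->
  exists l, forall n, normc (l - a n) <= 2 * e n.
Proof.
move=> e0 ae.
have [n m nm|u Hu] := @real_interval_limit (fun n => complex.Re (a n)) e e0.
  have := ae n m nm; apply: le_trans; apply: le_trans (normc_Re _).
  by case: (a m) => ? ?; case: (a n).
have [n m nm|v Hv] := @real_interval_limit (fun n => complex.Im (a n)) e e0.
  have := ae n m nm; apply: le_trans; apply: le_trans (normc_Im _).
  by case: (a m) => ? ?; case: (a n).
exists (u +i* v) => n; apply: (le_trans (normc_ReIm _)).
rewrite mulr2n mulrDl !mul1r; apply: lerD.
  by have := Hu n; case: (a n).
by have := Hv n; case: (a n).
Qed.

(** The limit is taken coordinatewise. Each finite partial sum of squares of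
    [l - u n] is approximated by that of [u m - u n] for large [m], hence is
    bounded by [e n ^+ 2]. *)
Lemma l2_complete (u : nat -> l2 R X) (e : nat -> R) :
  (forall n, 0 <= e n) -> (forall n m, (n <= m)%N -> e m <= e n) ->
  (forall eps : R, 0 < eps -> exists n, e n <= eps) ->
  (forall n m, (n <= m)%N -> l2norm (u m - u n) <= e n) ->
  exists l, forall n, l2norm (l - u n) <= e n.
Proof.
move=> e0 emon elim ue.
have /choice[l Hl] x : exists l, forall n, normc (l - u n x) <= 2 * e n.
  apply: complex_disc_limit => // n m nm; apply: le_trans (ue _ _ nm).
  by rewrite -l2BE normc_le_l2norm.
have key n : (sqsum (fun x => (l x - u n x)%R) <= (e n ^+ 2)%:E)%E.
  apply: sqsum_le => s us; apply/ler_addgt0Pr => eps eps0.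
  (* The modulus p of a coordinate of u M - u n is at most e n. If d <= 1, then
     (p + d)^2 <= p^2 + d (2 e n + 1); the excess is summed over N coordinates. *)
  pose N : R := (size s)%:R; have N0 : 0 <= N by rewrite ler0n.
  have c0 : 0 < N * (2 * e n + 1) + 1.
    by have := mulr_ge0 N0 (e0 n); have := e0 n; nra.
  pose d := Num.min 1 (eps / (N * (2 * e n + 1) + 1)).
  have d0 : 0 < d by rewrite lt_min ltr01 divr_gt0.
  have d1 : d <= 1 by rewrite ge_min lexx.
  have dN : d * (N * (2 * e n + 1) + 1) <= eps.
    by rewrite -ler_pdivlMr// ge_min lexx orbT.
  have [m Hm] := elim (d / 2) (divr_gt0 d0 (ltr0Sn _ _)).
  pose M := maxn n m.
  have eM : 2 * e M <= d.
    by have := emon _ _ (leq_maxr n m); rewrite -/M; lra.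
  apply: (@le_trans _ _ (\sum_(x <- s)
      (normc ((u M - u n) x) ^+ 2 + d * (2 * e n + 1)))).
    apply: ler_sum => x _.
    have h1 : normc ((u M - u n) x) <= e n.
      by apply: le_trans (normc_le_l2norm _ _) (ue _ _ (leq_maxl _ _)).
    have h2 : normc (l x - u n x) <= normc ((u M - u n) x) + d.
      have -> : l x - u n x = (u M - u n) x + (l x - u M x).
        by rewrite l2BE; ring.
      apply: (le_trans (normc_add _ _)); rewrite lerD2l.
      by apply: le_trans (Hl x M) eM.
    have := normc_ge0 (l x - u n x); have := normc_ge0 ((u M - u n) x).
    move: (normc _) (normc _) h1 h2 (e0 n) => p q; move: (e n) => w; nra.
  rewrite big_split/= big_const_seq count_predT iter_addr addr0.
  apply: lerD.
    apply: (le_trans (sum_le_l2norm (u M - u n) us)).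
    by rewrite ler_sqr ?nnegrE ?l2norm_ge0// ue// leq_maxl.
  rewrite -mulr_natr -/N; apply: le_trans dN.
  have := mulr_ge0 (mulr_ge0 (ltW d0) N0) (e0 n); nra.
have [lE _] := l2norm_mkl2 (e0 0%N) (key 0%N).
pose L := mkl2 (fun x => l x - u 0%N x) + u 0%N.
have LE x : L x = l x by rewrite l2DE lE subrK.
exists L => n; apply: l2norm_le => //.
rewrite (_ : (L - u n : X -> R[i]) = (fun x => l x - u n x)) //.
by apply/funext => x; rewrite l2BE LE.
Qed.

Definition restrict_to (A : set X) xi : l2 R X :=
  mkl2 (fun x => if x \in A then xi x else 0).

Lemma projE A xi x : restrict_to A xi x = if x \in A then xi x else 0.
Proof.
rewrite /restrict_to mkl2E//; apply: le_lt_trans (sqsum_l2 xi).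
by apply: le_esum => y _; case: ifP; rewrite lee_fin// normc0 expr0n sqr_ge0.
Qed.

Lemma proj_pythagoras A xi :
  l2norm (restrict_to A xi) ^+ 2 + l2norm (restrict_to (~` A) xi) ^+ 2 = l2norm xi ^+ 2.
Proof.
rewrite !l2norm_nsum -nsumD//; try by [move=> x; rewrite sqr_ge0|exact: l2_nsummable].
congr nsum; apply/funext => x; rewrite !projE in_setC if_neg.
by case: ifP => _; rewrite normc0 expr0n ?addr0 ?add0r.
Qed.

Lemma l2norm_proj A xi : l2norm (restrict_to A xi) <= l2norm xi.
Proof.
rewrite -ler_sqr ?nnegrE ?l2norm_ge0// -(proj_pythagoras A xi).
by rewrite lerDl sqr_ge0.
Qed.

Lemma proj_linear A : linear (restrict_to A).
Proof.
move=> k u v; apply: l2P => x; rewrite l2DE l2ZE !projE l2DE l2ZE.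
by case: ifP; rewrite ?mulr0 ?addr0.
Qed.

Lemma l2_tail xi (eps : R) : 0 < eps ->
  exists s : seq X, l2norm (restrict_to (~` [set` s]) xi) <= eps.
Proof.
move=> eps0; have e2 : 0 < eps ^+ 2 by rewrite exprn_gt0.
have : ((l2norm xi ^+ 2 - eps ^+ 2)%:E < sqsum xi)%E.
  by rewrite -sqr_l2norm lte_fin ltrBlDr ltrDl.
move=> /ereal_sup_gt[_ [A [finA _] <-]].
rewrite fsbig_finite//= sumEFin lte_fin => /ltW h.
exists (fset_set A); rewrite -ler_sqr ?nnegrE ?l2norm_ge0 ?(ltW eps0)//.
have := proj_pythagoras [set` fset_set A] xi.
suff : \sum_(x <- fset_set A) normc (xi x) ^+ 2 <=
    l2norm (restrict_to [set` fset_set A] xi) ^+ 2 by lra.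
apply: le_trans (sum_le_l2norm _ (fset_uniq (fset_set A))).
rewrite big_seq [leRHS]big_seq; apply: ler_sum => x xA.
by rewrite projE mem_set.
Qed.

(** Finitely supported vectors are dense, so a closed linear condition can be
    checked on the canonical basis. *)
Lemma l2_dense_ind (Q : l2 R X -> Prop) : Q 0 ->
  (forall k u v, Q u -> Q v -> Q (k *: u + v)) ->
  (forall x, Q (basis_vec R x)) ->
  (forall u, (forall eps : R, 0 < eps -> exists2 v, Q v & l2norm (u - v) <= eps) ->
     Q u) ->
  forall u, Q u.
Proof.
move=> Q0 Qlin Qb Qlim.
have fin (s : seq X) (u : l2 R X) : (forall x, x \notin s -> u x = 0) -> Q u.
  elim: s u => [|a s ih] u us; first by rewrite (_ : u = 0)//; apply: l2P => x; rewrite us.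
  rewrite -(subrK (u a *: basis_vec R a) u) addrC; apply: Qlin => //; apply: ih.
  move=> x xs; rewrite l2BE l2ZE basis_vecE; case: eqP => [->|/eqP xa].
    by rewrite mulr1 subrr.
  by rewrite mulr0 subr0 us// inE negb_or xa.
move=> u; apply: Qlim => eps /(l2_tail u)[s Hs].
exists (restrict_to [set` s] u).
  by apply: (fin s) => x /negP xs; rewrite projE memNset.
rewrite (_ : u - _ = restrict_to (~` [set` s]) u)//; apply: l2P => x.
by rewrite l2BE !projE in_setC if_neg; case: ifP => _; rewrite ?subrr ?subr0.
Qed.

End sequences_l2.

Section operators.
Context (R : realType).

Lemma linear_fun0 (V W : lmodType R[i]) (a : V -> W) : linear a -> a 0 = 0.
Proof. by move=> la; have := la (-1) 0 0; rewrite scaler0 addr0 scaleN1r addNr. Qed.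

Lemma linear_funD (V W : lmodType R[i]) (a : V -> W) u v : linear a ->
  a (u + v) = a u + a v.
Proof. by move=> la; have := la 1 u v; rewrite !scale1r. Qed.

Lemma linear_funZ (V W : lmodType R[i]) (a : V -> W) k u : linear a ->
  a (k *: u) = k *: a u.
Proof. by move=> la; have := la k u 0; rewrite !addr0 (linear_fun0 la) addr0. Qed.

Lemma linear_funN (V W : lmodType R[i]) (a : V -> W) u : linear a ->
  a (- u) = - a u.
Proof. by move=> la; rewrite -scaleN1r linear_funZ// scaleN1r. Qed.

Lemma linear_funB (V W : lmodType R[i]) (a : V -> W) u v : linear a ->
  a (u - v) = a u - a v.
Proof. by move=> la; rewrite linear_funD// linear_funN. Qed.

Implicit Types X Y : choiceType.

(** Estimates are stated with explicit real bounds, so that they stay in [R]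
    while [opnorm] takes its values in the extended reals. *)
Definition opbound X Y (a : l2 R X -> l2 R Y) (k : R) :=
  forall xi, l2norm (a xi) <= k * l2norm xi.

Lemma bounded_opP X (a : l2 R X -> l2 R X) : bounded_op a ->
  exists2 k, 0 <= k & opbound a k.
Proof.
move=> [_ [k ak]]; exists `|k| => // xi; apply: le_trans (ak xi) _.
by rewrite ler_wpM2r ?l2norm_ge0// ler_norm.
Qed.

Lemma le_opbound X Y (a : l2 R X -> l2 R Y) k l :
  k <= l -> opbound a k -> opbound a l.
Proof.
by move=> kl ak xi; apply: le_trans (ak xi) _; rewrite ler_wpM2r ?l2norm_ge0.
Qed.

Lemma opboundD X Y (a b : l2 R X -> l2 R Y) k l :
  opbound a k -> opbound b l -> opbound (a + b) (k + l).
Proof.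
move=> ak bl xi; apply: (le_trans (ler_l2normD _ _)).
by rewrite mulrDl lerD.
Qed.

Lemma opboundZ X Y (a : l2 R X -> l2 R Y) k c :
  opbound a k -> opbound (c *: a) (normc c * k).
Proof. by move=> ak xi; rewrite l2normZ -mulrA ler_wpM2l ?normc_ge0. Qed.

Lemma opboundN X Y (a : l2 R X -> l2 R Y) k : opbound a k -> opbound (- a) k.
Proof. by move=> ak xi; rewrite [(- a) xi]/(- a xi) l2normN. Qed.

Lemma opbound_comp X Y Z (a : l2 R Y -> l2 R Z) (b : l2 R X -> l2 R Y) k l :
  0 <= k -> opbound a k -> opbound b l -> opbound (a \o b) (k * l).
Proof.
move=> k0 ak bl xi; apply: (le_trans (ak _)).
by rewrite -mulrA ler_wpM2l.
Qed.

Lemma linear_comb X Y (a b : l2 R X -> l2 R Y) k :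
  linear a -> linear b -> linear (k *: a + b).
Proof.
move=> la lb c u v; have E w : (k *: a + b) w = k *: a w + b w by [].
by apply: l2P => x; rewrite !E la lb !(l2DE, l2ZE); ring.
Qed.

Lemma linear_compo X Y Z (a : l2 R Y -> l2 R Z) (b : l2 R X -> l2 R Y) :
  linear a -> linear b -> linear (a \o b).
Proof. by move=> la lb c u v /=; rewrite lb la. Qed.

Lemma bounded_op_comb X (a b : l2 R X -> l2 R X) k :
  bounded_op a -> bounded_op b -> bounded_op (k *: a + b).
Proof.
move=> ba bb; have [p p0 ap] := bounded_opP ba; have [q q0 bq] := bounded_opP bb.
case: ba bb => la _ [lb _]; split; first exact: linear_comb.
by exists (normc k * p + q); apply: opboundD => //; exact: opboundZ.
Qed.

Lemma bounded_op_comp X (a b : l2 R X -> l2 R X) :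
  bounded_op a -> bounded_op b -> bounded_op (a \o b).
Proof.
move=> ba bb; have [p p0 ap] := bounded_opP ba; have [q q0 bq] := bounded_opP bb.
case: ba bb => la _ [lb _]; split; first exact: linear_compo.
by exists (p * q); apply: opbound_comp.
Qed.

Lemma bounded_op0 X : bounded_op (0 : l2 R X -> l2 R X).
Proof.
split; first by move=> k u v; rewrite -[RHS]/(k *: 0 + 0) scaler0 addr0.
by exists 0 => xi; rewrite -[X in l2norm X]/0 l2norm0 mul0r.
Qed.

Lemma opnorm_le X (a : l2 R X -> l2 R X) k : 0 <= k -> opbound a k ->
  (opnorm a <= k%:E)%E.
Proof.
move=> k0 ak; apply: ge_ereal_sup => _ [xi /= xi1 <-]; rewrite lee_fin.
by apply: (le_trans (ak xi)); rewrite ler_piMr.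
Qed.

Lemma opbound_opnorm X (a : l2 R X -> l2 R X) k : linear a ->
  (opnorm a <= k%:E)%E -> opbound a k.
Proof.
move=> la ak xi; have [x0|x0] := eqVneq (l2norm xi) 0.
  by rewrite (l2norm_eq0 x0) (linear_fun0 la) l2norm0 mulr0.
have n0 : 0 < l2norm xi by rewrite lt_neqAle eq_sym x0 l2norm_ge0.
pose c : R[i] := ((l2norm xi)^-1)%:C.
have cE : normc c = (l2norm xi)^-1 by rewrite normc_real ger0_norm// invr_ge0 l2norm_ge0.
have : ((l2norm (a (c *: xi)))%:E <= k%:E)%E.
  apply: le_trans ak; apply: ereal_sup_ubound; exists (c *: xi) => //=.
  by rewrite l2normZ cE mulVf.
by rewrite lee_fin linear_funZ// l2normZ cE mulrC ler_pdivrMr.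
Qed.

Lemma op_closure_approx X (S : set (l2 R X -> l2 R X)) a :
  (forall b, S b -> linear b) -> op_closure S a ->
  forall eps : R, 0 < eps -> exists2 b, S b & opbound (a - b) eps.
Proof.
move=> Slin [[la _] aS] eps /aS[b Sb ab]; exists b => //.
apply: opbound_opnorm; last exact: ltW.
by rewrite addrC -scaleN1r; apply: linear_comb => //; exact: Slin.
Qed.

Lemma op_closureI X (S : set (l2 R X -> l2 R X)) a : bounded_op a ->
  (forall eps : R, 0 < eps -> exists2 b, S b & opbound (a - b) eps) ->
  op_closure S a.
Proof.
move=> ba aS; split=> // eps eps0.
have [b Sb ab] := aS (eps / 2) (divr_gt0 eps0 (ltr0Sn _ _)).
exists b => //; apply: (@le_lt_trans _ _ (eps / 2)%:E).
  by apply: opnorm_le => //; rewrite divr_ge0// ltW.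
by rewrite lte_fin; lra.
Qed.

Lemma sub_op_closure X (S : set (l2 R X -> l2 R X)) a :
  bounded_op a -> S a -> op_closure S a.
Proof.
move=> ba Sa; apply: op_closureI => // eps eps0; exists a => // xi.
by rewrite -[X in l2norm X]/(a xi - a xi) subrr l2norm0 mulr_ge0 ?l2norm_ge0// ltW.
Qed.

Lemma l2_eq_eps X (u v : l2 R X) (C : R) : 0 <= C ->
  (forall eps : R, 0 < eps -> l2norm (u - v) <= C * eps) -> u = v.
Proof.
move=> C0 uv; apply/eqP; rewrite -subr_eq0; apply/eqP/l2norm_eq0/eqP.
rewrite eq_le l2norm_ge0 andbT; apply/ler_addgt0Pr => eps eps0; rewrite add0r.
have C1 : 0 < C + 1 by lra.
apply: (le_trans (uv (eps / (C + 1)) (divr_gt0 eps0 C1))).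
by rewrite mulrCA ger_pMr// ler_pdivrMr// mul1r; lra.
Qed.

(** Operators form a Banach space: the limit exists pointwise by completeness
    of [l^2], and it is linear since the approximants are. *)
Lemma op_complete X Y (T : nat -> l2 R X -> l2 R Y) (e : nat -> R) :
  (forall n, 0 <= e n) -> (forall n m, (n <= m)%N -> e m <= e n) ->
  (forall eps : R, 0 < eps -> exists n, e n <= eps) ->
  (forall n, linear (T n)) ->
  (forall n m, (n <= m)%N -> opbound (T m - T n) (e n)) ->
  exists2 L, linear L & forall n, opbound (L - T n) (e n).
Proof.
move=> e0 emon elim lT Te.
have /choice[L HL] xi : exists l, forall n, l2norm (l - T n xi) <= e n * l2norm xi.
  apply: (@l2_complete _ _ (fun n => T n xi) (fun n => e n * l2norm xi)).
  - by move=> n; rewrite mulr_ge0 ?l2norm_ge0.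
  - by move=> n m nm; rewrite ler_wpM2r ?l2norm_ge0 ?emon.
  - move=> eps eps0; have c0 : 0 < l2norm xi + 1 by rewrite ltr_pwDr ?l2norm_ge0.
    have [n Hn] := elim (eps / (l2norm xi + 1)) (divr_gt0 eps0 c0).
    exists n; apply: (@le_trans _ _ (e n * (l2norm xi + 1))).
      by rewrite ler_wpM2l// lerDl.
    by rewrite -ler_pdivlMr.
  - by move=> n m nm; exact: Te.
exists L; [move=> k u v|by move=> n xi; exact: HL].
apply: (@l2_eq_eps _ _ _ (l2norm (k *: u + v) + normc k * l2norm u + l2norm v)).
  by rewrite !addr_ge0 ?mulr_ge0 ?l2norm_ge0 ?normc_ge0.
move=> eps /elim[n Hn].
have -> : L (k *: u + v) - (k *: L u + L v) = (L (k *: u + v) - T n (k *: u + v))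
    - (k *: (L u - T n u) + (L v - T n v)).
  by rewrite lT scalerBr [RHS]addrC !opprD !opprK !addrA; 
    apply: l2P => x; rewrite !(l2DE, l2NE, l2ZE); ring.
apply: (le_trans (ler_l2normB _ _)); rewrite -addrA mulrDl; apply: lerD.
  by apply: le_trans (HL _ n) _; rewrite mulrC ler_wpM2l ?l2norm_ge0.
apply: (le_trans (ler_l2normD _ _)); rewrite mulrDl; apply: lerD.
  rewrite l2normZ -mulrA ler_wpM2l ?normc_ge0//.
  by apply: le_trans (HL _ n) _; rewrite mulrC ler_wpM2l ?l2norm_ge0.
by apply: le_trans (HL _ n) _; rewrite mulrC ler_wpM2l ?l2norm_ge0.
Qed.

Lemma opbound_limit X Y (L T : l2 R X -> l2 R Y) k e :
  opbound (L - T) e -> opbound T k -> opbound L (e + k).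
Proof.
move=> LT Tk xi; rewrite -(subrK (T xi) (L xi)).
apply: (le_trans (ler_l2normD _ _)); rewrite mulrDl.
by apply: lerD; [exact: LT|exact: Tk].
Qed.

Lemma op_ext_basis X Y (a b : l2 R X -> l2 R Y) k l :
  linear a -> linear b -> 0 <= k -> 0 <= l -> opbound a k -> opbound b l ->
  (forall x, a (basis_vec R x) = b (basis_vec R x)) -> a = b.
Proof.
move=> la lb k0 l0 ak bl ab; apply/funext; apply: l2_dense_ind => [||//|].
- by rewrite (linear_fun0 la) (linear_fun0 lb).
- by move=> c u v au av; rewrite la lb au av.
- move=> u Hu; apply: (@l2_eq_eps _ _ _ (k + l)); first exact: addr_ge0.
  move=> eps /Hu[v av uv].
  have -> : a u - b u = a (u - v) - b (u - v).
    by rewrite (linear_funB _ _ la) (linear_funB _ _ lb) av opprB addrA subrK.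
  apply: (le_trans (ler_l2normB _ _)); rewrite mulrDl; apply: lerD.
    by apply: (le_trans (ak _)); rewrite ler_wpM2l.
  by apply: (le_trans (bl _)); rewrite ler_wpM2l.
Qed.

Lemma adjointC X (a b : l2 R X -> l2 R X) : adjoint a b -> adjoint b a.
Proof. by move=> ab u v; rewrite innerC -ab -innerC. Qed.

Lemma adjoint_comp X (a b c d : l2 R X -> l2 R X) :
  adjoint a b -> adjoint c d -> adjoint (a \o c) (d \o b).
Proof. by move=> ab cd u v /=; rewrite ab cd. Qed.

Lemma adjoint_comb X (a b c d : l2 R X -> l2 R X) (k : R) :
  adjoint a b -> adjoint c d -> adjoint (k%:C *: a + c) (k%:C *: b + d).
Proof.
move=> ab cd u v.
have E (f g : l2 R X -> l2 R X) w : (k%:C *: f + g) w = k%:C *: f w + g w by [].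
by rewrite !E innerDl innerDr innerZl innerZr ab cd conjc_real.
Qed.

(** [||b v||^2 = <a (b v), v>]. *)
Lemma adjoint_bound X (a b : l2 R X -> l2 R X) k : adjoint a b ->
  opbound a k -> opbound b k.
Proof.
move=> ab ak v; have [b0|b0] := eqVneq (l2norm (b v)) 0.
  rewrite b0; have := ak v; apply: le_trans; exact: l2norm_ge0.
have n0 : 0 < l2norm (b v) by rewrite lt_neqAle eq_sym b0 l2norm_ge0.
rewrite -(ler_pM2l n0) -expr2.
have := inner_norm (b v); rewrite -ab => /(congr1 (@normc R)).
rewrite normc_real ger0_norm ?sqr_ge0// => <-.
apply: (le_trans (cauchy_schwarz _ _)).
by rewrite mulrCA mulrA ler_wpM2r ?l2norm_ge0// mulrC.
Qed.

Lemma complex_eq_eps (z w : R[i]) (C : R) : 0 <= C ->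
  (forall eps : R, 0 < eps -> normc (z - w) <= C * eps) -> z = w.
Proof.
move=> C0 zw; apply/eqP; rewrite -subr_eq0; apply/eqP/eq0_normc/eqP.
rewrite eq_le normc_ge0 andbT; apply/ler_addgt0Pr => eps eps0; rewrite add0r.
have C1 : 0 < C + 1 by lra.
apply: (le_trans (zw (eps / (C + 1)) (divr_gt0 eps0 C1))).
by rewrite mulrCA ger_pMr// ler_pdivrMr// mul1r; lra.
Qed.

Lemma adjoint_limit X (a b : l2 R X -> l2 R X) :
  (forall eps : R, 0 < eps -> exists c d, [/\ adjoint c d, opbound (a - c) eps &
     opbound (b - d) eps]) -> adjoint a b.
Proof.
move=> H u v; apply: (@complex_eq_eps _ _ (2 * (l2norm u * l2norm v))).
  by rewrite !mulr_ge0 ?l2norm_ge0.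
move=> eps /H[c [d [cd ac bd]]].
have -> : inner (a u) v - inner u (b v) = inner ((a - c) u) v - inner u ((b - d) v).
  rewrite -[(a - c) u]/(a u - c u) -[(b - d) v]/(b v - d v).
  rewrite innerDl innerNl innerDr innerNr cd; ring.
apply: (le_trans (normc_add _ _)); rewrite normcN.
have -> : 2 * (l2norm u * l2norm v) * eps =
    eps * l2norm u * l2norm v + l2norm u * (eps * l2norm v) by ring.
apply: lerD.
  by apply: (le_trans (cauchy_schwarz _ _)); rewrite ler_wpM2r ?l2norm_ge0.
by apply: (le_trans (cauchy_schwarz _ _)); rewrite ler_wpM2l ?l2norm_ge0.
Qed.

(** Both sides of the adjunction are continuous and additive in each vector,
    so it is enough to compare matrix coefficients: one vector at a time is
    moved from the basis to the whole space by density. *)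
Lemma adjoint_basis X (a b : l2 R X -> l2 R X) : bounded_op a -> bounded_op b ->
  (forall x y, a (basis_vec R y) x = conjc (b (basis_vec R x) y)) -> adjoint a b.
Proof.
move=> ba bb ab; have [k k0 ak] := bounded_opP ba; have [l l0 bl] := bounded_opP bb.
case: ba bb => la _ [lb _].
have lim (P : l2 R X -> R[i]) (Q : l2 R X -> R[i]) (C : R) : 0 <= C ->
    (forall u v, normc (P u - P v) <= C * l2norm (u - v)) ->
    (forall u v, normc (Q u - Q v) <= C * l2norm (u - v)) ->
    forall u, (forall eps : R, 0 < eps -> exists2 v, P v = Q v & l2norm (u - v) <= eps) ->
    P u = Q u.
  move=> C0 HP HQ u Hu; apply: (@complex_eq_eps _ _ (C + C)); first exact: addr_ge0.
  move=> eps /Hu[v PQ uv].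
  have -> : P u - Q u = (P u - P v) + (Q v - Q u) by rewrite PQ; ring.
  apply: (le_trans (normc_add _ _)); rewrite mulrDl; apply: lerD.
    by apply: (le_trans (HP _ _)); rewrite ler_wpM2l.
  rewrite -normcN opprB.
  by apply: (le_trans (HQ _ _)); rewrite ler_wpM2l.
have key x u : inner (a u) (basis_vec R x) = inner u (b (basis_vec R x)).
  move: u; apply: l2_dense_ind => [|c u v|y|].
  - by rewrite (linear_fun0 la) -(scale0r 0) !innerZl !mul0r.
  - by rewrite la !innerDl !innerZl => -> ->.
  - by rewrite inner_basis ab [RHS]innerC inner_basis.
  - apply: (lim (fun u => inner (a u) (basis_vec R x))
      (fun u => inner u (b (basis_vec R x))) (k + l)); first exact: addr_ge0.
    + move=> u v; rewrite -innerNl -innerDl -(linear_funB _ _ la).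
      apply: (le_trans (cauchy_schwarz _ _)); rewrite l2norm_basis_vec mulr1.
      by apply: (le_trans (ak _)); rewrite ler_wpM2r ?l2norm_ge0// lerDl.
    + move=> u v; rewrite -innerNl -innerDl.
      apply: (le_trans (cauchy_schwarz _ _)); rewrite mulrC ler_wpM2r ?l2norm_ge0//.
      by apply: (le_trans (bl _)); rewrite l2norm_basis_vec mulr1 lerDr.
move=> u; apply: l2_dense_ind => [|c v w|x|].
- by rewrite (linear_fun0 lb) -(scale0r 0) !innerZr conjc0 !mul0r.
- by rewrite lb !innerDr !innerZr => -> ->.
- exact: key.
- apply: (lim (fun v => inner (a u) v) (fun v => inner u (b v))
      ((k + l) * l2norm u)); first by rewrite mulr_ge0 ?addr_ge0 ?l2norm_ge0.
  + move=> v w; rewrite -innerNr -innerDr.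
    apply: (le_trans (cauchy_schwarz _ _)); rewrite ler_wpM2r ?l2norm_ge0//.
    by apply: (le_trans (ak _)); rewrite ler_wpM2r ?l2norm_ge0// lerDl.
  + move=> v w; rewrite -innerNr -innerDr -(linear_funB _ _ lb).
    apply: (le_trans (cauchy_schwarz _ _)); rewrite -mulrA mulrCA ler_wpM2l ?l2norm_ge0//.
    by apply: (le_trans (bl _)); rewrite ler_wpM2r ?l2norm_ge0// lerDr.
Qed.

End operators.

(** * Compact open sets in totally disconnected spaces *)

Section zero_dimensionality.
Context (T : topologicalType).
Implicit Types (x y : T) (A B C D K O : set T).

(** A filter that can be separated from each point of a compact set can be
    separated from the whole set. It is used with the neighbourhoods of a point,
    the neighbourhoods of a compact set, and a filter of clopen sets. *)
Lemma compact_filter_separation K (N : set_system T) : ProperFilter N -> compact K ->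
  (forall y, K y -> exists A B, [/\ N A, nbhs y B & A `&` B = set0]) ->
  exists A B, [/\ N A, open B, K `<=` B & A `&` B = set0].
Proof.
move=> FN cK H.
move: cK => /compact_near_coveringP cov.
have FP : Filter (powerset_filter_from N).
  by apply: filter_filter; exact: powerset_filter_from_filter.
have := cov _ (powerset_filter_from N)
  (fun A y => exists B, nbhs y B /\ A `&` B = set0) FP.
case=> [y /H[A [B [NA]]]|].
  rewrite nbhsE => -[B' [oB' B'y] B'B] AB.
  exists (B', [set A' | A' `<=` A]); first split => /=.
  - exact: open_nbhs_nbhs.
  - apply/near_powerset_filter_fromP; first by move=> ? ?; exact: subset_trans.
    by exists A.
  - move=> [y' A'] [/= B'y' A'A]; exists B'; split.
      by rewrite nbhsE; exists B'.
    by apply/seteqP; split=> // z [/A'A Az /B'B Bz]; rewrite -AB.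
move=> S [SN _ [A SA]] /(_ _ SA) KA.
exists A, (\bigcup_(V in [set V | open V /\ A `&` V = set0]) V); split.
- exact: SN.
- by apply: bigcup_open => V [].
- move=> y /KA[B []]; rewrite nbhsE => -[V [oV Vy] VB] AB; exists V => //.
  by split=> //; apply/seteqP; split=> // z [Az /VB Bz]; rewrite -AB.
- by apply/seteqP; split=> // z [Az [V [_ AV] Vz]]; rewrite -AV.
Qed.

Lemma compact_separation K L : hausdorff_space T -> compact K -> compact L ->
  K `&` L = set0 ->
  exists V W, [/\ open V, open W, K `<=` V, L `<=` W & V `&` W = set0].
Proof.
move=> hT cK cL KL; have [->|/set0P[k Kk]] := eqVneq K set0.
  by exists set0, setT; split; rewrite ?set0I//; [exact: open0|exact: openT].
pose N := filter_from [set V | open V /\ K `<=` V] id.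
have FN : ProperFilter N.
  apply: filter_from_proper => [|V [_ KV]]; last by exists k; exact: KV.
  apply: filter_from_filter; first by exists setT; split=> //; exact: openT.
  move=> A B [oA KA] [oB KB]; exists (A `&` B) => //.
  by split; [exact: openI|move=> z Kz; split; [exact: KA|exact: KB]].
have [|A [B [[V [oV KV] VA] oB LB AB]]] := @compact_filter_separation L N FN cL.
  move=> y Ly.
  have [|A [B [Ay oB KB AB]]] := @compact_filter_separation K (nbhs y) _ cK.
    move=> x Kx; have yx : y != x.
      by apply/eqP => yx; rewrite -[False]/(set0 x) -KL; split=> //; rewrite -yx.
    have := hT; rewrite open_hausdorff => /(_ _ _ yx)[[A B] /= [+ +] [oA oB /eqP AB]].
    by rewrite !inE => Ay Bx; exists A, B; split=> //; exact: open_nbhs_nbhs.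
  by exists B, A; split=> //; [exists B|rewrite setIC].
exists V, B; split=> //.
by apply/seteqP; split=> // z [/VA Az Bz]; rewrite -AB.
Qed.

(** Inside a compact neighbourhood the intersection of the relatively clopen
    sets containing [x] is connected, hence reduced to [x]; compactness then
    puts one of these sets inside any given neighbourhood. *)
Lemma compact_open_basis x O : hausdorff_space T -> locally_compact [set: T] ->
  (forall C, connected C -> C x -> C `<=` [set x]) -> open O -> O x ->
  exists K, [/\ compact K, open K, K x & K `<=` O].
Proof.
move=> hT lcT dis oO Ox.
have [C nC [cC clC]] := lcT x I.
have {}nC : nbhs x C by move: nC; rewrite /within/=; apply: filterS => z; apply.
wlog OC : O oO Ox / O `<=` C => [H|].
  have [| | |K [cK oK Kx KO]] := H (O `&` C^°).
  - by apply: openI => //; exact: open_interior.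
  - by [].
  - by move=> y [_ /interior_subset].
  by exists K; split=> // y /KO[].
pose F := [set D | [/\ D x, D `<=` C, closed D & closed (C `\` D)]].
have FI A B : F A -> F B -> F (A `&` B).
  move=> [Ax AC cA cA'] [Bx BC cB cB']; split=> //.
  - by move=> z [/AC].
  - exact: closedI.
  - by rewrite setDIr; exact: closedU.
have FC : F C.
  split=> //; first exact: nbhs_singleton.
  by rewrite setDv; exact: closed0.
have FN : ProperFilter (filter_from F id).
  apply: filter_from_proper => [|D [Dx _ _ _]]; last by exists x.
  apply: filter_from_filter; first by exists C.
  by move=> A B FA FB; exists (A `&` B) => //; exact: FI.
have shrink W : open W -> \bigcap_(D in F) D `<=` W -> exists2 D, F D & D `<=` W.
  move=> oW QW.
  have [||A [B [[D FD DA] oB CB AB]]] :=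
      @compact_filter_separation (C `\` W) (filter_from F id) FN.
  - by rewrite setDE; apply: compact_closedI => //; exact: open_closedC.
  - move=> y [Cy Wy]; have [D FD Dy] : exists2 D, F D & ~ D y.
      apply: contrapT => nD; apply: Wy; apply: QW => D FD.
      by apply: contrapT => nDy; apply: nD; exists D.
    exists D, (~` D); split; [by exists D| |by rewrite setICr].
    by apply: open_nbhs_nbhs; split=> //; apply: closed_openC; case: FD.
  exists D => // z Dz; apply: contrapT => nW.
  have : (A `&` B) z by split; [exact: DA|apply: CB; split=> //; case: FD => _ + _ _; exact].
  by rewrite AB.
pose Q := \bigcap_(D in F) D.
have Qx : Q x by move=> D [].
have QC : Q `<=` C by move=> z /(_ _ FC).
have clQ : closed Q by apply: closed_bigI => D [].
have cQ : connected Q.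
  move=> B [b Bb] [V oV BV] [E cE BE].
  have cB : compact B.
    by rewrite BE; apply: (subclosed_compact _ cC); [exact: closedI|move=> z [/QC]].
  pose B' := Q `&` ~` V.
  have cB' : compact B'.
    apply: (subclosed_compact _ cC); last by move=> z [/QC].
    by apply: closedI => //; exact: open_closedC.
  have BB' : B `&` B' = set0.
    by apply/seteqP; split=> // z [+ [_ nV]]; rewrite BV => -[].
  have QE z : Q z -> B z \/ B' z.
    by move=> Qz; have [Vz|nVz] := pselect (V z); [left; rewrite BV|right].
  have [V1 [V2 [oV1 oV2 BV1 BV2 V12]]] := compact_separation hT cB cB' BB'.
  have [||D FD D12] := shrink (V1 `|` V2); first exact: openU.
    by move=> z /QE[/BV1|/BV2]; [left|right].
  have half U1 U2 : open U1 -> open U2 -> U1 `&` U2 = set0 -> D `<=` U1 `|` U2 ->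
      U1 x -> Q `<=` U1.
    move=> o1 o2 U12 DU U1x; suff : F (D `&` U1) by move=> FDU z /(_ _ FDU)[].
    case: FD => Dx DC cD cD'; split=> //.
    - by move=> z [/DC].
    - rewrite (_ : D `&` U1 = D `&` ~` U2).
        by apply: closedI => //; exact: open_closedC.
      apply/seteqP; split=> z [Dz] => [U1z|nU2]; split=> //.
        by move=> U2z; rewrite -[False]/(set0 z) -U12.
      by case: (DU z Dz).
    - rewrite setDIr; apply: closedU => //.
      rewrite setDE; apply: closedI => //; exact: open_closedC.
  have sub U1 U2 : U1 `&` U2 = set0 -> Q `<=` U1 -> forall z, Q z -> ~ U2 z.
    by move=> U12 QU z /QU U1z U2z; rewrite -[False]/(set0 z) -U12.
  have V21 : V2 `&` V1 = set0 by rewrite setIC.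
  have [xB|xB'] := QE x Qx.
    have QV := half V1 V2 oV1 oV2 V12 D12 (BV1 _ xB).
    apply/seteqP; split=> z; first by rewrite BV => -[].
    by move=> Qz; case: (QE z Qz) => // /BV2; have := sub _ _ V12 QV z Qz.
  have D21 : D `<=` V2 `|` V1 by rewrite setUC.
  have QV := half V2 V1 oV2 oV1 V21 D21 (BV2 _ xB').
  have Qb : Q b by move: Bb; rewrite BV => -[].
  by have := sub _ _ V21 QV b Qb (BV1 _ Bb).
have [D FD DO] : exists2 D, F D & D `<=` O.
  by apply: shrink => // z Qz; rewrite (dis Q cQ Qx z Qz).
case: FD => Dx DC cD cD'; exists D; split=> //.
  exact: (subclosed_compact cD cC).
rewrite (_ : D = O `&` ~` (C `\` D)).
  by apply: openI => //; exact: closed_openC.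
apply/seteqP; split=> z; first by move=> Dz; split; [exact: DO|move=> []].
by move=> [Oz nCD]; apply: contrapT => nD; apply: nCD; split=> //; exact: OC.
Qed.

Definition copen K := compact K /\ open K.

Lemma copen0 : copen set0.
Proof. by split; [exact: compact0|exact: open0]. Qed.

Lemma copenU K L : copen K -> copen L -> copen (K `|` L).
Proof. by move=> [? ?] [? ?]; split; [exact: compactU|exact: openU]. Qed.

Lemma copen_closed K : hausdorff_space T -> copen K -> closed K.
Proof. by move=> hT [? _]; exact: compact_closed. Qed.

Lemma copenI K L : hausdorff_space T -> copen K -> copen L -> copen (K `&` L).
Proof.
move=> hT cK cL; case: (cK) (cL) => ? ? [? ?]; split; last exact: openI.
by apply: compact_closedI => //; exact: copen_closed.
Qed.

Lemma copenD K L : hausdorff_space T -> copen K -> copen L -> copen (K `\` L).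
Proof.
move=> hT cK cL; case: (cK) (cL) => ? ? [? ?]; rewrite setDE; split.
  by apply: compact_closedI => //; exact: open_closedC.
by apply: openI => //; apply: closed_openC; exact: copen_closed.
Qed.

(** A finite cover by compact open sets can be made disjoint, so a property that
    holds locally and passes to disjoint unions holds around a compact set. *)
Lemma copen_ind (E : set T -> Prop) C : hausdorff_space T -> compact C ->
  E set0 ->
  (forall K L, copen K -> copen L -> K `&` L = set0 -> E K -> E L -> E (K `|` L)) ->
  (forall z, C z -> exists N, [/\ copen N, N z &
     forall L, copen L -> L `<=` N -> E L]) ->
  exists U, [/\ copen U, C `<=` U & forall L, copen L -> L `<=` U -> E L].
Proof.
move=> hT cC E0 EU HC.
pose good N := copen N /\ forall L, copen L -> L `<=` N -> E L.
have gU N N' : good N -> good N' -> good (N `|` N').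
  move=> [cN gN] [cN' gN']; split; first exact: copenU.
  move=> L cL LN; rewrite -(setUIDK L N); apply: EU.
  - exact: copenI.
  - exact: copenD.
  - by apply/seteqP; split=> // z [[_ ?] []].
  - by apply: gN => [|z []//]; exact: copenI.
  - apply: gN' => [|z [Lz nN]]; first exact: copenD.
    by case: (LN z Lz).
have /choice[N HN] z : exists N, C z -> good N /\ N z.
  have [Cz|nCz] := pselect (C z); last by exists set0.
  by have [N [? ? ?]] := HC z Cz; exists N.
have cov : cover_compact C := compact_coverT cC.
have [z Cz|z Cz|D DC CD] := cov T C N.
- by have [[[]]] := HN z Cz.
- by exists z => //; have [] := HN z Cz.
have [cU gU'] : good (\big[setU/set0]_(z <- D) N z).
  rewrite big_seq; elim/big_ind: _ => [|//|z zD].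
    by split; [exact: copen0|move=> L _; rewrite subset0 => ->].
  by have /set_mem Cz := DC z zD; have [] := HN z Cz.
exists (\big[setU/set0]_(z <- D) N z); split=> // z /CD[w wD Nwz].
by rewrite -bigcup_seq; exists w.
Qed.

End zero_dimensionality.

(** * The topology of an etale groupoid *)

Section groupoid_identities.
Context (G : groupoidType).
Implicit Types x y z : G.

Lemma gmulKV x y : src x = rng y -> gmul (gmul x y) (ginv y) = x.
Proof. by move=> xy; rewrite -gmulA ?rng_inv// gmulxV -xy gmul_src. Qed.

Lemma gmulVKl x y : src x = rng y -> gmul (ginv x) (gmul x y) = y.
Proof. by move=> xy; rewrite gmulA ?src_inv// gmulVx xy gmul_rng. Qed.

Lemma ginvM x y : src x = rng y -> ginv (gmul x y) = gmul (ginv y) (ginv x).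
Proof.
move=> xy; have cV : src (ginv y) = rng (ginv x) by rewrite src_inv rng_inv.
have sV : src (gmul (ginv y) (ginv x)) = rng (gmul x y).
  by rewrite src_mul// src_inv rng_mul.
have E : gmul (gmul (ginv y) (ginv x)) (gmul x y) = src (gmul x y).
  rewrite -gmulA//; last by rewrite src_inv rng_mul.
  by rewrite gmulVKl// gmulVx src_mul.
by rewrite -[RHS](gmulKV sV) E -[in LHS](gmul_rng (ginv _)) rng_inv.
Qed.

End groupoid_identities.

Section etale_topology.
Context (G : etaleGroupoidType).
Implicit Types (x y z : G) (A B K L O V : set G).

Lemma local_homeo_continuous (f : G -> G) :
  local_homeo_into (@units G) f -> continuous f.
Proof.
move=> hf x; have [U [oU Ux cf _ _]] := hf x.
by move: cf; rewrite continuous_open_subspace// => /(_ x); rewrite inE; exact.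
Qed.

Lemma src_continuous : continuous (src : G -> G).
Proof. exact: local_homeo_continuous (src_local_homeo (s := G)). Qed.

Lemma rng_continuous : continuous (rng : G -> G).
Proof. exact: local_homeo_continuous (rng_local_homeo (s := G)). Qed.

(** Near a unit the source map is injective and fixes its own values. *)
Lemma open_units : open (@units G).
Proof.
rewrite openE => u /= su; have [U [oU Uu _ iU _]] := src_local_homeo u.
rewrite /interior nbhsE; exists (U `&` src @^-1` U).
  split; last by split=> //=; rewrite su.
  by apply: openI => //; move/continuousP: src_continuous; apply.
move=> z [Uz Usz]; rewrite /units/=; apply: iU; rewrite ?inE//.
by rewrite src_src.
Qed.

Lemma local_homeo_open (f : G -> G) :
  local_homeo_into (@units G) f -> forall V, open V -> open (f @` V).
Proof.
move=> hf V oV; rewrite openE => _ [x Vx <-]; rewrite /interior nbhsE.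
have [U [oU Ux _ _ fU]] := hf x.
have [|W [oW fW]] := fU (U `&` V) (openI oU oV); first by move=> z [].
exists (f @` (U `&` V)).
  by split; [rewrite fW; apply: openI => //; exact: open_units|exists x].
by move=> _ [z [_ Vz] <-]; exists z.
Qed.

Lemma src_open V : open V -> open (src @` V).
Proof. exact: local_homeo_open (src_local_homeo (s := G)) V. Qed.

Lemma rng_open V : open V -> open (rng @` V).
Proof. exact: local_homeo_open (rng_local_homeo (s := G)) V. Qed.

Lemma copen_image (f : G -> G) K : continuous f ->
  (forall V, open V -> open (f @` V)) -> copen K -> copen (f @` K).
Proof.
move=> cf of_ [cK oK]; split; last exact: of_.
by apply: continuous_compact => //; exact: continuous_subspaceT.
Qed.

Lemma copen_src K : copen K -> copen (src @` K).
Proof. by apply: copen_image; [exact: src_continuous|exact: src_open]. Qed.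

Lemma copen_rng K : copen K -> copen (rng @` K).
Proof. by apply: copen_image; [exact: rng_continuous|exact: rng_open]. Qed.

Lemma clopen_copen K : copen K -> clopen K.
Proof.
by move=> cK; split; [case: cK|exact: copen_closed (@etale_hausdorff G) cK].
Qed.

(** A connected set is mapped by the source to a connected set of units, that
    is, to a point; the source being locally injective, the set is itself a
    point, and [compact_open_basis] applies to the whole groupoid. *)
Lemma etale_copen_basis x O : totally_disconnected (@units G) -> open O -> O x ->
  exists K, [/\ copen K, K x, K `<=` O & bisection K].
Proof.
move=> td oO Ox.
have [U [oU Ux _ iU _]] := src_local_homeo x.
have [V [oV Vx _ iV _]] := rng_local_homeo x.
have [|||||K [cK oK Kx KO]] := @compact_open_basis G x (O `&` U `&` V).
- exact: etale_hausdorff.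
- exact: etale_locally_compact.
- move=> C cC Cx.
  have sC : src @` C `<=` [set src x].
    rewrite -(td (src x) (src_src x)); apply: connected_component_max.
    + by exists x.
    + by move=> _ [z _ <-]; exact: src_src.
    + apply: connected_continuous_connected => //.
      by apply: continuous_subspaceT; exact: src_continuous.
  have one z : C z -> U z -> z = x.
    by move=> Cz Uz; apply: iU; rewrite ?inE//; apply: sC; exists z.
  suff -> : C = [set x] by [].
  apply/esym; apply: cC; first by exists x.
  - exists U => //; apply/seteqP; split=> [z ->|z [? ?]]; first by split.
    exact: one.
  - exists [set x]; first by apply: compact_closed; [exact: etale_hausdorff|exact: compact_set1].
    by apply/seteqP; split=> [z ->|z []]; first by split.
- by apply: openI => //; exact: openI.
- by [].
exists K; split=> //; first by move=> z /KO[[]].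
by split=> a b; rewrite !inE => /KO[[_ Ua] Va] /KO[[_ Ub] Vb];
  [apply: iV|apply: iU]; rewrite inE.
Qed.

Lemma bisection_sub K L : K `<=` L -> bisection L -> bisection K.
Proof.
by move=> KL [rL sL]; split=> a b; rewrite !inE => /KL Ka /KL Kb;
  [apply: rL|apply: sL]; rewrite inE.
Qed.

(** On an open set where it is injective, an open map has a continuous inverse. *)
Lemma local_section (f : G -> G) L : (forall V, open V -> open (f @` V)) ->
  open L -> set_inj L f ->
  exists g : G -> G, forall l, L l -> g (f l) = l /\ {for f l, continuous g}.
Proof.
move=> fo oL iL.
have /choice[g Hg] u : exists l, (exists2 l', L l' & f l' = u) -> L l /\ f l = u.
  have [[l Ll lu]|n] := pselect (exists2 l', L l' & f l' = u); first by exists l.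
  by exists u.
have gf l : L l -> g (f l) = l.
  move=> Ll; have [|Lg fg] := Hg (f l); first by exists l.
  by apply: iL; rewrite ?inE.
exists g => l Ll; split; first exact: gf.
move=> O /=; rewrite gf// nbhsE => -[V [oV Vl] VO].
have : nbhs (f l) (f @` (V `&` L)).
  by apply: open_nbhs_nbhs; split; [apply: fo; exact: openI|exists l].
by apply: filterS => _ [z [Vz Lz] <-]; apply: VO; rewrite gf.
Qed.

(** The multiplication is continuous only on composable pairs, so the pair must
    stay composable near [t]. *)
Lemma gmul_continuous_at (T : topologicalType) (a b : T -> G) (t : T) :
  {near t, forall s, src (a s) = rng (b s)} ->
  {for t, continuous a} -> {for t, continuous b} ->
  {for t, continuous (fun s => gmul (a s) (b s))}.
Proof.
move=> ab ca cb.
have /subspace_continuousP/(_ (a t, b t)) := @gmul_continuous G.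
have tt : @composable G (a t, b t) by exact: nbhs_singleton ab.
move=> /(_ tt) H; apply: (cvg_comp (G := within (@composable G) (nbhs (a t, b t)))
  (fun s => (a s, b s)) (fun p : G * G => gmul p.1 p.2)) => //.
have ct : (fun s => (a s, b s)) @ nbhs t --> (a t, b t) by exact: cvg_pair.
move=> W /= /ct nW.
by move: ab nW; apply: filterS2 => s e; apply.
Qed.

End etale_topology.

(** * The convolution algebra of compactly supported functions *)

Section complex_continuity.
Context (R : realType) (T : topologicalType).
Implicit Types (f g : T -> R[i]) (x : T).

Definition ccontinuous_at f x := {for x, continuous (f : T -> R[i]^o)}.

Lemma ccontinuousP f x : ccontinuous_at f x <->
  forall e : R, 0 < e -> \forall z \near x, normc (f x - f z) < e.
Proof.
have H (w : R[i]) (e : R) : (`|w| < e%:C) = (normc w < e).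
  by rewrite normc_def ltcE /= eqxx; case: w.
split=> [/cvgrPdist_lt cf e e0|cf].
  have := cf e%:C; rewrite ltcR => /(_ e0).
  by apply: filterS => z; rewrite /= -H.
apply/cvgrPdist_lt => -[e e'] /=; rewrite ltcE/= => /andP[/eqP -> e0].
by apply: filterS (cf e e0) => z; rewrite -H.
Qed.

Lemma ccontinuous_near f g x : {near x, f =1 g} ->
  ccontinuous_at f x -> ccontinuous_at g x.
Proof.
move=> fg /ccontinuousP cf; apply/ccontinuousP => e /cf cfe.
have fgx : f x = g x by exact: nbhs_singleton fg.
by move: fg cfe; apply: filterS2 => z fgz; rewrite fgx fgz.
Qed.

Lemma ccontinuousM f g x : ccontinuous_at f x -> ccontinuous_at g x ->
  ccontinuous_at (fun z => f z * g z) x.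
Proof.
move=> cf cg; rewrite /ccontinuous_at /prop_for.
by apply: (@cvgM (complex_complex__canonical__Num_ClosedField R) T);
  [exact: cf|exact: cg].
Qed.

Lemma ccontinuousD f g x : ccontinuous_at f x -> ccontinuous_at g x ->
  ccontinuous_at (fun z => f z + g z) x.
Proof.
move=> cf cg; rewrite /ccontinuous_at /prop_for.
by apply: (@cvgD (complex_complex__canonical__Num_ClosedField R) R[i]^o T);
  [exact: cf|exact: cg].
Qed.

Lemma ccontinuousV f x : f x != 0 -> ccontinuous_at f x ->
  ccontinuous_at (fun z => (f z)^-1) x.
Proof.
move=> f0 cf; rewrite /ccontinuous_at /prop_for.
by apply: (@cvgV (complex_complex__canonical__Num_ClosedField R) T); [|exact: cf].
Qed.

Lemma ccontinuous_cst (k : R[i]) x : ccontinuous_at (fun=> k) x.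
Proof. by apply/ccontinuousP => e e0; apply: nearW => z; rewrite subrr normc0. Qed.

Lemma ccontinuous_conj f x : ccontinuous_at f x ->
  ccontinuous_at (fun z => conjc (f z)) x.
Proof.
move=> /ccontinuousP cf; apply/ccontinuousP => e /cf; apply: filterS => z.
by rewrite -rmorphB normc_conj.
Qed.

Lemma ccontinuous_comp (S : topologicalType) (h : T -> S) (f : S -> R[i]) x :
  {for x, continuous h} -> {for h x, continuous (f : S -> R[i]^o)} ->
  ccontinuous_at (fun z => f (h z)) x.
Proof. by move=> ch cf; apply: continuous_comp. Qed.

Definition cutoff (A : set T) f : T -> R[i] := fun x => if x \in A then f x else 0.

Lemma cutoff_in (A : set T) f x : A x -> cutoff A f x = f x.
Proof. by move=> Ax; rewrite /cutoff mem_set. Qed.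

Lemma cutoff_out (A : set T) f x : ~ A x -> cutoff A f x = 0.
Proof. by move=> Ax; rewrite /cutoff memNset. Qed.

Lemma cutoff_continuous (A : set T) f : clopen A ->
  (forall x, A x -> ccontinuous_at f x) -> forall x, ccontinuous_at (cutoff A f) x.
Proof.
move=> [oA cA] cf x; have [Ax|nAx] := pselect (A x).
  apply: ccontinuous_near (cf x Ax).
  have : nbhs x A by exact: open_nbhs_nbhs.
  by apply: filterS => z Az; rewrite cutoff_in.
apply: (@ccontinuous_near (fun=> 0)); last exact: ccontinuous_cst.
have : nbhs x (~` A) by apply: open_nbhs_nbhs; split=> //; exact: closed_openC.
by apply: filterS => z Az; rewrite cutoff_out.
Qed.

End complex_continuity.

Section compactly_supported.
Context (R : realType) (G : etaleGroupoidType).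
Implicit Types (f g h : G -> R[i]) (P Q K L : set G).

Lemma supp_subset f Q : closed Q -> (forall x, f x != 0 -> Q x) -> supp f `<=` Q.
Proof. by move=> cQ fQ; rewrite /supp [X in _ `<=` X](closure_id _).1//; exact: closureS. Qed.

Lemma CcI P f : (forall x, ccontinuous_at f x) ->
  (exists Q, [/\ compact Q, Q `<=` P & forall x, f x != 0 -> Q x]) -> Cc P f.
Proof.
move=> cf [Q [cQ QP fQ]].
have sQ : supp f `<=` Q.
  by apply: supp_subset fQ; exact: compact_closed (@etale_hausdorff G) cQ.
split=> //; last exact: subset_trans sQ QP.
by apply: (subclosed_compact _ cQ sQ); exact: closed_closure.
Qed.

Lemma Cc_continuous P f x : Cc P f -> ccontinuous_at f x.
Proof. by case=> cf _ _; exact: cf. Qed.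

Lemma Cc_out P f x : Cc P f -> ~ P x -> f x = 0.
Proof.
move=> [_ _ fP] Px; apply/eqP; apply: contrapT => /negP f0; apply: Px.
by apply: fP; exact: subset_closure.
Qed.

Lemma sub_Cc P Q f : P `<=` Q -> Cc P f -> Cc Q f.
Proof. by move=> PQ [? ? fP]; split=> //; exact: subset_trans fP PQ. Qed.

Lemma CcT P f : Cc P f -> Cc setT f.
Proof. exact: sub_Cc. Qed.

Lemma Cc0 P : Cc P (fun=> 0 : R[i]).
Proof.
apply: CcI; first by move=> x; exact: ccontinuous_cst.
by exists set0; split=> [||x]; [exact: compact0| |rewrite eqxx].
Qed.

Lemma Cc_comb P (k : R[i]) f g : Cc P f -> Cc P g ->
  Cc P (fun x => k * f x + g x).
Proof.
move=> Cf Cg; apply: CcI => [x|].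
  apply: ccontinuousD; last exact: Cc_continuous Cg.
  by apply: (@ccontinuousM _ _ (fun=> k) f); [exact: ccontinuous_cst|exact: Cc_continuous Cf].
case: (Cf) (Cg) => _ kf fP [_ kg gP].
exists (supp f `|` supp g); split; first exact: compactU.
  by move=> x [/fP|/gP].
move=> x; have [->|f0 _] := eqVneq (f x) 0; last by left; exact: subset_closure.
by rewrite mulr0 add0r => g0; right; exact: subset_closure.
Qed.

Lemma CcD P f g : Cc P f -> Cc P g -> Cc P (fun x => f x + g x).
Proof.
by move=> Cf Cg; have := Cc_comb 1 Cf Cg; under eq_fun do rewrite mul1r.
Qed.

Lemma Cc_cutoff P L f : clopen L -> Cc P f -> Cc (P `&` L) (cutoff L f).
Proof.
move=> cL Cf; apply: CcI.
  by apply: cutoff_continuous => // x _; exact: Cc_continuous Cf.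
case: Cf => _ kf fP; exists (supp f `&` L); split.
- by apply: compact_closedI => //; case: cL.
- by move=> x [/fP].
- move=> x; have [Lx|nLx] := pselect (L x); last by rewrite cutoff_out ?eqxx.
  by rewrite cutoff_in// => f0; split=> //; exact: subset_closure.
Qed.

Lemma Cc_copen K f : copen K -> (forall x, K x -> ccontinuous_at f x) ->
  Cc K (cutoff K f).
Proof.
move=> cK cf; apply: CcI.
  by apply: cutoff_continuous => //; exact: clopen_copen.
exists K; split=> //; first by case: cK.
by move=> x; have [//|nKx] := pselect (K x); rewrite cutoff_out ?eqxx.
Qed.

(** The support is covered by finitely many disjoint compact open sets, and [f]
    is the sum of its restrictions to them. *)
Lemma Cc_ind (Phi : (G -> R[i]) -> Prop) f : Cc setT f ->
  Phi (fun=> 0) ->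
  (forall g h, Cc setT g -> Cc setT h -> Phi g -> Phi h ->
     Phi (fun x => g x + h x)) ->
  (forall z, supp f z -> exists N, [/\ copen N, N z &
     forall L, copen L -> L `<=` N -> Phi (cutoff L f)]) ->
  Phi f.
Proof.
move=> Cf P0 PD Hf; have hG := @etale_hausdorff G.
have [||||U [cU fU HU]] := @copen_ind G (fun L => Phi (cutoff L f)) (supp f) hG.
- by case: Cf.
- by rewrite (_ : cutoff set0 f = fun=> 0)//; apply/funext => x; rewrite cutoff_out.
- move=> K L cK cL KL PK PL.
  rewrite (_ : cutoff _ _ = fun x => cutoff K f x + cutoff L f x).
    by apply: PD => //; apply: CcT; apply: Cc_cutoff Cf; exact: clopen_copen.
  apply/funext => x; have [Kx|nKx] := pselect (K x).
    rewrite [in RHS]cutoff_in// [cutoff L f x]cutoff_out ?addr0; last first.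
      by move=> Lx; rewrite -[False]/(set0 x) -KL.
    by rewrite cutoff_in//; left.
  rewrite [cutoff K f x]cutoff_out// add0r /cutoff in_setU [x \in K]memNset//.
- exact: Hf.
rewrite (_ : f = cutoff U f); first by exact: HU.
apply/funext => x; have [Ux|nUx] := pselect (U x); first by rewrite cutoff_in.
rewrite cutoff_out//; apply/eqP; apply: contrapT => /negP f0; apply: nUx.
by apply: fU; exact: subset_closure.
Qed.

Lemma Ind_basis f x y : Cc setT f ->
  Ind f (basis_vec R y) x = if src y == src x then f (gmul x (ginv y)) else 0.
Proof.
move=> Cf; rewrite IndE//; case: eqP => [yx|nyx].
  rewrite -(fsbig_widen [set y]) => [|_ -> //|z [/= _ /eqP zy]].
    by rewrite fsbig_set1 basis_vecE eqxx mulr1.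
  by rewrite basis_vecE (negPf zy) mulr0.
apply: fsbig1 => z /= zx; rewrite basis_vecE; case: eqP => [zy|]; last by rewrite mulr0.
by case: nyx; rewrite -zx zy.
Qed.

Lemma bounded_op_ext (X : choiceType) (a b : l2 R X -> l2 R X) :
  bounded_op a -> bounded_op b ->
  (forall x y, a (basis_vec R y) x = b (basis_vec R y) x) -> a = b.
Proof.
move=> ba bb ab; have [k k0 ak] := bounded_opP ba; have [l l0 bl] := bounded_opP bb.
case: ba bb => la _ [lb _]; apply: (op_ext_basis la lb k0 l0 ak bl) => y.
exact: l2P.
Qed.

Lemma Ind_comb (k : R[i]) f g : Cc setT f -> Cc setT g ->
  Ind (fun x => k * f x + g x) = k *: Ind f + Ind g :> (l2 R G -> l2 R G).
Proof.
move=> Cf Cg; have Ch := Cc_comb k Cf Cg; apply: bounded_op_ext.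
- exact: Ind_bounded.
- by apply: bounded_op_comb; exact: Ind_bounded.
move=> x y; rewrite -[RHS]/(k * Ind f _ x + Ind g _ x) !Ind_basis//.
by case: ifP; rewrite // mulr0 addr0.
Qed.

Lemma IndD f g : Cc setT f -> Cc setT g ->
  Ind (fun x => f x + g x) = Ind f + Ind g :> (l2 R G -> l2 R G).
Proof.
move=> Cf Cg; rewrite -[X in X + _]scale1r -Ind_comb//.
by congr Ind; apply/funext => x; rewrite mul1r.
Qed.

Lemma Ind0 : Ind (fun=> 0 : R[i]) = 0 :> (l2 R G -> l2 R G).
Proof.
apply: bounded_op_ext; [exact: Ind_bounded (Cc0 _)|exact: bounded_op0|].
by move=> x y; rewrite Ind_basis; [case: ifP|exact: Cc0].
Qed.

Lemma jmap_bound (a : l2 R G -> l2 R G) (k : R) x : opbound a k -> normc (jmap a x) <= k.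
Proof.
move=> ak; apply: (le_trans (normc_le_l2norm _ _)).
by apply: (le_trans (ak _)); rewrite l2norm_basis_vec mulr1.
Qed.

(** The convolution [f * g] when [g] lives on a bisection [L]: at [z] its only
    term comes from the point of [L] with the same source as [z]. *)
Lemma convolution_bisection f g L : Cc setT f -> Cc L g -> copen L -> bisection L ->
  exists2 h, Cc setT h & Ind f \o Ind g = Ind h :> (l2 R G -> l2 R G).
Proof.
move=> Cf Cg cL [rL sL]; have oL : open L by case: cL.
(* sg and rh invert the source and the range on L. *)
have [sg Hs] := local_section (@src_open G) oL sL.
have [rh Hr] := local_section (@rng_open G) oL rL.
have sgE l : L l -> sg (src l) = l by move=> /Hs[].
pose S := src @^-1` (src @` L).
have cS : clopen S.
  have [op cl] := clopen_copen (copen_src cL).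
  split; first by move/continuousP: (@src_continuous G); apply.
  by apply: preimage_closed cl => x _; exact: src_continuous.
pose h0 z := f (gmul z (ginv (sg (src z)))) * g (sg (src z)).
have Ssg z : S z -> L (sg (src z)) /\ src (sg (src z)) = src z.
  by move=> [l Ll lz]; rewrite -lz sgE.
have sgc z : S z -> {for z, continuous (fun w => sg (src w))}.
  move=> [l Ll lz]; apply: (@continuous_comp _ _ _ src sg); first exact: src_continuous.
  by rewrite -lz; case: (Hs l Ll).
have nS z : S z -> nbhs z S by move=> Sz; apply: open_nbhs_nbhs; case: cS.
have Ch : Cc setT (cutoff S h0).
  apply: CcI.
    apply: cutoff_continuous => // z Sz; apply: ccontinuousM.
      apply: (@ccontinuous_comp _ _ _ _ f); last exact: Cc_continuous Cf.
      apply: (@gmul_continuous_at G G (fun z => z) (fun z => ginv (sg (src z)))) => //.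
        by apply: filterS (nS z Sz) => w /Ssg[_]; rewrite rng_inv.
      apply: (@continuous_comp _ _ _ (fun w => sg (src w)) ginv); first exact: sgc.
      exact: ginv_continuous.
    apply: (@ccontinuous_comp _ _ _ (fun w => sg (src w)) g); first exact: sgc.
    exact: Cc_continuous Cg.
  (* A product x * l with l in L is determined by x, so the support of the
     convolution is the image of a compact set of x. *)
  pose Q := supp f `&` src @^-1` (rng @` L).
  exists ((fun x => gmul x (rh (src x))) @` Q); split=> //.
    have [op cl] := clopen_copen (copen_rng cL).
    apply: continuous_compact; last first.
      apply: compact_closedI; first by case: Cf.
      by apply: preimage_closed cl => x _; exact: src_continuous.
    apply/continuous_in_subspaceT => z /set_mem[_ /= zL].
    apply: (@gmul_continuous_at G G (fun z => z) (fun z => rh (src z))) => //.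
      have : nbhs z (src @^-1` (rng @` L)).
        apply: open_nbhs_nbhs; split=> //.
        by move/continuousP: (@src_continuous G); apply.
      by apply: filterS => w [l Ll lw]; rewrite -lw; have [-> _] := Hr l Ll.
    apply: (@continuous_comp _ _ _ src rh); first exact: src_continuous.
    by case: zL => l Ll <-; case: (Hr l Ll).
  move=> z; have [Sz|nSz] := pselect (S z); last by rewrite cutoff_out ?eqxx.
  rewrite cutoff_in// /h0 mulf_eq0 negb_or => /andP[f0 g0].
  have [Ll lz] := Ssg z Sz; set l := sg (src z) in f0 g0 Ll lz *.
  have zl : src (gmul z (ginv l)) = rng l by rewrite src_mul ?rng_inv// src_inv.
  exists (gmul z (ginv l)); first by split; [exact: subset_closure|exists l].
  by rewrite zl; have [-> _] := Hr l Ll; rewrite gmulK.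
exists (cutoff S h0) => //; apply: bounded_op_ext.
- by apply: bounded_op_comp; apply: Ind_bounded => //; exact: CcT Cg.
- exact: Ind_bounded.
move=> x w; rewrite Ind_basis//= IndE//.
have gw y : Ind g (basis_vec R w) y =
    if src w == src y then g (gmul y (ginv w)) else 0.
  exact: Ind_basis (CcT Cg).
case: eqP => [wx|nwx]; last first.
  apply: fsbig1 => y /= yx; rewrite gw; case: eqP => [wy|]; last by rewrite mulr0.
  by case: nwx; rewrite wy yx.
have sxw : src (gmul x (ginv w)) = rng w by rewrite src_mul ?rng_inv// src_inv.
have zero y : src y = src x -> ~ L (gmul y (ginv w)) ->
    f (gmul x (ginv y)) * Ind g (basis_vec R w) y = 0.
  by move=> yx nL; rewrite gw yx wx eqxx (Cc_out Cg nL) mulr0.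
have syw y : src y = src x -> src (gmul y (ginv w)) = rng w.
  by move=> yx; rewrite src_mul ?rng_inv ?yx// src_inv.
have [Sx|nSx] := pselect (S (gmul x (ginv w))); last first.
  rewrite cutoff_out//; apply: fsbig1 => y /= yx; apply: zero => // Ly; apply: nSx.
  by exists (gmul y (ginv w)) => //; rewrite sxw syw.
have [Ll lz] := Ssg _ Sx; rewrite cutoff_in// /h0.
set l := sg _ in Ll lz *; rewrite sxw in lz.
rewrite -(fsbig_widen [set gmul l w]) => [|y -> /=|y [/= yx nyl]].
- rewrite fsbig_set1 gw src_mul// eqxx gmulKV// ginvM// gmulA ?rng_inv//.
  by rewrite src_inv.
- by rewrite src_mul.
- apply: zero => // Ly; apply: nyl.
  have <- : gmul y (ginv w) = l by apply: sL; rewrite ?inE// syw.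
  by rewrite gmulK// yx.
Qed.


Lemma Ind_mul f g : totally_disconnected (@units G) -> Cc setT f -> Cc setT g ->
  exists2 h, Cc setT h & Ind f \o Ind g = Ind h :> (l2 R G -> l2 R G).
Proof.
move=> td Cf Cg; have [lf _] := Ind_bounded Cf.
pose Phi g := exists2 h, Cc setT h & Ind f \o Ind g = Ind h :> (l2 R G -> l2 R G).
apply: (@Cc_ind Phi) => //.
- exists (fun=> 0); first exact: Cc0.
  by rewrite Ind0; apply/funext => xi /=; rewrite (linear_fun0 lf).
- move=> g1 g2 C1 C2 [h1 D1 E1] [h2 D2 E2].
  exists (fun x => h1 x + h2 x); first exact: CcD.
  rewrite !IndD// -E1 -E2; apply/funext => xi /=.
  exact: linear_funD lf.
- move=> z _; have [N [cN Nz _ bN]] := etale_copen_basis td (@openT G) (I : setT z).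
  exists N; split=> // L cL LN; apply: (convolution_bisection Cf _ cL).
    by apply: Cc_copen => // x _; exact: Cc_continuous Cg.
  exact: bisection_sub LN bN.
Qed.

Lemma Ind_star f : Cc setT f ->
  exists2 h, Cc setT h & adjoint (Ind f) (@Ind R G h).
Proof.
move=> Cf; pose h x := conjc (f (ginv x)).
have Ch : Cc setT h.
  apply: CcI => [x|].
    apply: ccontinuous_conj; apply: (@ccontinuous_comp _ _ _ ginv f).
      exact: ginv_continuous.
    exact: Cc_continuous Cf.
  exists (ginv @` supp f); split=> //.
    apply: continuous_compact; last by case: Cf.
    by apply: continuous_subspaceT; exact: ginv_continuous.
  move=> x hx; exists (ginv x); last exact: ginvK.
  apply: subset_closure => /=; apply: contra_neq hx => fx.
  by rewrite /h fx conjc0.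
exists h => //; apply: adjoint_basis; [exact: Ind_bounded..|].
move=> x y; rewrite !Ind_basis// eq_sym; case: eqP => [yx|]; last by rewrite conjc0.
by rewrite /h conjcK ginvM ?rng_inv// ginvK.
Qed.

End compactly_supported.

(** * Automatic continuity of *-homomorphisms *)

Section automatic_continuity.
Context (R : realType) (X Y : choiceType).
Implicit Types (a b c p q : l2 R X -> l2 R X).

Lemma half_pow_small (eps : R) : 0 < eps -> exists n, 2 * 2^-1 ^+ n <= eps.
Proof.
move=> eps0; exists (Num.bound (2 / eps)).
have /archi_boundP/ltW : 0 <= 2 / eps by rewrite divr_ge0// ltW.
set n := Num.bound _ => h; rewrite exprVn ler_pdivrMr ?exprn_gt0//.
rewrite mulrC -ler_pdivrMr//; apply: (le_trans h).
by rewrite -natrX ler_nat ltnW// ltn_expl.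
Qed.

Lemma opbound_sqr_diff p q (k l d : R) : linear p -> 0 <= k -> 0 <= d ->
  opbound p k -> opbound q l -> opbound (p - q) d ->
  opbound ((p \o p) - (q \o q)) (k * d + d * l).
Proof.
move=> lp k0 d0 pk ql pqd xi.
have -> : ((p \o p) - (q \o q)) xi = p ((p - q) xi) + (p - q) (q xi).
  rewrite -[LHS]/(p (p xi) - q (q xi)) -[(p - q) xi]/(p xi - q xi).
  rewrite (linear_funB _ _ lp) -[(p - q) (q xi)]/(p (q xi) - q (q xi)).
  by rewrite addrA subrK.
apply: (le_trans (ler_l2normD _ _)); rewrite mulrDl; apply: lerD.
  by apply: (le_trans (pk _)); rewrite -mulrA ler_wpM2l.
by apply: (le_trans (pqd _)); rewrite -mulrA ler_wpM2l.
Qed.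

Context (A : set (l2 R X -> l2 R X)).
Hypothesis A_bounded : forall a, A a -> bounded_op a.
Hypothesis A_subspace : op_subspace A.
Hypothesis A_comp : forall a b, A a -> A b -> A (a \o b).
Hypothesis A_limit : forall a, linear a ->
  (forall eps : R, 0 < eps -> exists2 b, A b & opbound (a - b) eps) -> A a.
Hypothesis A_star : forall a, A a -> exists2 b, A b & adjoint a b.

Let A_linear a : A a -> linear a. Proof. by case/A_bounded. Qed.
Let A_comb (k : R[i]) a b : A a -> A b -> A (k *: a + b).
Proof. by case: A_subspace => _; apply. Qed.
Let A_scale (k : R[i]) a : A a -> A (k *: a).
Proof. by move=> Aa; rewrite -[X in A X]addr0; apply: A_comb => //; case: A_subspace. Qed.

Section square_root.
Context (c : l2 R X -> l2 R X).
Hypothesis Ac : A c.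
Hypothesis cc : adjoint c c.
Hypothesis c4 : opbound c 4^-1.

Let h : R[i] := (2^-1)%:C.
Let normc_h : normc h = 2^-1. Proof. by rewrite normc_real ger0_norm ?invr_ge0. Qed.

Let beta n := iter n (fun b => h *: (b \o b) + h *: c) 0.

Let A_beta n : A (beta n).
Proof.
elim: n => [|n ih]; first by case: A_subspace.
by rewrite /beta iterS -/(beta n); apply: A_comb; [exact: A_comp|exact: A_scale].
Qed.

Let beta_adj n : adjoint (beta n) (beta n).
Proof.
elim: n => [|n ih].
  move=> u v; rewrite -[beta 0 u]/(0 : l2 R X) -[beta 0 v]/(0 : l2 R X).
  by rewrite -(scale0r 0) innerZl innerZr conjc0 !mul0r.
rewrite /beta iterS -/(beta n); apply: adjoint_comb; first exact: adjoint_comp.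
rewrite -[h *: c]addr0; apply: adjoint_comb => //.
move=> u v; rewrite -[X in inner X _]/(0 : l2 R X) -[X in _ = inner _ X]/(0 : l2 R X).
by rewrite -(scale0r 0) innerZl innerZr conjc0 !mul0r.
Qed.

(* 1/2 is preserved: (1/2)^2 / 2 + (1/4) / 2 <= 1/2, and on the ball of radius
   1/2 the map b |-> (c + b^2) / 2 contracts distances by 1/2. *)
Let beta_bound n : opbound (beta n) 2^-1.
Proof.
elim: n => [|n ih].
  by move=> u; rewrite -[beta 0 u]/(0 : l2 R X) l2norm0 mulr_ge0 ?invr_ge0 ?l2norm_ge0.
rewrite /beta iterS -/(beta n).
apply: (@le_opbound _ _ _ _ (normc h * (2^-1 * 2^-1) + normc h * 4^-1)).
  by rewrite normc_h; lra.
by apply: opboundD; apply: opboundZ => //; apply: opbound_comp => //; rewrite invr_ge0.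
Qed.

Let beta_step n : opbound (beta n.+1 - beta n) (2^-1 ^+ n).
Proof.
elim: n => [|n ih].
  rewrite -[beta 0]/(0 : l2 R X -> l2 R X) subr0 expr0.
  by apply: le_opbound (beta_bound 1); lra.
have -> : beta n.+2 - beta n.+1 = h *: ((beta n.+1 \o beta n.+1) - (beta n \o beta n)).
  by rewrite [beta n.+2]iterS -/(beta n.+1) [in X in _ - X]/beta iterS -/(beta n)
    opprD addrACA subrr addr0 scalerBr.
apply: (@le_opbound _ _ _ _ (normc h * (2^-1 * 2^-1 ^+ n + 2^-1 ^+ n * 2^-1))).
  by rewrite normc_h exprS; move: (2^-1 ^+ n) => u; lra.
apply: opboundZ; apply: opbound_sqr_diff => //.
exact: A_linear.
Qed.

Let beta_cauchy n m : (n <= m)%N -> opbound (beta m - beta n) (2 * 2^-1 ^+ n).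
Proof.
move=> /subnK <-; set j := (m - n)%N; move: j => {m} j.
apply: (@le_opbound _ _ _ _ (2 * 2^-1 ^+ n - 2 * 2^-1 ^+ (j + n))).
  by rewrite gerBl mulr_ge0// exprn_ge0 ?invr_ge0.
elim: j => [|j ih].
  move=> xi; rewrite -[X in l2norm X]/(beta n xi - beta n xi) subrr l2norm0.
  by rewrite subrr mul0r.
have -> : beta (j.+1 + n) - beta n = (beta (j + n).+1 - beta (j + n)) + (beta (j + n) - beta n).
  by rewrite addrA subrK addSn.
apply: le_opbound (opboundD (@beta_step _) ih).
by rewrite addSn exprS; lra.
Qed.

(** If [c] is small and self-adjoint then [1 - c = (1 - b)^2] for a self-adjoint
    [b] of the algebra: [b] is the fixed point of the contraction
    [b |-> (c + b^2) / 2]. *)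
Lemma square_root_one_sub : exists b, [/\ A b, adjoint b b &
  c = 1 *: b + ((-1) *: (b \o b) + b)].
Proof.
have [|||||L lL HL] := @op_complete R X X beta (fun n => 2 * 2^-1 ^+ n).
- by move=> n; rewrite mulr_ge0// exprn_ge0 ?invr_ge0.
- move=> n m nm; rewrite ler_wpM2l// ler_wiXn2l ?invr_ge0//.
  by rewrite invf_le1// ler1n.
- by move=> eps; exact: half_pow_small.
- by move=> n; exact: A_linear.
- exact: beta_cauchy.
have AL : A L.
  apply: A_limit => // eps /half_pow_small[n Hn]; exists (beta n) => //.
  exact: le_opbound Hn (HL n).
exists L; split=> //.
  apply: adjoint_limit => eps /half_pow_small[n Hn]; exists (beta n), (beta n).
  by split=> //; exact: le_opbound Hn (HL n).
have LK : opbound L (2 + 2^-1).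
  by have := opbound_limit (HL 0%N) (@beta_bound 0%N); rewrite expr0 mulr1.
suff E : h *: (L \o L) + h *: c = L.
  apply/funext => xi; apply: l2P => x.
  have E' : h * L (L xi) x + h * c xi x = L xi x.
    by rewrite -[LHS]/((h *: (L \o L) + h *: c) xi x) E.
  rewrite -[RHS]/(1 * L xi x + (-1 * L (L xi) x + L xi x)) -E'.
  have h2 : 2 * h = 1 by rewrite /h -[2](rmorph_nat (real_complex R)) -rmorphM mulfV.
  transitivity (2 * h * c xi x + (2 * h - 1) * L (L xi) x); last by ring.
  by rewrite h2 subrr mul0r mul1r addr0.
apply/funext => xi; apply: (@l2_eq_eps _ _ _ _ (3 * l2norm xi)).
  by rewrite mulr_ge0 ?l2norm_ge0.
move=> eps /half_pow_small[n Hn].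
have e0 : 0 <= 2 * 2^-1 ^+ n :> R by rewrite mulr_ge0// exprn_ge0 ?invr_ge0.
have HS : opbound (L - beta n.+1) (2 * 2^-1 ^+ n).
  by apply: le_opbound (HL n.+1); rewrite exprS; lra.
have := opbound_sqr_diff lL _ e0 LK (@beta_bound n) (HL n).
rewrite addr_ge0 ?invr_ge0// => /(_ isT)/(@opboundZ _ _ _ _ _ h) HQ.
have -> : (h *: (L \o L) + h *: c) xi - L xi =
    (h *: ((L \o L) - (beta n \o beta n))) xi - (L - beta n.+1) xi.
  apply: l2P => x.
  rewrite -[LHS]/(h * L (L xi) x + h * c xi x - L xi x).
  rewrite -[RHS]/(h * (L (L xi) x - beta n (beta n xi) x) -
    (L xi x - (h * beta n (beta n xi) x + h * c xi x))).
  ring.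
apply: (le_trans (ler_l2normB _ _)).
apply: (le_trans (lerD (HQ xi) (HS xi))).
rewrite normc_h -mulrDl [leRHS]mulrAC ler_wpM2r ?l2norm_ge0//.
by move: (2^-1 ^+ n) e0 Hn => u; lra.
Qed.

End square_root.

Context (pi : (l2 R X -> l2 R X) -> (l2 R Y -> l2 R Y)).
Hypothesis pi_comb : forall (k : R[i]) a b, A a -> A b ->
  pi (k *: a + b) = k *: pi a + pi b.
Hypothesis pi_comp : forall a b, A a -> A b -> pi (a \o b) = pi a \o pi b.
Hypothesis pi_star : forall a b, A a -> A b -> adjoint a b -> adjoint (pi a) (pi b).

Let pi0 : pi 0 = 0.
Proof.
case: A_subspace => A0 _; have := pi_comb (-1) A0 A0.
by rewrite scaler0 addr0 scaleN1r addNr.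
Qed.

(** Writing [a^* a = 2 b - b^2] and [P = pi b], one gets
    [||pi a eta||^2 = 2 Re <eta, P eta> - ||P eta||^2
    = ||eta||^2 - ||eta - P eta||^2]. *)
Lemma star_hom_half a : A a -> opbound a 2^-1 -> opbound (pi a) 1.
Proof.
move=> Aa a2; have [s As as_] := A_star Aa.
have h0 : 0 <= 2^-1 :> R by rewrite invr_ge0.
have s2 := adjoint_bound as_ a2.
pose c := s \o a.
have Ac : A c by exact: A_comp.
have cc : adjoint c c by apply: adjoint_comp => //; exact: adjointC.
have c4 : opbound c 4^-1.
  by apply: le_opbound (opbound_comp h0 s2 a2); lra.
have [b [Ab bb cE]] := square_root_one_sub Ac cc c4.
have pcE : pi c = 1 *: pi b + ((-1) *: (pi b \o pi b) + pi b).
  have Abb : A (b \o b) by exact: A_comp.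
  have Am : A ((-1) *: (b \o b) + b) by exact: A_comb.
  by rewrite cE pi_comb// pi_comb// pi_comp.
move=> eta; rewrite mul1r -ler_sqr ?nnegrE ?l2norm_ge0//.
set P := pi b in pcE *; have PP : adjoint P P by exact: pi_star.
have E1 : (l2norm (pi a eta) ^+ 2)%:C = inner eta (pi c eta).
  by rewrite -inner_norm (pi_star Aa As as_) /c pi_comp.
have E2 : inner eta (pi c eta) =
    inner eta (P eta) + (- (l2norm (P eta) ^+ 2)%:C + inner eta (P eta)).
  rewrite pcE -[X in inner eta X]/(1 *: P eta + ((-1) *: P (P eta) + P eta)).
  by rewrite scale1r scaleN1r !innerDr innerNr -(PP eta (P eta)) inner_norm.
have := sqr_ge0 (l2norm (eta + - P eta)).
rewrite sqr_l2normD innerNr l2normN.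
move: (congr1 (@complex.Re R) E1); rewrite E2.
by case: (inner eta (P eta)) => u v /=; lra.
Qed.

(** Boundedness of a *-homomorphism between concrete C*-algebras, by scaling
    [a] to norm at most [1/2]. The sharp constant would be [k]. *)
Lemma star_hom_bounded a (k : R) : A a -> 0 < k -> opbound a k ->
  opbound (pi a) (2 * k).
Proof.
move=> Aa k0 ak; pose r : R := (2 * k)^-1.
have r0 : 0 < r by rewrite invr_gt0 mulr_gt0.
have /star_hom_half : A (r%:C *: a) by exact: A_scale.
have nr : normc r%:C = r by rewrite normc_real gtr0_norm.
have rk : r * (2 * k) = 1 by rewrite mulVf// mulf_neq0// gt_eqF.
have ra : opbound (r%:C *: a) 2^-1.
  by apply: le_opbound (opboundZ r%:C ak); rewrite nr; nra.
move=> /(_ ra); rewrite -[r%:C *: a]addr0 pi_comb//; last by case: A_subspace.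
rewrite pi0 addr0 => H eta; have := H eta.
rewrite -[X in l2norm X]/(r%:C *: pi a eta) l2normZ nr mul1r => H'.
by rewrite -(ler_pM2l r0) mulrA rk mul1r.
Qed.

End automatic_continuity.

(** * The reduced C*-algebra and the coaction *)

Section reduced_Cstar.
Context (R : realType) (G : etaleGroupoidType).
Hypothesis td : totally_disconnected (@units G).
Implicit Types a b : l2 R G -> l2 R G.

Let A := @Cstar_red R G.

Lemma Cstar_linear a : A a -> linear a.
Proof. by case=> -[]. Qed.

Lemma Cstar_approx a (eps : R) : A a -> 0 < eps ->
  exists2 f, Cc setT f & opbound (a - Ind f) eps.
Proof.
move=> Aa eps0.
have [_ [f Cf <-] H] : exists2 b, [set Ind f | f in Cc setT] b & opbound (a - b) eps.
  by apply: op_closure_approx => // _ [f Cf <-]; case: (Ind_bounded Cf).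
by exists f.
Qed.

Lemma Cstar_limit a : linear a ->
  (forall eps : R, 0 < eps -> exists2 b, A b & opbound (a - b) eps) -> A a.
Proof.
move=> la Ha; apply: op_closureI.
  split=> //; have [b [/bounded_opP[k _ bk] _] ab] := Ha 1 ltr01.
  by exists (1 + k); exact: opbound_limit ab bk.
move=> eps eps0; have e2 : 0 < eps / 2 by rewrite divr_gt0.
have [b Ab ab] := Ha _ e2; have [f Cf bf] := Cstar_approx Ab e2.
exists (Ind f); first by exists f.
have -> : a - Ind f = (a - b) + (b - Ind f) by rewrite addrA subrK.
by apply: le_opbound (opboundD ab bf); lra.
Qed.

Lemma Cstar_subspace : op_subspace A.
Proof.
split; first by rewrite -Ind0; apply: Ind_Cstar_red; exact: Cc0.
move=> k a b Aa Ab; apply: Cstar_limit.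
  by apply: linear_comb; exact: Cstar_linear.
move=> eps eps0; have n0 : 0 <= normc k by exact: normc_ge0.
have e1 : 0 < eps / 2 / (normc k + 1) by rewrite !divr_gt0//; lra.
have [f Cf af] := Cstar_approx Aa e1.
have [g Cg bg] := Cstar_approx Ab (divr_gt0 eps0 (ltr0Sn R 1)).
exists (Ind (fun x => k * f x + g x)); first by apply: Ind_Cstar_red; exact: Cc_comb.
rewrite Ind_comb// opprD addrACA -scalerBr.
apply: le_opbound (opboundD (opboundZ k af) bg).
suff : normc k * (eps / 2 / (normc k + 1)) <= eps / 2 by lra.
rewrite mulrCA ger_pMr ?divr_gt0// ler_pdivrMr; lra.
Qed.

(** [a b - f g = a (b - g) + (a - f) g]. *)
Lemma Cstar_comp a b : A a -> A b -> A (a \o b).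
Proof.
move=> Aa Ab; apply: Cstar_limit.
  by apply: linear_compo; exact: Cstar_linear.
have [k k0 ak] : exists2 k, 0 <= k & opbound a k by apply: bounded_opP; case: Aa.
have [l l0 bl] : exists2 k, 0 <= k & opbound b k by apply: bounded_opP; case: Ab.
move=> eps eps0.
pose d := Num.min 1 (eps / (k + l + 1)).
have s0 : 0 < k + l + 1 by rewrite ltr_wpDl// addr_ge0.
have d0 : 0 < d by rewrite lt_min ltr01 divr_gt0.
have d1 : d <= 1 by rewrite ge_min lexx.
have ds : d * (k + l + 1) <= eps by rewrite -ler_pdivlMr// ge_min lexx orbT.
have [f Cf af] := Cstar_approx Aa d0; have [g Cg bg] := Cstar_approx Ab d0.
have [h Ch fg] := Ind_mul td Cf Cg.
exists (Ind h); first exact: Ind_Cstar_red.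
have gl : opbound (@Ind R G g) (d + l).
  apply: (opbound_limit (L := Ind g) (T := b)) => //.
  by rewrite -opprB; exact: opboundN.
apply: (@le_opbound _ _ _ _ (k * d + d * (d + l))); first nra.
have -> : a \o b - Ind h = (a \o (b - Ind g)) + ((a - Ind f) \o Ind g).
  rewrite -fg; apply/funext => xi.
  rewrite -[LHS]/(a (b xi) - Ind f (Ind g xi)).
  rewrite -[RHS]/(a (b xi - Ind g xi) + (a (Ind g xi) - Ind f (Ind g xi))).
  by rewrite (linear_funB _ _ (Cstar_linear Aa)) addrA subrK.
by apply: opboundD; apply: opbound_comp => //; exact: ltW.
Qed.

(** Taking adjoints preserves bounds, so the adjoints of a sequence of [Ind f]
    converging to [a] form a Cauchy sequence. *)
Lemma Cstar_star a : A a -> exists2 b, A b & adjoint a b.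
Proof.
move=> Aa.
have e0 n : 0 < 2^-1 ^+ n :> R by rewrite exprn_gt0// invr_gt0.
have /choice[f Hf] n : exists f, Cc setT f /\ opbound (a - Ind f) (2^-1 ^+ n).
  by have [f] := Cstar_approx Aa (e0 n); exists f.
have /choice[h Hh] n : exists h, Cc setT h /\ adjoint (Ind (f n)) (@Ind R G h).
  by case: (Hf n) => /Ind_star[h]; exists h.
have lin n : linear (@Ind R G (h n)) by case: (Hh n) => /Ind_bounded[].
have decr n m : (n <= m)%N -> 2^-1 ^+ m <= 2^-1 ^+ n :> R.
  by move=> nm; rewrite ler_wiXn2l ?invr_ge0// invf_le1// ler1n.
have [|||||b lb Hb] := @op_complete R G G (fun n => Ind (h n)) (fun n => 2 * 2^-1 ^+ n).
- by move=> n; rewrite mulr_ge0// ltW.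
- by move=> n m nm; rewrite ler_wpM2l// decr.
- by move=> eps; exact: half_pow_small.
- exact: lin.
- move=> n m nm.
  have fnm : opbound (@Ind R G (f m) - Ind (f n)) (2 * 2^-1 ^+ n).
    have -> : Ind (f m) - Ind (f n) = (a - Ind (f n)) - (a - Ind (f m)).
      by rewrite opprB [RHS]addrC addrA subrK.
    apply: le_opbound (opboundD (Hf n).2 (opboundN (Hf m).2)).
    by have := decr _ _ nm; lra.
  apply: (adjoint_bound _ fnm).
  have := adjoint_comb (-1) (Hh n).2 (Hh m).2.
  by rewrite rmorphN1 !scaleN1r ![- _ + _]addrC.
exists b.
  apply: Cstar_limit => // eps /half_pow_small[n Hn]; exists (Ind (h n)).
    by apply: Ind_Cstar_red; case: (Hh n).
  exact: le_opbound Hn (Hb n).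
apply: adjoint_limit => eps /half_pow_small[n Hn]; exists (Ind (f n)), (Ind (h n)).
split; [by case: (Hh n)| |exact: le_opbound Hn (Hb n)].
apply: le_opbound (Hf n).2; have := e0 n; lra.
Qed.

End reduced_Cstar.

Section slices.
Context (R : realType) (X : choiceType) (Gamma : groupType).
Implicit Types (xi : l2 R X) (t : Gamma)
  (T S : l2 R (X * Gamma)%type -> l2 R (X * Gamma)%type).

Let tens xi : l2 R (X * Gamma)%type := tensor_vec xi (basis_vec R (1%g : Gamma)).

Let tensE xi p : tens xi p = if p.2 == 1%g then xi p.1 else 0.
Proof. by rewrite /tens tensor_vecE basis_vecE; case: eqP; rewrite ?mulr1 ?mulr0. Qed.

Let tens_linear : linear tens.
Proof.
move=> k u v; apply: l2P => p; rewrite l2DE l2ZE !tensE l2DE l2ZE.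
by case: ifP; rewrite // mulr0 addr0.
Qed.

Let tens_norm xi : l2norm (tens xi) <= l2norm xi.
Proof.
apply: l2norm_le; first exact: l2norm_ge0.
apply: sqsum_le => s us; pose s1 := [seq p.1 | p <- s & p.2 == 1%g].
apply: (@le_trans _ _ (\sum_(x <- s1) normc (xi x) ^+ 2)).
  rewrite big_map big_filter [leRHS]big_mkcond/=; apply: ler_sum => p _.
  by rewrite tensE; case: ifP; rewrite // normc0 expr0n.
apply: sum_le_l2norm; rewrite map_inj_in_uniq ?filter_uniq// => p q.
rewrite !mem_filter => /andP[/eqP p1 _] /andP[/eqP q1 _].
by case: p p1 => x y /= ->; case: q q1 => z w /= -> ->.
Qed.

(** The slice map [id (x) phi_t], where [phi_t] reads off the coefficient at
    [t] of an operator on [l^2(Gamma)]. *)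
Definition slice t T xi : l2 R X :=
  mkl2 (fun x => T (tensor_vec xi (basis_vec R (1%g : Gamma))) (x, t)).

Lemma sliceE t T xi x :
  slice t T xi x = T (tensor_vec xi (basis_vec R (1%g : Gamma))) (x, t).
Proof.
rewrite /slice mkl2E//; apply: le_lt_trans (sqsum_l2 (T (tens xi))).
by apply: (@sqsum_le_inj _ _ _ setT (fun x => (x, t))) => u v _ _ [].
Qed.

Lemma slice_bound t T (k : R) : 0 <= k -> opbound T k -> opbound (slice t T) k.
Proof.
move=> k0 Tk xi; apply: (@le_trans _ _ (l2norm (T (tens xi)))).
  apply: l2norm_le; first exact: l2norm_ge0.
  rewrite sqr_l2norm; apply: le_trans (@sqsum_le_inj _ _ _ setT (fun x => (x, t)) _ _).
    by apply: le_esum => x _; rewrite sliceE.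
  by move=> u v _ _ [].
by apply: (le_trans (Tk _)); rewrite ler_wpM2l.
Qed.

Lemma slice_linear t T : linear T -> linear (slice t T).
Proof.
move=> lT k u v; apply: l2P => x; rewrite l2DE l2ZE !sliceE.
by rewrite -/(tens _) -/(tens u) -/(tens v) tens_linear lT.
Qed.

Lemma slice_bounded t T : bounded_op T -> bounded_op (slice t T).
Proof.
move=> bT; have [k k0 Tk] := bounded_opP bT; case: bT => lT _.
by split; [exact: slice_linear|exists k; exact: slice_bound].
Qed.

Lemma slice_comb t (k : R[i]) T S : slice t (k *: T + S) = k *: slice t T + slice t S.
Proof.
apply/funext => xi; apply: l2P => x.
by rewrite -[RHS]/(k * slice t T xi x + slice t S xi x) !sliceE.
Qed.

Lemma slice0 t : slice t 0 = 0.
Proof. by apply/funext => xi; apply: l2P => x; rewrite sliceE. Qed.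

Lemma sliceB t T S : slice t (T - S) = slice t T - slice t S.
Proof. by rewrite addrC -scaleN1r slice_comb scaleN1r addrC. Qed.

Lemma slice_tensor t (a : l2 R X -> l2 R X) (b : l2 R Gamma -> l2 R Gamma) T :
  is_tensor a b T -> slice t T = b (basis_vec R 1%g) t *: a.
Proof.
move=> [_ Tab]; apply/funext => xi; apply: l2P => x.
rewrite sliceE Tab tensor_vecE -[RHS]/(b (basis_vec R 1%g) t * a xi x).
by rewrite mulrC.
Qed.

Lemma op_span_sub (Y : choiceType) (S S' : set (l2 R Y -> l2 R Y)) : op_subspace S' ->
  S `<=` S' -> op_span S `<=` S'.
Proof. by move=> sS' SS' T; apply; split. Qed.

Lemma sub_op_span (Y : choiceType) (S : set (l2 R Y -> l2 R Y)) : S `<=` op_span S.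
Proof. by move=> T ST S' [_]; apply. Qed.

Lemma op_span_subspace (Y : choiceType) (S : set (l2 R Y -> l2 R Y)) : op_subspace (op_span S).
Proof.
split; first by move=> S' [[]].
by move=> k a b Sa Sb S' /[dup] [[[_ lS'] _]] hS'; apply: lS'; [exact: Sa|exact: Sb].
Qed.

(** The slice of an elementary tensor [a (x) b] is a multiple of [a], and slices
    are contractive. *)
Lemma slice_min_tensor t (M : set (l2 R X -> l2 R X)) (N : set (l2 R Gamma -> l2 R Gamma)) T :
  (forall a, M a -> bounded_op a) -> op_subspace M -> op_closure M `<=` M ->
  min_tensor M N T -> M (slice t T).
Proof.
move=> Mb Ms Mc TMN; have bT : bounded_op T by case: TMN.
pose S := [set T | linear T /\ M (slice t T)].
have sS : op_subspace S.
  case: Ms => M0 Ml; split.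
    split; first by case: (@bounded_op0 R (X * Gamma)%type).
    by rewrite slice0.
  move=> k a b [la Ma] [lb Mb']; split; first exact: linear_comb.
  by rewrite slice_comb; exact: Ml.
have spanS T' : op_span [set T | exists a b, [/\ M a, N b & is_tensor a b T]] T' -> S T'.
  apply: op_span_sub => // T1 [a [b [Ma Nb Tab]]].
  split; first by case: Tab => -[].
  rewrite (slice_tensor _ Tab) -[_ *: _]addr0.
  by case: Ms => M0; apply.
apply: Mc; apply: op_closureI; first exact: slice_bounded.
move=> eps eps0; have [|T' ST' TT'] := op_closure_approx _ TMN eps0.
  by move=> T' /spanS[].
by exists (slice t T'); [case: (spanS _ ST')|rewrite -sliceB; apply: slice_bound; rewrite ?ltW].
Qed.

End slices.

Section coaction_theory.
Context (R : realType) (G : etaleGroupoidType) (Gamma : groupType).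
Hypothesis td : totally_disconnected (@units G).
Context (c : G -> Gamma)
  (delta : (l2 R G -> l2 R G) -> (l2 R (G * Gamma)%type -> l2 R (G * Gamma)%type)).
Hypothesis cc : continuous_cocycle c.
Hypothesis dc : is_coaction c delta.

Let A := @Cstar_red R G.

Lemma grading_clopen t : clopen (c @^-1` [set t]).
Proof.
have [cont _] := cc; split.
  apply: (@open_comp G (discrete_topology Gamma) c [set t]) => [x _|]; first exact: cont.
  exact: discrete_open.
apply: (@preimage_closed G (discrete_topology Gamma) c [set t]) => [x _|]; first exact: cont.
exact: discrete_closed.
Qed.

Lemma coaction_bounded_op a : A a -> bounded_op (delta a).
Proof. by move=> Aa; have [] := coaction_in dc Aa. Qed.

Lemma coaction_contraction a (k : R) : A a -> 0 < k -> opbound a k ->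
  opbound (delta a) (2 * k).
Proof.
have A_bounded b : A b -> bounded_op b by case.
exact: (@star_hom_bounded R G (G * Gamma)%type A A_bounded (@Cstar_subspace R G)
  (Cstar_comp td) (@Cstar_limit R G) (Cstar_star (G := G)) delta
  (coaction_linear dc) (coaction_mul dc) (coaction_star dc)).
Qed.

Lemma coactionB a b : A a -> A b -> delta (a - b) = delta a - delta b.
Proof.
move=> Aa Ab; have -> : a - b = -1 *: b + a by rewrite scaleN1r addrC.
by rewrite (coaction_linear dc (-1) Ab Aa) scaleN1r addrC.
Qed.

Lemma coactionD a b : A a -> A b -> delta (a + b) = delta a + delta b.
Proof.
move=> Aa Ab; have -> : a + b = 1 *: a + b by rewrite scale1r.
by rewrite (coaction_linear dc 1 Aa Ab) scale1r.
Qed.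

Lemma coaction0 : delta 0 = 0.
Proof.
have [A0 _] := @Cstar_subspace R G.
have {1}-> : (0 : l2 R G -> l2 R G) = 0 - 0 by rewrite subrr.
by rewrite (coactionB A0 A0) subrr.
Qed.

(** A function with compact support is a finite sum of functions each living
    on a compact open set where the cocycle is constant. *)
Lemma graded_ind (Phi : (G -> R[i]) -> Prop) (f : G -> R[i]) : Cc setT f -> Phi (fun=> 0) ->
  (forall g h, Cc setT g -> Cc setT h -> Phi g -> Phi h ->
     Phi (fun x => g x + h x)) ->
  (forall t (L : set G), copen L -> L `<=` c @^-1` [set t] -> Phi (cutoff L f)) ->
  Phi f.
Proof.
move=> Cf P0 PD PL; apply: Cc_ind => // z _.
have [oz _] := grading_clopen (c z).
have [N [cN Nz Nc _]] := etale_copen_basis td oz (erefl (c z)).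
by exists N; split=> // L cL LN; apply: (PL (c z)) => // x /LN/Nc.
Qed.

(** Slicing the coaction at [t] extracts the homogeneous component of degree
    [t], since [lambda_s] maps the basis vector at the identity to that at
    [s]. *)
Lemma slice_coaction_Ind t (f : G -> R[i]) : Cc setT f ->
  slice t (delta (Ind f)) = Ind (cutoff (c @^-1` [set t]) f).
Proof.
move=> Cf; pose Phi (f : G -> R[i]) :=
  slice t (delta (Ind f)) = Ind (cutoff (c @^-1` [set t]) f).
have cutoffC g : Cc setT g -> Cc setT (cutoff (c @^-1` [set t]) g).
  by move=> Cg; apply: CcT; exact: Cc_cutoff (grading_clopen t) Cg.
apply: (@graded_ind Phi) => //.
- rewrite /Phi (_ : cutoff _ _ = fun=> 0); last by apply/funext => x; rewrite /cutoff; case: ifP.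
  by rewrite Ind0 coaction0 slice0.
- move=> g h Cg Ch; rewrite /Phi => Eg Eh.
  rewrite (IndD Cg Ch) (coactionD (Ind_Cstar_red Cg) (Ind_Cstar_red Ch)).
  rewrite -[delta (Ind g)]scale1r slice_comb scale1r Eg Eh -IndD; [|exact: cutoffC..].
  by congr Ind; apply/funext => x; rewrite /cutoff; case: ifP; rewrite // addr0.
- move=> s L cL Ls; have CL : Cc (c @^-1` [set s]) (cutoff L f).
    apply: (sub_Cc Ls); apply: Cc_copen => // x _; exact: Cc_continuous Cf.
  rewrite /Phi (slice_tensor t (coaction_Cc dc CL)) left_regE basis_vecE.
  case: eqP => [st|st].
    rewrite scale1r; congr Ind; apply/funext => x.
    have [cx|cx] := pselect (c x = t); first by rewrite [RHS]cutoff_in.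
    rewrite [RHS]cutoff_out// cutoff_out// => /Ls/= xs; apply: cx; rewrite xs.
    by apply: (mulgI s^-1%g); rewrite st mulVg.
  rewrite scale0r -Ind0; congr Ind; apply/funext => x.
  have [cx|cx] := pselect (c x = t); last by rewrite cutoff_out.
  rewrite cutoff_in// cutoff_out// => /Ls/= xs; apply: st.
  by rewrite -xs cx mulVg.
Qed.

(** One function approximates [a] and, through its component of degree [t], the
    slice of [delta a] as well, because [delta] is bounded. *)
Lemma coaction_approx a t (eps : R) : A a -> 0 < eps ->
  exists f, [/\ Cc setT f, opbound (a - Ind f) eps &
    opbound (slice t (delta a) - Ind (cutoff (c @^-1` [set t]) f)) (2 * eps)].
Proof.
move=> Aa eps0; have [f Cf af] := Cstar_approx Aa eps0; exists f; split=> //.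
have Af : A (Ind f) by exact: Ind_Cstar_red.
have Aaf : A (a - Ind f).
  have -> : a - Ind f = -1 *: Ind f + a by rewrite scaleN1r addrC.
  by case: (@Cstar_subspace R G) => _ AD; exact: (AD (-1) _ _ Af Aa).
rewrite -(slice_coaction_Ind t Cf) -sliceB -(coactionB Aa Af); apply: slice_bound.
  by rewrite mulr_ge0// ltW.
exact: coaction_contraction.
Qed.

End coaction_theory.

(** * Compressing operators to bisections *)

Section diagonal_compressions.
Context (R : realType) (G : etaleGroupoidType).
Implicit Types (f h b : G -> R[i]) (a y : l2 R G -> l2 R G) (K L V : set G).

Lemma jmapB a y x : jmap (a - y) x = jmap a x - jmap y x.
Proof. by []. Qed.

(** [jmap a] is a uniform limit of continuous functions. *)
Lemma jmap_continuous a x : Cstar_red a -> ccontinuous_at (jmap a) x.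
Proof.
move=> Aa; apply/ccontinuousP => e e0.
have e3 : 0 < e / 3 by rewrite divr_gt0.
have [f Cf af] := Cstar_approx Aa e3.
have close z : normc (jmap a z - f z) <= e / 3.
  by have := jmap_bound z af; rewrite jmapB jmap_Ind.
have /ccontinuousP/(_ _ e3) : ccontinuous_at f x by exact: Cc_continuous Cf.
apply: filterS => z fz.
have -> : jmap a x - jmap a z = (jmap a x - f x) + ((f x - f z) - (jmap a z - f z)).
  by ring.
apply: (le_lt_trans (normc_add _ _)).
apply: (@le_lt_trans _ _ (e / 3 + (normc (f x - f z) + e / 3))); last by lra.
apply: lerD; first exact: close.
by apply: (le_trans (normc_add _ _)); rewrite normcN lerD2l.
Qed.

Lemma Ind_units b xi x : Cc (@units G) b -> Ind b xi x = b (rng x) * xi x.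
Proof.
move=> Cb; rewrite IndE; last exact: CcT Cb.
rewrite -(fsbig_widen [set x]) => [|_ ->//|y [/= yx nxy]].
  by rewrite fsbig_set1 gmulxV.
rewrite (Cc_out Cb) ?mul0r// => u; apply: nxy => /=.
have E : gmul x (ginv y) = rng y.
  by rewrite -[LHS]u src_mul ?rng_inv// src_inv.
by rewrite -(gmulK (esym yx)) E gmul_rng.
Qed.

Lemma C0_Cc_units b : Cc (@units G) b -> C0_units b.
Proof.
move=> Cb; split.
- by apply: continuous_subspaceT => x; exact: Cc_continuous Cb.
- by move=> x; exact: Cc_out Cb.
move=> e e0; case: (Cb) => _ kb bu.
pose Q := [set x | e <= normc (b x)].
have cQ : closed Q.
  rewrite -[Q]setCK; apply: open_closedC; rewrite openE => z /= /negP.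
  rewrite -ltNge => bz; rewrite /interior.
  have d0 : 0 < e - normc (b z) by rewrite subr_gt0.
  have /ccontinuousP/(_ _ d0) : ccontinuous_at b z by exact: Cc_continuous Cb.
  apply: filterS => w bw; apply/negP; rewrite -ltNge.
  have -> : b w = b z - (b z - b w) by ring.
  by apply: (le_lt_trans (normc_add _ _)); rewrite normcN -ltrBrDl.
apply: (subclosed_compact _ kb); last first.
  move=> x [_ ex]; apply: subset_closure => /=; apply/eqP => b0.
  by move: ex; rewrite b0 normc0 leNgt e0.
rewrite (_ : [set x | _] = supp b `&` Q).
  by apply: closedI => //; exact: closed_closure.
apply/seteqP; split=> x [h ex]; split=> //; last exact: bu.
apply: subset_closure => /=; apply/eqP => b0.
by move: ex; rewrite b0 normc0 leNgt e0.
Qed.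

Definition unit_indic V : G -> R[i] := cutoff V (fun=> 1).

Lemma Cc_indic V : copen V -> V `<=` @units G -> Cc (@units G) (unit_indic V).
Proof.
move=> cV Vu; apply: (sub_Cc Vu); apply: Cc_copen => // x _.
exact: ccontinuous_cst.
Qed.

Lemma Ind_indic V xi : copen V -> V `<=` @units G ->
  Ind (unit_indic V) xi = restrict_to (rng @^-1` V) xi.
Proof.
move=> cV Vu; apply: l2P => x; rewrite Ind_units; last exact: Cc_indic.
rewrite projE /unit_indic; have [Vx|nVx] := pselect (V (rng x)).
  by rewrite cutoff_in// mul1r mem_set.
by rewrite cutoff_out// mul0r memNset.
Qed.

Lemma rng_units K : rng @` K `<=` @units G.
Proof. by move=> _ [z _ <-]; exact: src_rng. Qed.

Lemma src_units K : src @` K `<=` @units G.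
Proof. by move=> _ [z _ <-]; exact: src_src. Qed.

Lemma proj_basis V x : restrict_to V (basis_vec R x) =
  (if x \in V then basis_vec R x else 0) :> l2 R G.
Proof.
apply: l2P => z; rewrite projE basis_vecE; case: (eqVneq z x) => [->|zx].
  by case: ifP => // _; rewrite basis_vecE eqxx.
by case: ifP; case: ifP => //; rewrite ?basis_vecE ?(negPf zx).
Qed.

(** On a bisection the reduced norm is the uniform norm, since [Ind f] is a
    weighted partial permutation of the canonical basis. *)
Lemma Ind_bisection_bound f K (r : R) : Cc K f -> bisection K -> 0 <= r ->
  (forall z, normc (f z) <= r) -> opbound (@Ind R G f) r.
Proof.
move=> Cf [rK sK] r0 fr xi; have CfT := CcT Cf.
pose E := [set x : G | exists y : G, src y = src x /\ K (gmul x (ginv y))].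
have /choice[g Hg] x : exists y : G, E x -> src y = src x /\ K (gmul x (ginv y)).
  by have [[y Ey]|nE] := pselect (E x); [exists y|exists x].
have IndEE x : normc (Ind f xi x) <= if x \in E then r * normc (xi (g x)) else 0.
  rewrite IndE//; have [Ex|nEx] := pselect (E x); last first.
    rewrite memNset// fsbig1 ?normc0// => y /= yx.
    by rewrite (Cc_out Cf) ?mul0r// => Ky; apply: nEx; exists y.
  have [gx Kg] := Hg x Ex; rewrite mem_set//.
  rewrite -(fsbig_widen [set g x]) => [|_ ->//|y [/= yx nyg]].
    by rewrite fsbig_set1 normcM ler_wpM2r ?normc_ge0.
  rewrite (Cc_out Cf) ?mul0r// => Ky; apply: nyg => /=.
  have EE : gmul x (ginv y) = gmul x (ginv (g x)).
    by apply: rK; rewrite ?inE// !rng_mul ?rng_inv.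
  by rewrite -(gmulVK (esym yx)) EE gmulVK.
have grE x x' : E x -> E x' -> g x = g x' -> x = x'.
  move=> /Hg[gx Kx] /Hg[gx' Kx'] gg; rewrite -gg in gx' Kx'.
  have EE : gmul x (ginv (g x)) = gmul x' (ginv (g x)).
    by apply: sK; rewrite ?inE// !src_mul ?rng_inv.
  by rewrite -(gmulK (esym gx)) EE gmulK.
apply: l2norm_le; first by rewrite mulr_ge0 ?l2norm_ge0.
apply: sqsum_le => s us.
pose s1 := [seq g x | x <- s & x \in E].
apply: (@le_trans _ _ (r ^+ 2 * \sum_(y <- s1) normc (xi y) ^+ 2)).
  rewrite big_map big_filter mulr_sumr [leRHS]big_mkcond/=; apply: ler_sum => x _.
  apply: (@le_trans _ _ ((if x \in E then r * normc (xi (g x)) else 0) ^+ 2)).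
    rewrite ler_sqr ?nnegrE ?normc_ge0//.
    by case: ifP => // _; rewrite mulr_ge0 ?normc_ge0.
  by case: ifP; rewrite ?exprMn// expr0n.
rewrite exprMn ler_wpM2l ?sqr_ge0//; apply: sum_le_l2norm.
rewrite map_inj_in_uniq ?filter_uniq// => x x'.
by rewrite !mem_filter => /andP[/set_mem Ex _] /andP[/set_mem Ex' _]; exact: grE.
Qed.

End diagonal_compressions.

Section local_spectral_synthesis.
Context (R : realType) (G : etaleGroupoidType).
Hypothesis td : totally_disconnected (@units G).
Context (M : set (l2 R G -> l2 R G)).
Hypothesis DM : diagonal_bimodule M.
Implicit Types (f h b : G -> R[i]) (a y : l2 R G -> l2 R G) (K L V : set G).

Lemma bimodule_bounded a : M a -> bounded_op a.
Proof. by case: DM => MA _ _ _ /MA[]. Qed.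

Lemma bimodule_comb (k : R[i]) a y : M a -> M y -> M (k *: a + y).
Proof. by case: DM => _ [_ ML] _ _; exact: ML. Qed.

(** If inside [C] only points of [K] have the ends of [z], then the same is true
    of mixed pairs of ends taken from points close to [z], because [C `\` K] is
    compact. *)
Lemma separating_neighbourhood K C z : copen K -> K z -> compact C ->
  (forall w, C w -> rng w = rng z -> src w = src z -> K w) ->
  exists N, [/\ copen N, N z, N `<=` K & forall z1 z2 w, N z1 -> N z2 -> C w ->
    rng w = rng z1 -> src w = src z2 -> K w].
Proof.
move=> cK Kz cC hC; have [oK clK] := clopen_copen cK.
have cCK : compact (C `\` K).
  by rewrite setDE; apply: compact_closedI => //; exact: open_closedC.
pose P (p : G * G) w := ~ (rng w = rng p.1 /\ src w = src p.2).
have /compact_near_coveringP/(_ _ (nbhs (z, z)) P _) := cCK.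
have sep (f : G -> G) w : continuous f -> f w != f z ->
    exists A B, [/\ nbhs w A, nbhs z B & forall u v, A u -> B v -> f u <> f v].
  move=> cf; have := @etale_hausdorff G; rewrite open_hausdorff => hG /hG.
  move=> [[A B] /= [/set_mem Aw /set_mem Bz] [oA oB /eqP AB]].
  exists (f @^-1` A), (f @^-1` B); split.
  - by apply: cf; exact: open_nbhs_nbhs.
  - by apply: cf; exact: open_nbhs_nbhs.
  - move=> u v /= Au Bv uv; rewrite -[False]/(set0 (f u)) -AB; split=> //.
    by rewrite uv.
case=> [w [Cw nKw]|].
  have [rw|rw] := eqVneq (rng w) (rng z); last first.
    have [A [B [nA nB AB]]] := sep rng w (@rng_continuous G) rw.
    exists (A, [set p | B p.1]).
      split=> //=; rewrite /nbhs/=; exists (B, setT); first by split=> //; exact: filterT.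
      by move=> p [].
    by move=> [u p] [/= Au Bp] [rup _]; exact: AB Au Bp rup.
  have [sw|sw] := eqVneq (src w) (src z); first by case: nKw; exact: hC.
  have [A [B [nA nB AB]]] := sep src w (@src_continuous G) sw.
  exists (A, [set p | B p.2]).
    split=> //=; rewrite /nbhs/=; exists (setT, B); first by split=> //; exact: filterT.
    by move=> p [].
  by move=> [u p] [/= Au Bp] [_ rup]; exact: AB Au Bp rup.
move=> [A B] /= [nA nB] AB.
have : nbhs z (A `&` B `&` K).
  by apply: filterI; [exact: filterI|exact: open_nbhs_nbhs].
rewrite nbhsE => -[W [oW Wz] WAB].
have [N [cN Nz NW _]] := etale_copen_basis td oW Wz.
exists N; split=> //; first by move=> w /NW/WAB[].
move=> z1 z2 w /NW/WAB[[Az1 _] _] /NW/WAB[[_ Bz2] _] Cw r1 s2.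
apply: contrapT => nKw; apply: (AB (z1, z2) (conj Az1 Bz2) w) => //.
Qed.

Lemma compression_Ind f L : Cc setT f -> copen L ->
  (forall w, f w != 0 -> (rng @` L) (rng w) -> (src @` L) (src w) -> L w) ->
  Ind (cutoff L f) = Ind (unit_indic R (rng @` L)) \o Ind f \o Ind (unit_indic R (src @` L)).
Proof.
move=> Cf cL hL; have cr := copen_rng cL; have cs := copen_src cL.
have Cr := Cc_indic R cr (@rng_units G L); have Cs := Cc_indic R cs (@src_units G L).
have CL : Cc setT (cutoff L f) by apply: CcT; apply: Cc_cutoff Cf; exact: clopen_copen.
apply: bounded_op_ext; first exact: Ind_bounded.
  apply: bounded_op_comp; last exact: Ind_bounded (CcT Cs).
  by apply: bounded_op_comp; [exact: Ind_bounded (CcT Cr)|exact: Ind_bounded].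
move=> x y; have lf := (Ind_bounded Cf).1.
rewrite Ind_basis// -[RHS]/(Ind (unit_indic R (rng @` L))
  (Ind f (Ind (unit_indic R (src @` L)) (basis_vec R y))) x).
rewrite (Ind_indic _ cr (@rng_units G L)) (Ind_indic _ cs (@src_units G L)).
rewrite projE proj_basis.
have [rx|nrx] := pselect ((rng @` L) (rng x)); last first.
  rewrite [in RHS]memNset//; case: eqP => // yx; rewrite cutoff_out// => Lw.
  apply: nrx; exists (gmul x (ginv y)) => //.
  by rewrite rng_mul ?rng_inv.
rewrite [in RHS]mem_set//; have [sy|nsy] := pselect ((src @` L) (rng y)); last first.
  rewrite [in RHS]memNset// (linear_fun0 lf); case: eqP => // yx.
  rewrite cutoff_out// => Lw; apply: nsy; exists (gmul x (ginv y)) => //.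
  by rewrite src_mul ?rng_inv// src_inv.
rewrite [in RHS]mem_set// Ind_basis//; case: eqP => // yx.
have [Lw|nLw] := pselect (L (gmul x (ginv y))); first by rewrite cutoff_in.
rewrite cutoff_out//; apply/esym/eqP; apply: contrapT => /negP f0; apply: nLw.
apply: hL => //; first by rewrite rng_mul ?rng_inv.
by rewrite src_mul ?rng_inv// src_inv.
Qed.

(** Cutting [y] by the projections of [r(L)] and [s(L)], for the pieces [L] of a
    fine partition of [K], gives a block-diagonal element of [M]: the error
    [y - Ind f] is compressed to orthogonal blocks, so its norm does not
    increase, and the blocks see only the part of [f] on [K]. *)
Lemma block_approximation y f K (eps : R) : M y -> Cc setT f ->
  opbound (y - Ind f) eps -> 0 <= eps -> copen K -> bisection K ->
  (forall z w, K z -> supp f w -> rng w = rng z -> src w = src z -> K w) ->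
  exists2 y', M y' & opbound (y' - Ind (cutoff K f)) eps.
Proof.
move=> My Cf yf eps0 cK [rK sK] hK; have hG := @etale_hausdorff G.
have cutT L : copen L -> Cc setT (cutoff L f).
  by move=> cL; apply: CcT; apply: Cc_cutoff Cf; exact: clopen_copen.
pose S L := rng @^-1` (src @` L) : set G.
(* For a piece L of the partition of K, the error has range in the block of
   r(L) and only depends on the block of s(L). *)
pose E L := L `<=` K -> exists y', [/\ M y',
  forall xi x, ~ (rng @` L) (rng x) -> (y' - Ind (cutoff L f)) xi x = 0 &
  forall xi, l2norm ((y' - Ind (cutoff L f)) xi) <= eps * l2norm (restrict_to (S L) xi)].
have [||||U [cU KU HU]] := @copen_ind G E K hG.
- by case: cK.
- move=> _; exists 0; have -> : Ind (cutoff set0 f) = 0.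
    by rewrite -Ind0; congr Ind; apply/funext => x; rewrite cutoff_out.
  split; [by case: DM => _ []|by rewrite subrr|move=> xi].
  by rewrite subrr -[X in l2norm X]/(0 : l2 R G) l2norm0 mulr_ge0 ?l2norm_ge0.
- move=> L1 L2 cL1 cL2 L12 E1 E2 LK.
  have L1K : L1 `<=` K by move=> z Lz; apply: LK; left.
  have L2K : L2 `<=` K by move=> z Lz; apply: LK; right.
  have [y1 [M1 z1 n1]] := E1 L1K; have [y2 [M2 z2 n2]] := E2 L2K.
  have DE : (1 *: y1 + y2) - Ind (cutoff (L1 `|` L2) f) =
      (y1 - Ind (cutoff L1 f)) + (y2 - Ind (cutoff L2 f)).
    rewrite scale1r addrACA -opprD -(IndD (cutT _ cL1) (cutT _ cL2)).
    congr (_ - Ind _); apply/funext => x.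
    rewrite /cutoff in_setU; have [Lx|nLx] := pselect (L1 x).
      rewrite mem_set//= memNset ?addr0// => L2x.
      by rewrite -[False]/(set0 x) -L12.
    by rewrite memNset//= add0r.
  have rdis x : (rng @` L1) x -> ~ (rng @` L2) x.
    move=> [u Lu <-] [v Lv vu]; rewrite -[False]/(set0 u) -L12; split=> //.
    by rewrite -(rK v u) ?inE//; [exact: L2K|exact: L1K].
  have sdis x : (src @` L1) x -> ~ (src @` L2) x.
    move=> [u Lu <-] [v Lv vu]; rewrite -[False]/(set0 u) -L12; split=> //.
    by rewrite -(sK v u) ?inE//; [exact: L2K|exact: L1K].
  exists (1 *: y1 + y2); split; first exact: bimodule_comb.
    move=> xi x nx; rewrite DE -[LHS]/((y1 - Ind (cutoff L1 f)) xi x +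
      (y2 - Ind (cutoff L2 f)) xi x).
    by rewrite z1 ?z2 ?addr0// => -[u Lu ux]; apply: nx; exists u => //; [right|left].
  move=> xi; rewrite DE; set D1 := y1 - _ in z1 n1 *; set D2 := y2 - _ in z2 n2 *.
  rewrite -[X in l2norm X]/(D1 xi + D2 xi).
  pose B := rng @^-1` (rng @` L1) : set G.
  have p1 : restrict_to B (D1 xi + D2 xi) = D1 xi.
    apply: l2P => x; rewrite projE; have [Bx|nBx] := pselect (B x).
      by rewrite mem_set// l2DE z2 ?addr0//; exact: rdis.
    by rewrite memNset// z1.
  have p2 : restrict_to (~` B) (D1 xi + D2 xi) = D2 xi.
    apply: l2P => x; rewrite projE; have [Bx|nBx] := pselect (B x).
      by rewrite memNset; [rewrite z2//; exact: rdis|apply].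
    by rewrite mem_set// l2DE z1 ?add0r.
  have q1 : restrict_to (S L1) (restrict_to (S (L1 `|` L2)) xi) = restrict_to (S L1) xi.
    apply: l2P => x; rewrite !projE; have [Bx|nBx] := pselect (S L1 x).
      by rewrite !mem_set//; case: Bx => u Lu ux; exists u => //; left.
    by rewrite memNset.
  have q2 : restrict_to (~` S L1) (restrict_to (S (L1 `|` L2)) xi) = restrict_to (S L2) xi.
    apply: l2P => x; rewrite !projE; have [Bx|nBx] := pselect (S L1 x).
      by rewrite memNset; [rewrite memNset//; exact: sdis|apply].
    rewrite mem_set//; have [Cx|nCx] := pselect (S L2 x).
      by rewrite !mem_set//; case: Cx => u Lu ux; exists u => //; right.
    rewrite !memNset// => -[u [Lu|Lu] ux]; [apply: nBx|apply: nCx]; by exists u.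
  have lE := proj_pythagoras B (D1 xi + D2 xi); rewrite p1 p2 in lE.
  have rE := proj_pythagoras (S L1) (restrict_to (S (L1 `|` L2)) xi).
  rewrite q1 q2 in rE.
  rewrite -ler_sqr ?nnegrE ?mulr_ge0 ?l2norm_ge0// exprMn -lE -rE mulrDr -!exprMn.
  by apply: lerD; rewrite ler_sqr ?nnegrE ?mulr_ge0 ?l2norm_ge0.
- move=> z Kz.
  have [||N [cN Nz NK HN]] := @separating_neighbourhood K (supp f) z cK Kz.
  + by case: Cf.
  + by move=> w; exact: hK.
  exists N; split=> // L cL LN LK.
  have cr := copen_rng cL; have cs := copen_src cL.
  have bim a (b : G -> R[i]) : M a -> C0_units b -> M (a \o Ind b) /\ M (Ind b \o a).
    by case: DM => _ _ _; apply.
  have C0r := C0_Cc_units (Cc_indic R cr (@rng_units G L)).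
  have C0s := C0_Cc_units (Cc_indic R cs (@src_units G L)).
  have cE : Ind (cutoff L f) =
      Ind (unit_indic R (rng @` L)) \o Ind f \o Ind (unit_indic R (src @` L)).
    apply: compression_Ind => // w f0 [u Lu uw] [v Lv vw].
    have Kw : K w.
      by apply: (HN u v w (LN _ Lu) (LN _ Lv)) => //; exact: subset_closure.
    by rewrite -(rK u w) ?inE//; exact: LK.
  have DE xi : (Ind (unit_indic R (rng @` L)) \o y \o Ind (unit_indic R (src @` L)) -
      Ind (cutoff L f)) xi =
      restrict_to (rng @^-1` (rng @` L)) ((y - Ind f) (restrict_to (S L) xi)).
    rewrite cE; set P := Ind (unit_indic R (rng @` L)); set Q := Ind (unit_indic R (src @` L)).
    rewrite -[LHS]/(P (y (Q xi)) - P (Ind f (Q xi))).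
    rewrite /P /Q !(Ind_indic _ cr (@rng_units G L)) !(Ind_indic _ cs (@src_units G L)).
    by rewrite -(linear_funB _ _ (@proj_linear R G _)).
  exists (Ind (unit_indic R (rng @` L)) \o y \o Ind (unit_indic R (src @` L))); split.
  + have [_ My1] := bim _ _ My C0r.
    by have [] := bim _ _ My1 C0s.
  + by move=> xi x nx; rewrite DE projE memNset.
  + move=> xi; rewrite DE; apply: (le_trans (l2norm_proj _ _)); exact: yf.
have [//|y' [My' _ ny']] := HU K cK KU.
exists y' => // xi; apply: (le_trans (ny' xi)).
by rewrite ler_wpM2l// l2norm_proj.
Qed.

End local_spectral_synthesis.

(** * Spectral bimodules and invariance *)

Section graded_fibres.
Context (G : etaleGroupoidType) (Gamma : groupType) (c : G -> Gamma).
Hypothesis cc : continuous_cocycle c.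
Hypothesis pc : principal_on (c @^-1` [set 1%g]).

(** Two arrows of the same degree with the same ends differ by an isotropy
    element of the kernel of the cocycle, that is, by a unit. *)
Lemma graded_fibre_inj (x y : G) : c x = c y -> rng x = rng y -> src x = src y ->
  x = y.
Proof.
move=> cxy rxy sxy; have [_ cM] := cc.
have xyc : src x = rng (ginv y) by rewrite rng_inv.
have cV : c (ginv y) = (c y)^-1%g.
  have cu : c (rng y) = 1%g.
    by apply: (mulgI (c (rng y))); rewrite -cM ?src_rng ?rng_rng// mulg1 -{2}(src_rng y) gmul_src.
  by apply: (mulgI (c y)); rewrite -cM ?rng_inv// gmulxV cu mulgV.
have u : units (gmul x (ginv y)).
  apply: pc; first by rewrite /= cM// cV cxy mulgV.
  by rewrite rng_mul// src_mul// src_inv.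
rewrite -(gmulK sxy); move: u; rewrite /units/= src_mul// src_inv => <-.
exact: gmul_rng.
Qed.

End graded_fibres.

Section invariance.
Context (R : realType) (G : etaleGroupoidType).
Hypothesis td : totally_disconnected (@units G).
Context (M : set (l2 R G -> l2 R G)).
Hypothesis DM : diagonal_bimodule M.

(** Around a point where a homogeneous element of [M] does not vanish, [M]
    contains every function with small support: the restriction [h0] of the
    element to a compact open bisection [K] is a limit of elements of [M], and
    any function on [K] is [h0] times a function on the unit space. *)
Lemma local_synthesis (Gamma : groupType) (c : G -> Gamma) (y : l2 R G -> l2 R G) z :
  continuous_cocycle c -> principal_on (c @^-1` [set 1%g]) -> M y ->
  (forall eps : R, 0 < eps ->
     exists2 f, Cc (c @^-1` [set c z]) f & opbound (y - Ind f) eps) ->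
  jmap y z != 0 ->
  exists K, [/\ copen K, K z & forall h : G -> R[i], Cc K h -> M (Ind h)].
Proof.
move=> cc pc My Hy yz.
have Ay : Cstar_red y by case: DM => + _ _ _; apply.
pose V := c @^-1` [set c z] `&` [set w | jmap y w != 0].
have oV : open V.
  apply: openI; first by case: (grading_clopen cc (c z)).
  rewrite openE => w /= yw; rewrite /interior.
  have n0 : 0 < normc (jmap y w).
    rewrite lt_neqAle normc_ge0 andbT eq_sym; apply: contra_neq yw; exact: eq0_normc.
  have /ccontinuousP/(_ _ n0) : ccontinuous_at (jmap y) w by exact: jmap_continuous.
  apply: filterS => v; apply: contraTneq => ->.
  by rewrite subr0 ltxx.
have [K [cK Kz KV bK]] := etale_copen_basis td oV (conj erefl yz : V z).
have [rK sK] := bK.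
pose h0 : G -> R[i] := cutoff K (jmap y).
have Ch0 : Cc K h0 by apply: Cc_copen => // x _; exact: jmap_continuous.
have Mh0 : M (Ind h0).
  case: (DM) => _ _ Mc _; apply: Mc; apply: op_closureI.
    exact: Ind_bounded (CcT Ch0).
  move=> eps eps0; have e2 : 0 < eps / 2 by rewrite divr_gt0.
  have [f Cf yf] := Hy _ e2; have CfT := CcT Cf.
  have [|y' My' y'f] := @block_approximation R G td M DM y f K (eps / 2) My CfT yf (ltW e2) cK bK.
    move=> u w Ku fw rwu swu; suff -> : w = u by [].
    apply: (graded_fibre_inj cc pc) => //.
    have -> : c u = c z by have [] := KV u Ku.
    by case: Cf => _ _ /(_ w fw).
  exists y' => //.
  have Cfk : Cc K (cutoff K f) by apply: Cc_copen => // x _; exact: Cc_continuous Cf.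
  pose d : G -> R[i] := fun x => -1 * cutoff K f x + h0 x.
  have Cd : Cc K d by exact: Cc_comb.
  have dr w : normc (d w) <= eps / 2.
    rewrite /d /h0; have [Kw|nKw] := pselect (K w); last first.
      by rewrite !cutoff_out// mulr0 addr0 normc0 ltW.
    rewrite !cutoff_in// mulN1r addrC.
    by have := jmap_bound w yf; rewrite jmapB jmap_Ind.
  have := Ind_bisection_bound Cd bK (ltW e2) dr.
  rewrite (Ind_comb (-1) (CcT Cfk) (CcT Ch0)) scaleN1r => dB.
  have -> : Ind h0 - y' = (- Ind (cutoff K f) + Ind h0) - (y' - Ind (cutoff K f)).
    by rewrite opprB addrACA addNr add0r.
  by apply: le_opbound (opboundD dB (opboundN y'f)); lra.
have oK : open K by case: cK.
have [rh Hr] := local_section (@rng_open G) oK rK.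
exists K; split=> // h Ch.
pose b : G -> R[i] := cutoff (rng @` K) (fun u => h (rh u) * (jmap y (rh u))^-1).
have Cb : Cc (@units G) b.
  apply: (sub_Cc (@rng_units G K)); apply: Cc_copen; first exact: copen_rng.
  move=> _ [w Kw <-]; have [rw crw] := Hr w Kw.
  apply: ccontinuousM.
    apply: (@ccontinuous_comp _ _ _ rh h) => //; exact: Cc_continuous Ch.
  apply: ccontinuousV; first by rewrite rw; case: (KV w Kw).
  by apply: (@ccontinuous_comp _ _ _ rh (jmap y)) => //; exact: jmap_continuous.
have -> : Ind h = Ind b \o Ind h0.
  have ChT := CcT Ch; have Ch0T := CcT Ch0.
  apply: bounded_op_ext; first exact: Ind_bounded.
    by apply: bounded_op_comp; apply: Ind_bounded => //; exact: CcT Cb.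
  move=> x w; rewrite Ind_basis//= Ind_units// Ind_basis//.
  case: eqP => [wx|]; last by rewrite mulr0.
  have [Kxw|nK] := pselect (K (gmul x (ginv w))); last first.
    by rewrite (Cc_out Ch nK) (Cc_out Ch0 nK) mulr0.
  have rx : rng x = rng (gmul x (ginv w)) by rewrite rng_mul ?rng_inv.
  rewrite /h0 cutoff_in// /b rx cutoff_in; last by exists (gmul x (ginv w)).
  have [-> _] := Hr _ Kxw.
  by rewrite divfK//; case: (KV _ Kxw).
by case: DM => _ _ _ bim; have [] := bim _ _ Mh0 (C0_Cc_units Cb).
Qed.

Context (Gamma : groupType) (c : G -> Gamma)
  (delta : (l2 R G -> l2 R G) -> (l2 R (G * Gamma)%type -> l2 R (G * Gamma)%type)).
Hypothesis cc : continuous_cocycle c.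
Hypothesis dc : is_coaction c delta.
Hypothesis FA : Fourier_approximation R G.

Lemma Fourier_approx (a : l2 R G -> l2 R G) (eps : R) : Cstar_red a -> 0 < eps ->
  exists2 f, Cc (supp' a) f & opbound (a - Ind f) eps.
Proof.
move=> Aa eps0.
have [b [f Cf <-] af] : exists2 b, [set Ind f | f in Cc (supp' a)] b &
    opbound (a - b) eps.
  by apply: op_closure_approx (FA Aa) _ eps0 => _ [f Cf <-]; case: (Ind_bounded (CcT Cf)).
by exists f.
Qed.

Lemma left_reg_group_Cstar (t : Gamma) :
  group_Cstar_red (left_reg t : l2 R Gamma -> l2 R Gamma).
Proof.
apply: sub_op_closure; last by apply: sub_op_span; exists t.
split=> [k u v|]; first by apply: l2P => g; rewrite l2DE l2ZE !left_regE.
exists 1 => xi; rewrite mul1r; apply: l2norm_le; first exact: l2norm_ge0.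
rewrite sqr_l2norm.
apply: le_trans (@sqsum_le_inj R _ _ setT (fun g : Gamma => (t^-1 * g)%g) _ _).
  by apply: le_esum => g _; rewrite left_regE.
by move=> u v _ _ /=; exact: mulgI.
Qed.

(** For [a] in a spectral [M], the homogeneous pieces [f_t] of a function [f]
    supported in the open support of [a] are in [M], so [delta (Ind f)], the sum
    of the [Ind f_t (x) lambda_t], is in the span of elementary tensors; [delta]
    being bounded, this passes to the limit when [Ind f] tends to [a]. *)
Lemma spectral_invariant : spectral M -> coaction_invariant delta M.
Proof.
move=> sM a Ma; have Aa : Cstar_red a by case: DM => + _ _ _; apply.
apply: op_closureI; first exact: coaction_bounded_op dc _ Aa.
move=> eps eps0; have e2 : 0 < eps / 2 by rewrite divr_gt0.
have [f Cf af] := Fourier_approx Aa e2; have CfT := CcT Cf.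
have Af : Cstar_red (@Ind R G f) by exact: Ind_Cstar_red.
exists (delta (Ind f)); last first.
  rewrite -(coactionB dc Aa Af).
  have Aaf : Cstar_red (a - Ind f).
    have -> : a - Ind f = -1 *: Ind f + a by rewrite scaleN1r addrC.
    by case: (@Cstar_subspace R G) => _ AD; exact: (AD (-1) _ _ Af Aa).
  apply: le_opbound (coaction_contraction td dc Aaf e2 af); lra.
set S := [set T | _].
have [span0 spanD] := op_span_subspace S.
pose Phi (g : G -> R[i]) := op_span S (delta (Ind g)).
apply: (@graded_ind R G Gamma td c cc Phi f) => //.
- by rewrite /Phi Ind0 (coaction0 dc).
- move=> g h Cg Ch Sg Sh; rewrite /Phi (IndD Cg Ch).
  rewrite (coactionD dc (Ind_Cstar_red Cg) (Ind_Cstar_red Ch)) -[delta (Ind g)]scale1r.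
  exact: spanD.
- move=> t L cL Lt; have CL : Cc L (cutoff L f).
    by apply: Cc_copen => // x _; exact: Cc_continuous Cf.
  apply: sub_op_span; exists (Ind (cutoff L f)), (left_reg t); split.
  + rewrite sM; split; first exact: Ind_Cstar_red (CcT CL).
    move=> x nx; rewrite (jmap_Ind (CcT CL)) /cutoff; case: ifP => // _.
    apply/eqP; apply: contrapT => /negP fx; apply: nx; exists a => //.
    case: Cf => _ _ Cf; suff : supp' a x by [].
    by apply: Cf; exact: subset_closure.
  + exact: left_reg_group_Cstar.
  + exact: (coaction_Cc dc (sub_Cc Lt CL)).
Qed.

Hypothesis pc : principal_on (c @^-1` [set 1%g]).

(** Every point [z] of the spectrum is seen by a homogeneous element of [M], the
    slice at [c z] of [delta b], so local synthesis applies there. *)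
Lemma invariant_spectral : coaction_invariant delta M -> spectral M.
Proof.
move=> iM; have [MA Ms Mc _] := DM; have [M0 _] := Ms.
apply/seteqP; split=> [a Ma|a [Aa aS]].
  split; first exact: MA.
  move=> x nx; apply/eqP; apply: contrapT => /negP ax; apply: nx.
  by exists a.
apply: (Mc); apply: op_closureI; first by case: Aa.
move=> eps eps0; have [f Cf af] := Fourier_approx Aa eps0; have CfT := CcT Cf.
exists (Ind f) => //; pose Phi (g : G -> R[i]) := M (Ind g).
apply: (@Cc_ind R G Phi) => //; first by rewrite /Phi Ind0.
  move=> g h Cg Ch Mg Mh; rewrite /Phi (IndD Cg Ch) -[Ind g]scale1r.
  exact: bimodule_comb DM _ _ _ Mg Mh.
move=> z fz.
have [b Mb bz] : spectrum M z.
  apply: contrapT => nz; have := aS z nz; apply/eqP.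
  by case: Cf => _ _ /(_ z fz).
pose y := slice (c z) (delta b).
have My : M y by apply: slice_min_tensor Ms Mc (iM b Mb); exact: bimodule_bounded DM.
have Hy (e : R) : 0 < e -> exists2 g, Cc (c @^-1` [set c z]) g &
    opbound (y - Ind g) (2 * e) /\ normc (jmap b z - g z) <= e.
  move=> e0; have [g [Cg bg yg]] := coaction_approx td cc dc (c z) (MA _ Mb) e0.
  exists (cutoff (c @^-1` [set c z]) g).
    by apply: (sub_Cc _ (Cc_cutoff (grading_clopen cc (c z)) Cg)) => x [].
  split=> //; rewrite cutoff_in//.
  by have := jmap_bound z bg; rewrite jmapB jmap_Ind.
have yb : jmap y z = jmap b z.
  apply: (@complex_eq_eps _ _ _ 3) => // e /Hy[g Cg [yg bg]].
  have -> : jmap y z - jmap b z = (jmap y z - g z) - (jmap b z - g z) by ring.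
  apply: (le_trans (normc_add _ _)); rewrite normcN.
  have := jmap_bound z yg; rewrite jmapB (jmap_Ind (CcT Cg)).
  by move=> h; lra.
have [|||||K [cK Kz HK]] := @local_synthesis Gamma c y z.
- exact: cc.
- exact: pc.
- exact: My.
- move=> e e0; have [g Cg [yg _]] := Hy _ (divr_gt0 e0 (ltr0Sn R 1)).
  by exists g => //; apply: le_opbound yg; lra.
- by rewrite yb.
exists K; split=> // L cL LK; apply: HK; apply: (sub_Cc LK).
by apply: Cc_copen => // x _; exact: Cc_continuous Cf.
Qed.

End invariance.

End spectral_synthesis.

Local Open Scope classical_set_scope.
Local Open Scope group_scope.

Theorem theorem4p11 (R : realType) (G : etaleGroupoidType) (Gamma : groupType)
  (c : G -> Gamma) (P : set Gamma)
  (Lambda : Gamma -> Type) (U : forall p : Gamma, Lambda p -> set G)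
  (delta : (l2 R G -> l2 R G) ->
           (l2 R (G * Gamma)%type -> l2 R (G * Gamma)%type))
  (M : set (l2 R G -> l2 R G)) :
  Fourier_approximation R G ->
  countable [set: Gamma] -> infinite_set [set: Gamma] ->
  (exists g h : Gamma, g * h <> h * g) ->
  continuous_cocycle c ->
  totally_disconnected (@units G) ->
  P 1 -> (forall p q, P p -> P q -> P (p * q)) ->
  (forall g, exists p q, [/\ P p, P q & g = p * q^-1]) ->
  (forall g, exists p q, [/\ P p, P q & g = p^-1 * q]) ->
  amenable_on R (c @^-1` [set 1]) ->
  principal_on (c @^-1` [set 1]) ->
  (forall p i, P p ->
     [/\ compact (U p i), open (U p i) & bisection (U p i)]) ->
  (forall p, P p -> \bigcup_i U p i = c @^-1` [set p]) ->
  (forall p q i j, P p -> P q -> @src G @` U p i = @src G @` U q j ->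
     open (set_gmul (U p i) (set_ginv (U q j)))) ->
  (forall x : G, exists p q i j,
     [/\ P p, P q, @src G @` U p i = @src G @` U q j &
         set_gmul (U p i) (set_ginv (U q j)) x]) ->
  is_coaction c delta ->
  diagonal_bimodule M ->
  spectral M <-> coaction_invariant delta M.
Proof.
move=> FA _ _ _ cc td _ _ _ _ _ pc _ _ _ _ dc DM; split.
  exact: (spectral_invariant td DM cc dc FA).
exact: (invariant_spectral td DM cc dc FA pc).
Qed.
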